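(* Let $p \in (0, \infty]$ and $q \in (0, \infty)$, and let $\boldsymbol{\sigma} = ((\sigma_{n, i})_{i=1}^n)_{n \in \mathbb{N}} \in \prod_{n \in \mathbb{N}} (0, \infty)^n$ be a triangular array of positive reals; write $\sigma_n := (\sigma_{n,i})_{i=1}^n$. Assume that the limit $$F_{q, \boldsymbol{\sigma}} := \lim_{n \to \infty}\biggl[ \biggl( \prod_{i = 1}^n \sigma_{n, i} \biggr)^{\frac{1}{n}} \biggl( \frac{1}{n} \sum_{i = 1}^n \sigma_{n, i}^{-q} \biggr)^{\frac{1}{q}} \biggr]$$ exists and $F_{q,\boldsymbol{\sigma}}<\infty$, that $$\lim_{n \to \infty} \biggl[ \biggl( \prod_{i = 1}^n \sigma_{n, i} \biggr)^{\frac{2 q}{n}} \frac{1}{n^2} \sum_{i = 1}^n \sigma_{n, i}^{-2 q} \biggr] = 0,\qquad \lim_{n \to \infty} \frac{\max_{1 \leq i \leq n} \sigma_{n, i}^{-2 q}}{\sum_{i = 1}^n \sigma_{n, i}^{-2 q}} = 0,$$ and, in the case $p < \infty$, that the limit $$G_{q, \boldsymbol{\sigma}} := \lim_{n \to \infty} \frac{\sum_{i = 1}^n \sigma_{n, i}^{-q}}{\sqrt{n} \bigl( \sum_{i = 1}^n \sigma_{n, i}^{-2 q} \bigr)^{1/2}}$$ exists. Assume moreover that $p\neq q$ or $G_{q,\boldsymbol{\sigma}}<1$, and let $s>0$ be given by $$s^2 := \frac{V_p(q)}{q^2 M_p(q)^2} - \frac{2 C_p(p, q) G_{q, \boldsymbol{\sigma}}^2}{p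 q M_p(q)} + \frac{G_{q, \boldsymbol{\sigma}}^2}{p}.$$ Define, for $n \in \mathbb{N}$, $$h_n := \frac{\bigl( \prod_{i = 1}^n \sigma_{n, i} \bigr)^{1/n} \bigl( \frac{1}{n} \sum_{i = 1}^n \sigma_{n, i}^{-q} \bigr)^{1/q}}{F_{q, \boldsymbol{\sigma}}}.$$ Then in the critical case $t_{\mathrm{crit}} = A_{p, q}^{-1} \, F_{q, \boldsymbol{\sigma}}$, if the limit $$z := \lim_{n \to \infty} \frac{\sum_{i = 1}^n \sigma_{n, i}^{-q}}{\bigl( \sum_{i = 1}^n \sigma_{n, i}^{-2 q} \bigr)^{1/2}} (h_n - 1) \in [-\infty, \infty]$$ exists, it holds that $$\lim_{n \to \infty} \operatorname{vol}_n\bigl(\mathbb{D}_p^n \cap t_{\mathrm{crit}}\, \widetilde{\mathcal{E}}_{q, \sigma_n}^n\bigr) = \Phi\Bigl( -\frac{z}{s} \Bigr),$$ where $\Phi$ is the cumulative distribution function of the standard normal distribution (with $\Phi(-\infty)=0$, $\Phi(\infty)=1$).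
   Context: For $0<p\le\infty$ and $x\in\mathbb{R}^n$: $\lVert x\rVert_p := (\sum_{i=1}^n |x_i|^p)^{1/p}$ if $p<\infty$, $\lVert x\rVert_\infty := \max_i |x_i|$. $\mathbb{B}_p^n := \{x\in\mathbb{R}^n : \lVert x\rVert_p\le 1\}$; $\operatorname{vol}_n$ is Lebesgue measure; $r_{n,p} := \operatorname{vol}_n(\mathbb{B}_p^n)^{-1/n}$ and $\mathbb{D}_p^n := r_{n,p}\mathbb{B}_p^n$. For $\sigma=(\sigma_1,\dots,\sigma_n)\in(0,\infty)^n$ and $q<\infty$, the $q$-ellipsoid with semi-axes $\sigma_1,\dots,\sigma_n$ is $\mathcal{E}_{q,\sigma}^n := \{x\in\mathbb{R}^n : \sum_{i=1}^n |x_i/\sigma_i|^q\le 1\}$, and its unit-volume dilation is $\widetilde{\mathcal{E}}_{q,\sigma}^n := \operatorname{vol}_n(\mathcal{E}_{q,\sigma}^n)^{-1/n}\,\mathcal{E}_{q,\sigma}^n$. The $p$-Gaussian distribution $\gamma_p$ on $\mathbb{R}$ has density $\frac{1}{2p^{1/p}\Gamma(\frac1p+1)}e^{-|x|^p/p}$ if $p<\infty$, and $\frac12 1_{[-1,1]}(x)$ if $p=\infty$. For $X\sim\gamma_p$: $M_p(q) := \mathbb{E}[|X|^q]$, $V_p(q) := \operatorname{Var}[|X|^q]$, $C_p(q,r) := \operatorname{Cov}[|X|^q,|X|^r]$, with the convention $C_\infty(\infty,q):=0$. Convention: $1/\infty=0$; thus for $p=\infty$ one has $s^2=\frac{V_\infty(q)}{q^2M_\infty(q)^2}$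 (the terms involving $G_{q,\boldsymbol{\sigma}}$ vanish, whether or not that limit exists). The constant $A_{p,q}$ is $$A_{p, q} := M_p(q)^{-\frac{1}{q}} \lim_{n \to \infty} \frac{n^{-\frac{1}{q}} \, r_{n, q}}{n^{-\frac{1}{p}} \, r_{n, p}} = \begin{cases} \dfrac{\Gamma(1 + \frac{1}{p})^{1 + 1/q}}{\Gamma(1 + \frac{1}{q})\, \Gamma(\frac{q + 1}{p})^{1/q}} \, e^{\frac{1}{p} - \frac{1}{q}} \, \bigl( \frac{p}{q} \bigr)^{\frac{1}{q}} & \text{if } p < \infty,\\[2mm] \dfrac{1}{\Gamma(1 + \frac{1}{q})} \bigl( \frac{q + 1}{q e} \bigr)^{\frac{1}{q}} & \text{if } p = \infty. \end{cases}$$ Under the stated hypotheses $F_{q,\boldsymbol{\sigma}}\ge 1$ and $s^2>0$, so the divisions make sense. *)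

(* Defs.v *)
From HB Require Import structures.
From mathcomp Require Import all_boot all_order all_algebra.
From mathcomp Require Import all_classical all_reals all_analysis.
From mathcomp Require Import measurable_realfun.
From mathcomp Require Import ring lra.
Set Implicit Arguments.
Unset Strict Implicit.
Unset Printing Implicit Defensive.
Import Order.TTheory GRing.Theory Num.Theory.
Import numFieldNormedType.Exports.
Local Open Scope classical_set_scope.
Local Open Scope ring_scope.

Section cons_measure.
Context {R : realType} (n : nat).
Notation RT := (measurableTypeR R).
Variable m : {sigma_finite_measure set (n.-tuple RT) -> \bar R}.

Definition tcons (x : RT * n.-tuple RT) : n.+1.-tuple RT :=
  [the n.+1.-tuple RT of x.1 :: x.2].

Lemma measurable_tcons : measurable_fun [set: RT * n.-tuple RT] tcons.
Proof. exact: measurable_cons. Qed.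

Definition cons_measure : set (n.+1.-tuple RT) -> \bar R :=
  pushforward (@lebesgue_measure R \x m)%E tcons.

Let cons_measure0 : cons_measure set0 = 0%E.
Proof. by rewrite /cons_measure /pushforward preimage_set0 measure0. Qed.

Let cons_measure_ge0 A : (0 <= cons_measure A)%E.
Proof. by rewrite /cons_measure /pushforward measure_ge0. Qed.

Let cons_measure_sigma_additive : semi_sigma_additive cons_measure.
Proof.
exact: (@measure_semi_sigma_additive _ _ _
  (measure_function_pushforward__canonical__measure_function_Measure
     (@lebesgue_measure R \x m)%E measurable_tcons)).
Qed.

HB.instance Definition _ := isMeasure.Build _ _ _ cons_measure
  cons_measure0 cons_measure_ge0 cons_measure_sigma_additive.

Lemma measurable_cons_rect (A : set RT) (B : set (n.-tuple RT)) :
  measurable A -> measurable B ->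
  measurable [set x : n.+1.-tuple RT | A (thead x) /\ B [tuple of behead x]].
Proof.
move=> mA mB; apply: measurableI.
- by rewrite -[X in measurable X]setTI; exact: (@measurable_tnth _ RT).
- by rewrite -[X in measurable X]setTI; exact: (@measurable_behead _ RT).
Qed.

Lemma cons_measureX (A : set RT) (B : set (n.-tuple RT)) :
  measurable A -> measurable B ->
  cons_measure [set x | A (thead x) /\ B [tuple of behead x]] =
  (lebesgue_measure A * m B)%E.
Proof.
move=> mA mB; rewrite /cons_measure /pushforward.
rewrite (_ : _ @^-1` _ = A `*` B) ?product_measure1E//.
apply/seteqP; split => -[a t]/=; rewrite theadE => -[Aa].
- by rewrite (_ : [tuple of _] = t)//; exact/val_inj.
- by rewrite (_ : [tuple of _] = t)//; exact/val_inj.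
Qed.

Let cons_measure_sigma_finite : sigma_finite setT cons_measure.
Proof.
have /sigma_finiteP[F [TF ndF Foo]] := sigma_finiteT (@lebesgue_measure R).
have /sigma_finiteP[G [TG ndG Goo]] := sigma_finiteT m.
exists (fun k => [set x : n.+1.-tuple RT |
    F k (thead x) /\ G k [tuple of behead x]]).
  apply/esym; rewrite -subTset => x _.
  have : setT (thead x) by [].
  rewrite TF => -[i _ Fi].
  have : setT [tuple of behead x] by [].
  rewrite TG => -[j _ Gj].
  exists (maxn i j) => //; split.
    by move: Fi; exact/subsetPset/ndF/leq_maxl.
  by move: Gj; exact/subsetPset/ndG/leq_maxr.
move=> k; have [mF Fk] := Foo k; have [mG Gk] := Goo k; split.
  exact: measurable_cons_rect.
by rewrite cons_measureX// lte_mul_pinfty// ge0_fin_numE.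
Qed.

HB.instance Definition _ := Measure_isSigmaFinite.Build _ _ _ cons_measure
  cons_measure_sigma_finite.

End cons_measure.

(* Lebesgue measure on R^n, vectors being n-tuples with the product
   sigma-algebra: the iterated product of the Lebesgue measure on R. *)
Fixpoint vol {R : realType} (n : nat) :
    {sigma_finite_measure set (n.-tuple (measurableTypeR R)) -> \bar R} :=
  if n is n'.+1 then cons_measure (vol n') else \d_[tuple].

Lemma measurable_box {R : realType} n (A : 'I_n -> set (measurableTypeR R)) :
  (forall i, measurable (A i)) ->
  measurable [set x : n.-tuple (measurableTypeR R) | forall i, A i (tnth x i)].
Proof.
elim: n A => [|n IHn] A mA.
  by rewrite (_ : [set _ | _] = setT)//; apply/seteqP; split => // x _ [].
have -> : [set x : n.+1.-tuple (measurableTypeR R) | forall i, A i (tnth x i)] =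
    [set x | A ord0 (thead x) /\
       forall i, A (lift ord0 i) (tnth [tuple of behead x] i)].
  apply/seteqP; split => x /=.
    move=> Ax; split; first exact: Ax.
    by move=> i; have := Ax (lift ord0 i); rewrite {1}(tuple_eta x) tnthS.
  move=> [Ax0 Ax] i; have [j ->|->//] := unliftP ord0 i.
  by rewrite (tuple_eta x) tnthS.
apply: (@measurable_cons_rect _ _ _
  [set x | forall i, A (lift ord0 i) (tnth x i)]) => //.
exact: (IHn (fun i => A (lift ord0 i))).
Qed.

Lemma vol_box {R : realType} n (A : 'I_n -> set (measurableTypeR R)) :
  (forall i, measurable (A i)) ->
  vol n [set x | forall i, A i (tnth x i)] =
  (\prod_(i < n) lebesgue_measure (A i))%E.
Proof.
elim: n A => [|n IHn] A mA.
  by rewrite big_ord0 /= diracE mem_set//= => -[].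
rewrite big_ord_recl -IHn//= -cons_measureX//; last first.
  exact: (@measurable_box _ _ (fun i => A (lift ord0 i))).
congr (cons_measure _ _); apply/seteqP; split => x /=.
  move=> Ax; split; first exact: Ax.
  by move=> i; have := Ax (lift ord0 i); rewrite {1}(tuple_eta x) tnthS.
move=> [Ax0 Ax] i; have [j ->|->//] := unliftP ord0 i.
by rewrite (tuple_eta x) tnthS.
Qed.

Definition Gamma {R : realType} (a : R) : R :=
  \int[lebesgue_measure]_(t in `]0, +oo[) (t `^ (a - 1) * expR (- t)).

Section pgaussian_mass.
Context {R : realType}.
Notation mu := (@lebesgue_measure R).
Notation RT := (measurableTypeR R).
Local Open Scope ereal_scope.

Lemma integral_expRN (y : R) :
  \int[mu]_(t in `[y, +oo[) (expR (- t))%:E = (expR (- y))%:E.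
Proof.
rewrite (@ge0_continuous_FTC2y _ _ (fun x => - expR (- x))%R y 0)//.
- by rewrite sub0e -EFinN opprK.
- apply: continuous_subspaceT => x.
  by apply: continuous_comp; [exact: opp_continuous|exact: continuous_expR].
- by rewrite -oppr0; apply: cvgN; exact: cvgr_expR.
- apply: cvgN; apply/cvg_at_right_filter.
  by apply: continuous_comp; [exact: opp_continuous|exact: continuous_expR].
- move=> x _; rewrite derive1N//.
  rewrite derive1_comp// derive1N// derive1_id mulrN1 opprK derive1E.
  by have /funeqP -> := @derive_expR R.
Qed.

Lemma integral_Gamma_lty (a : R) : (0 < a)%R ->
  \int[mu]_(t in `]0%R, +oo[) (t `^ a * expR (- t))%:E < +oo.
Proof.
move=> a0; set C := (2 * (2 * a) `^ a)%R.
have C0 : (0 <= C)%R by rewrite mulr_ge0 ?powR_ge0.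
pose g t : \bar R := C%:E * (exponential_pdf 2^-1 t)%:E.
have mg : measurable_fun setT g.
  apply: measurable_funeM; apply/measurable_EFinP.
  exact: measurable_exponential_pdf.
have g0 x : 0 <= g x.
  by rewrite mule_ge0// lee_fin exponential_pdf_ge0.
apply: (@le_lt_trans _ _ (\int[mu]_(t in `]0%R, +oo[) g t)).
  apply: ge0_le_integral => //.
  - by move=> t _; rewrite lee_fin mulr_ge0 ?powR_ge0 ?expR_ge0.
  - apply/measurable_EFinP/measurable_funM.
      by apply: measurable_funTS; exact: measurable_powR.
    by apply: measurableT_comp.
  - exact: measurable_funTS.
  move=> t /=; rewrite in_itv/= andbT => t0.
  rewrite /g -EFinM lee_fin exponential_pdfE ?(ltW t0)//.
  rewrite /C mulrACA mulfV// mul1r.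
  have -> : expR (- t) = ((expR (t / 2))^-1 * expR (- 2^-1 * t))%R.
    by rewrite -expRN -expRD; congr expR; field.
  rewrite mulrA ler_wpM2r ?expR_ge0//.
  rewrite ler_pdivrMr ?expR_gt0//.
  rewrite /powR !gt_eqF ?mulr_gt0// -expRD ler_expR.
  have := ln_sublinear (divr_gt0 t0 (mulr_gt0 (ltr0n R 2) a0)).
  rewrite ln_div ?posrE ?mulr_gt0// ltrBlDr => /ltW.
  rewrite -(ler_pM2l a0) => /le_trans; apply.
  rewrite mulrDr addrC lerD2l le_eqVlt; apply/orP; left; apply/eqP.
  by field; rewrite gt_eqF.
apply: (@le_lt_trans _ _ (\int[mu]_t g t)).
  exact: ge0_subset_integral.
rewrite /g ge0_integralZl_EFin//.
- by rewrite integral_exponential_pdf// mule1 ltry.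
- by move=> x _; rewrite lee_fin exponential_pdf_ge0.
- by apply/measurable_EFinP; exact: measurable_exponential_pdf.
Qed.

Lemma integral_Gamma_gt0 (a : R) : (0 <= a)%R ->
  0 < \int[mu]_(t in `]0%R, +oo[) (t `^ a * expR (- t))%:E.
Proof.
move=> a0.
apply: (@lt_le_trans _ _ (\int[mu]_(t in `[1%R, 2%R]) (cst (expR (- 2))%:E t))).
  rewrite integral_cst//= lebesgue_measure_itv/= lte_fin ltr1n -EFinB -EFinM.
  by rewrite lte_fin mulr_gt0 ?expR_gt0// subr_gt0 ltr1n.
have mgam (D : set RT) : measurable_fun D (fun t : RT => (t `^ a * expR (- t))%:E).
  apply: measurable_funTS; apply/measurable_EFinP/measurable_funM.
    exact: measurable_powR.
  by apply: measurableT_comp.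
apply: (@le_trans _ _ (\int[mu]_(t in `[1%R, 2%R]) (t `^ a * expR (- t))%:E)).
  apply: ge0_le_integral => //; first by move=> t _; rewrite lee_fin expR_ge0.
  move=> t /=; rewrite in_itv/= lee_fin => /andP[t1 t2].
  rewrite -[leLHS]mul1r ler_pM ?expR_ge0// ?ler_expR ?lerN2//.
  by rewrite -(powRr0 t) ler_powR.
apply: ge0_subset_integral => //.
- by move=> t _; rewrite lee_fin mulr_ge0 ?powR_ge0 ?expR_ge0.
- by move=> t /=; rewrite !in_itv/= andbT => /andP[t1 _]; exact: lt_le_trans t1.
Qed.

Variable r : R.
Hypothesis r0 : (0 < r)%R.

Let y (x : RT) : R := (`|x| `^ r / r)%R.

Let y_ge0 x : (0 <= y x)%R.
Proof. by rewrite /y divr_ge0 ?powR_ge0// ltW. Qed.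

Let measurable_y : measurable_fun setT y.
Proof.
apply: measurable_funM => //.
by apply: (measurableT_comp (measurable_powR r)); exact: normr_measurable.
Qed.

Let E : set (RT * RT) := [set z : RT * RT | (y z.1 <= z.2)%R].

Let f (z : RT * RT) : \bar R := (\1_E z * expR (- z.2))%:E.

Let measurable_f : measurable_fun setT f.
Proof.
apply/measurable_EFinP; apply: measurable_funM.
  apply: measurable_indic; rewrite -[E]setTI.
  apply: measurable_fun_le => //.
  by apply: (measurableT_comp measurable_y); exact: measurable_fst.
apply: measurableT_comp => //.
by apply: measurableT_comp => //; exact: measurable_snd.
Qed.

Let f_ge0 z : 0 <= f z.
Proof. by rewrite lee_fin mulr_ge0 ?expR_ge0// indicE. Qed.

Let measurable_y_le t : measurable [set x : RT | (y x <= t)%R].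
Proof. by rewrite -[X in measurable X]setTI; exact: measurable_fun_le. Qed.

Let y_le t : (0 <= t)%R ->
  [set x : RT | (y x <= t)%R] = `[(- (r * t) `^ r^-1)%R, ((r * t) `^ r^-1)%R]%classic.
Proof.
move=> t0; have rt0 : (0 <= r * t)%R by rewrite mulr_ge0// ltW.
apply/seteqP; split => x /=; rewrite in_itv/= -ler_norml /y ler_pdivrMr//.
- move=> xt.
  rewrite -[leLHS]powRr1// -(@mulfV _ r) ?gt_eqF// powRrM.
  by rewrite ge0_ler_powR ?nnegrE ?invr_ge0 ?powR_ge0 ?(ltW r0)// mulrC.
- move=> /(@ge0_ler_powR _ r (ltW r0)).
  rewrite !nnegrE normr_ge0 powR_ge0 => /(_ isT isT).
  by rewrite -powRrM mulVf ?gt_eqF// powRr1// mulrC.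
Qed.

Lemma integral_pgauss_fun :
  \int[mu]_x (expR (- y x))%:E =
  (2 * r `^ r^-1)%:E * \int[mu]_(t in `]0%R, +oo[) (t `^ r^-1 * expR (- t))%:E.
Proof.
have -> : \int[mu]_x (expR (- y x))%:E = \int[mu]_x \int[mu]_t f (x, t).
  apply: eq_integral => x _; rewrite -integral_expRN integral_mkcond.
  apply: eq_integral => t _; rewrite /f/= indicE patchE mem_setE in_itv/= andbT.
  rewrite (_ : ((x, t) \in E) = (y x <= t)%R); last by apply/idP/idP; rewrite inE.
  by case: ifPn => ht; rewrite ?mul1r ?mul0r.
rewrite (@fubini_tonelli _ _ _ _ _ mu mu f)//=.
rewrite -ge0_integralZl_EFin//=; last 3 first.
- by move=> t _; rewrite lee_fin mulr_ge0 ?powR_ge0 ?expR_ge0.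
- apply/measurable_EFinP/measurable_funM.
    by apply: measurable_funTS; exact: measurable_powR.
  by apply: measurableT_comp.
- by rewrite mulr_ge0 ?powR_ge0.
rewrite [RHS]integral_mkcond; apply: eq_integral => t _.
rewrite patchE.
have -> : \int[mu]_x f (x, t) = (expR (- t))%:E * mu [set x : RT | (y x <= t)%R].
  have ind x : \1_E (x, t) = \1_[set x : RT | (y x <= t)%R] x :> R.
    by rewrite !indicE; congr (_%:R); apply/idP/idP; rewrite !inE.
  rewrite (eq_integral (fun x : RT => (expR (- t))%:E *
      (\1_[set x : RT | (y x <= t)%R] x)%:E)); last first.
    by move=> x _; rewrite /f ind/= mulrC EFinM.
  rewrite ge0_integralZl_EFin ?expR_ge0//.
  by rewrite integral_indic// setIT.
  by apply/measurable_EFinP; exact: measurable_indic.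
case: ifPn => [|].
  rewrite inE/= in_itv/= andbT => t0.
  rewrite y_le ?(ltW t0)// lebesgue_measure_itv/= lte_fin.
  have rt0 : (0 < (r * t) `^ r^-1)%R by rewrite powR_gt0 ?mulr_gt0.
  rewrite gtrN// -EFinB -!EFinM; congr EFin.
  by rewrite opprK powRM ?(ltW t0) ?(ltW r0)//; ring.
rewrite notin_setE/= in_itv/= andbT => /negP; rewrite -leNgt le_eqVlt.
move=> /predU1P[->|t0].
  rewrite y_le// mulr0 powR0 ?invr_eq0 ?gt_eqF// oppr0.
  by rewrite lebesgue_measure_itv/= lte_fin ltxx mule0.
rewrite (_ : [set x | _] = set0) ?measure0 ?mule0//.
by apply/seteqP; split => x //=; rewrite leNgt (lt_le_trans t0).
Qed.

End pgaussian_mass.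

(* The density is meant for p in ]0, +oo]. Any other p is sent to the uniform
   density so that pgauss p is a probability for every p : \bar R. *)
Definition pgauss_pdf {R : realType} (p : \bar R) (x : R) : R :=
  if (0 < p < +oo)%E then
    let r := fine p in
    (2 * r `^ r^-1 * Gamma (r^-1 + 1))^-1 * expR (- (`|x| `^ r / r))
  else 2^-1 * \1_(`[-1, 1]%classic : set R) x.

Definition pgauss {R : realType} (p : \bar R) :
    set (measurableTypeR R) -> \bar R :=
  fun A => (\int[lebesgue_measure]_(x in A) (pgauss_pdf p x)%:E)%E.

Section pgauss_probability.
Context {R : realType} (p : \bar R).
Notation mu := (@lebesgue_measure R).
Notation RT := (measurableTypeR R).
Local Open Scope ereal_scope.

Let GammaE (r : R) : (0 < r)%R ->
  (Gamma (r^-1 + 1))%:E =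
    \int[mu]_(t in `]0%R, +oo[) (t `^ r^-1 * expR (- t))%:E /\
  (0 < Gamma (r^-1 + 1))%R.
Proof.
move=> r0; rewrite /Gamma addrK.
have r10 : (0 < r^-1)%R by rewrite invr_gt0.
have Ioo := integral_Gamma_lty r10; have I0 := integral_Gamma_gt0 (ltW r10).
split; first by rewrite /Rintegral fineK// ge0_fin_numE// ltW.
by rewrite /Rintegral fine_gt0// I0 Ioo.
Qed.

Lemma pgauss_pdf_ge0 x : (0 <= pgauss_pdf p x)%R.
Proof.
rewrite /pgauss_pdf; case: ifPn => [/andP[p0 poo]|_]; last first.
  by rewrite mulr_ge0// indicE.
have r0 : (0 < fine p)%R by rewrite fine_gt0// p0.
by rewrite mulr_ge0 ?expR_ge0// invr_ge0 !mulr_ge0 ?powR_ge0 ?ltW ?(GammaE r0).2.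
Qed.

Lemma measurable_pgauss_pdf : measurable_fun [set: RT] (pgauss_pdf p).
Proof.
rewrite /pgauss_pdf; case: (0 < p < +oo); last first.
  by apply: measurable_funM => //; exact: measurable_indic.
apply: measurable_funM => //; apply: measurableT_comp => //.
apply: measurableT_comp => //; apply: measurable_funM => //.
by apply: (measurableT_comp (measurable_powR _)); exact: normr_measurable.
Qed.

Let pgauss0 : pgauss p set0 = 0.
Proof. by rewrite /pgauss integral_set0. Qed.

Let pgauss_ge0 A : 0 <= pgauss p A.
Proof. by apply: integral_ge0 => x _; rewrite lee_fin pgauss_pdf_ge0. Qed.

Let pgauss_sigma_additive : semi_sigma_additive (pgauss p).
Proof.
move=> /= F mF tF mUF; rewrite /pgauss; apply: cvg_toP.
  apply: ereal_nondecreasing_is_cvgn => m n mn.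
  apply: lee_sum_nneg_natr => // k _ _; apply: integral_ge0 => /= x Fkx.
  by rewrite lee_fin pgauss_pdf_ge0.
rewrite ge0_integral_bigcup//=.
- apply/measurable_funTS/measurableT_comp => //.
  exact: measurable_pgauss_pdf.
- by move=> x _; rewrite lee_fin pgauss_pdf_ge0.
Qed.

HB.instance Definition _ := isMeasure.Build _ _ _ (pgauss p)
  pgauss0 pgauss_ge0 pgauss_sigma_additive.

Let pgauss_setT : pgauss p setT = 1.
Proof.
rewrite /pgauss /pgauss_pdf; case: (boolP (0 < p < +oo)) => [/andP[p0 poo]|_].
  set r := fine p; have r0 : (0 < r)%R by rewrite fine_gt0// p0.
  have [GE G0] := GammaE r0.
  set c := (_ * Gamma _)%R.
  have c0 : (0 < c)%R by rewrite !mulr_gt0// powR_gt0.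
  under eq_integral do rewrite EFinM.
  rewrite ge0_integralZl_EFin//; last 2 first.
    apply/measurable_EFinP; apply: measurableT_comp => //.
    apply: measurableT_comp => //; apply: measurable_funM => //.
    by apply: (measurableT_comp (measurable_powR _)); exact: normr_measurable.
    by rewrite invr_ge0 ltW.
  rewrite integral_pgauss_fun// -GE -!EFinM.
  by rewrite mulVf// gt_eqF.
under eq_integral do rewrite EFinM.
rewrite ge0_integralZl_EFin//; last first.
  by apply/measurable_EFinP; exact: measurable_indic.
rewrite integral_indic//= setIT lebesgue_measure_itv/= lte_fin gtrN//.
by rewrite -EFinB -EFinM; congr EFin; field.
Qed.

HB.instance Definition _ := @Measure_isProbability.Build _ _ R
  (pgauss p) pgauss_setT.

End pgauss_probability.

Section pgauss_moments.
Context {R : realType}.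
Implicit Types (p : \bar R) (q : R).

Definition pgauss_moment p q : R :=
  fine ('E_(pgauss p)[(fun x => `|x| `^ q)%R])%E.

Definition pgauss_var p q : R :=
  fine (variance (pgauss p) (fun x => `|x| `^ q)).

(* The first exponent may be +oo, to express the convention
   C_oo(oo, q) = 0. *)
Definition pgauss_cov p (a : \bar R) q : R :=
  if a is r%:E then
    fine (covariance (pgauss p) (fun x => `|x| `^ r) (fun x => `|x| `^ q))
  else 0.

End pgauss_moments.

Section bodies.
Context {R : realType} (n : nat).
Notation vec := (n.-tuple (measurableTypeR R)).

Definition dilate (c : R) (A : set vec) : set vec :=
  [set [tuple c * tnth x i | i < n] | x in A].

Definition unit_vol_factor (A : set vec) : R :=
  fine (vol n A) `^ (- n%:R^-1).

Definition unit_dilation (A : set vec) : set vec :=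
  dilate (unit_vol_factor A) A.

Definition lp_norm (p : \bar R) (x : vec) : R :=
  if p is r%:E then (\sum_(i < n) `|tnth x i| `^ r) `^ r^-1
  else \big[Num.max/0]_(i < n) `|tnth x i|.

Definition lp_ball (p : \bar R) : set vec := [set x | lp_norm p x <= 1].

Definition ellipsoid (q : R) (sigma : 'I_n -> R) : set vec :=
  [set x | \sum_(i < n) `|tnth x i / sigma i| `^ q <= 1].

End bodies.
Arguments lp_ball {R} n p.

Definition lp_radius {R : realType} (n : nat) (p : \bar R) : R :=
  unit_vol_factor (lp_ball n p).

(* In \bar R, +oo^-1 = 0, so fine p^-1 is 1/p with the convention 1/oo = 0. *)

Definition Apq {R : realType} (p : \bar R) (q : R) : R :=
  pgauss_moment p q `^ (- q^-1) *
  lim ((n%:R `^ (- q^-1) * lp_radius n q%:E) /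
       (n%:R `^ (- fine p^-1%E) * lp_radius n p) @[n --> \oo]).

Definition s2 {R : realType} (p : \bar R) (q G : R) : R :=
  pgauss_var p q / (q ^+ 2 * pgauss_moment p q ^+ 2)
  - 2 * pgauss_cov p p q * G ^+ 2 * fine p^-1%E / (q * pgauss_moment p q)
  + G ^+ 2 * fine p^-1%E.

(* The distribution function of N(0, 1), extended to \bar R: the set is empty
   at -oo and full at +oo. *)
Definition Phi {R : realType} (x : \bar R) : \bar R :=
  normal_prob 0 1 [set y : R | (y%:E <= x)%E].

(* Main.v *)
(* Let B be the unit p-ball. After rescaling, the volume is that of the part of B where
   [sum_i |x_i / sigma_i|^q <= kappa_n^q], divided by the volume of B. For p < oo all but a fraction
   (1 - e)^n of B lies outside of (1 - e) B, so up to replacing kappa_n by kappa_n / (1 - e) the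
   condition may be made homogeneous, [sum_i |x_i / sigma_i|^q <= kappa_n^q * ||x||_p^q]. The fraction
   of B in this cone is its probability under the product of p-Gaussian laws, because their density is
   a function of ||x||_p; for p = oo the product law is the uniform law on B itself. Taking logarithms
   and linearizing at the means (with Chebyshev's inequality for the remainder), the cone becomes the
   event that a sum of independent centered variables is at most a_n rho_n, where
   a_n = sum_i sigma_i^-q / (sum_i sigma_i^-2q)^(1/2), the variance of the sum tends to s^2, and
   rho_n = - ln h_n + O(ln n / n) by Stirling-type bounds on the radii of the balls. As a_n <= n^(1/2)
   and a_n -> oo, a_n rho_n -> - z, and Lindeberg's central limit theorem gives the limit. *)
Require Import Defs.
From HB Require Import structures.
From mathcomp Require Import all_boot all_order all_algebra.
From mathcomp Require Import all_classical all_reals all_analysis.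
From mathcomp Require Import measurable_realfun.
From mathcomp Require Import ring lra.
Set Implicit Arguments.
Unset Strict Implicit.
Unset Printing Implicit Defensive.
Import Order.TTheory GRing.Theory Num.Theory.
Import numFieldNormedType.Exports.
Local Open Scope classical_set_scope.
Local Open Scope ring_scope.

(** * Integrals against product probabilities *)

(** For p < oo the uniform law on the ball is not a product and the event is not a cone, so
    independence becomes available only once the event is replaced by a cone. All precision
    requirements come from a_n <= n^(1/2), which is Cauchy-Schwarz: the errors on the logarithms of
    the radii and the shrinkage e must be o(n^(-1/2)), while n e -> oo is needed for the inner ball
    to vanish. Numerator and denominator of the ratio are functions of the same coordinates; their
    linearizations are therefore merged coordinate by coordinate into one sum of independent terms,
    and their correlation produces the covariance term of s^2. Each term combines two fixed
    variables with finite third moments, so that Lyapunov's condition reduces to the hypothesis on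
    the maximum of the weights. Lindeberg's replacement then gives an error uniform in the
    threshold, as is required since the threshold moves with n and may tend to infinity. That a_n ->
    oo follows from the hypothesis on the sum of the sigma_i^-2q through the inequality of
    arithmetic and geometric means. *)

Section bounded_integrals.
Context d (T : measurableType d) (R : realType) (P : probability T R).

Lemma bounded_integrable (f : T -> R) (c : R) :
  measurable_fun setT f -> (forall x, `|f x| <= c) ->
  P.-integrable setT (EFin \o f).
Proof.
move=> mf fc; apply: (@le_integrable _ _ _ _ _ _ _ (cst c%:E)) => //.
- exact/measurable_EFinP.
- move=> x _ /=; rewrite lee_fin (le_trans (fc x))//.
  by rewrite ler_norm.
- by apply: finite_measure_integrable_cst.
Qed.

Lemma Rintegral_cst1 (c : R) : \int[P]_x c = c.
Proof.
by rewrite Rintegral_cst// /=; have -> : P setT = 1%E := probability_setT P; rewrite mulr1.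
Qed.

Lemma Rintegral_dist (f g : T -> R) (h : T -> R) :
  P.-integrable setT (EFin \o f) -> P.-integrable setT (EFin \o g) ->
  P.-integrable setT (EFin \o h) ->
  (forall x, `|f x - g x| <= h x) ->
  `|\int[P]_x f x - \int[P]_x g x| <= \int[P]_x h x.
Proof.
move=> fi gi hi fgh; rewrite -RintegralB//.
have fgi : P.-integrable setT (EFin \o (fun x => f x - g x)).
  by have := integrableB measurableT fi gi; apply: eq_integrable.
apply: le_trans (le_normr_Rintegral _ _) _ => //.
apply: le_Rintegral => //.
by have := integrable_abse fgi; apply: eq_integrable.
Qed.

Lemma ge0_Rintegral (f : T -> R) : P.-integrable setT (EFin \o f) ->
  (\int[P]_x (f x)%:E)%E = (\int[P]_x f x)%:E.
Proof. by move=> fi; rewrite /Rintegral fineK//; exact: integrable_fin_num. Qed.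

End bounded_integrals.

Section bounded_fubini.
Context d1 d2 (T1 : measurableType d1) (T2 : measurableType d2) (R : realType).
Variables (P1 : probability T1 R) (P2 : probability T2 R).
Variable f : T1 * T2 -> R.
Hypotheses (mf : measurable_fun setT f) (f01 : forall z, 0 <= f z <= 1).

Let f0 z : (0 <= (f z)%:E)%E.
Proof. by rewrite lee_fin; case/andP: (f01 z). Qed.

Let fi (d : measure_display) (T : measurableType d) (P : probability T R) (g : T -> T1 * T2) :
  measurable_fun setT g -> P.-integrable setT (EFin \o (f \o g)).
Proof.
move=> mg; apply: (@bounded_integrable _ _ _ _ _ 1).
  exact: measurableT_comp.
by move=> x; rewrite ger0_norm; case/andP: (f01 (g x)).
Qed.

Lemma measurable_Rintegral_snd : measurable_fun setT (fun x => \int[P2]_y f (x, y)).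
Proof.
rewrite /Rintegral; apply: measurableT_comp => //.
apply: (@measurable_fun_fubini_tonelli_F _ _ _ _ _ P2 (EFin \o f)) => //.
exact/measurable_EFinP.
Qed.

Lemma measurable_Rintegral_fst : measurable_fun setT (fun y => \int[P1]_x f (x, y)).
Proof.
rewrite /Rintegral; apply: measurableT_comp => //.
apply: (@measurable_fun_fubini_tonelli_G _ _ _ _ _ P1 (EFin \o f)) => //.
exact/measurable_EFinP.
Qed.

Lemma Rintegral_01 (d : measure_display) (T : measurableType d) (P : probability T R) (g : T -> R) :
  measurable_fun setT g -> (forall x, 0 <= g x <= 1) -> 0 <= \int[P]_x g x <= 1.
Proof.
move=> mg g01; apply/andP; split.
  by apply: Rintegral_ge0 => x _; case/andP: (g01 x).
rewrite -[leRHS](Rintegral_cst1 P); apply: le_Rintegral => //.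
- by apply: (@bounded_integrable _ _ _ _ _ 1) => // x; rewrite ger0_norm; case/andP: (g01 x).
- by apply: finite_measure_integrable_cst.
- by move=> x _; case/andP: (g01 x).
Qed.

Lemma Rfubini : \int[P1]_x \int[P2]_y f (x, y) = \int[P2]_y \int[P1]_x f (x, y).
Proof.
rewrite /Rintegral; congr fine.
transitivity (\int[P1]_x \int[P2]_y (f (x, y))%:E)%E.
  apply: eq_integral => x _; rewrite fineK//.
  by apply: integrable_fin_num => //; exact: (fi P2 (pair1_measurable x)).
rewrite (@fubini_tonelli _ _ _ _ _ P1 P2 (EFin \o f))//=; last exact/measurable_EFinP.
apply: eq_integral => y _; rewrite fineK//.
by apply: integrable_fin_num => //; exact: (fi P1 (pair2_measurable y)).
Qed.

Lemma Rfubini1 : \int[(P1 \x P2)%E]_z f z = \int[P1]_x \int[P2]_y f (x, y).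
Proof.
rewrite /Rintegral; congr fine.
rewrite (@fubini_tonelli1 _ _ _ _ _ P1 P2 (EFin \o f))//=; last exact/measurable_EFinP.
apply: eq_integral => x _; rewrite /fubini_F fineK//.
by apply: integrable_fin_num => //; exact: (fi P2 (pair1_measurable x)).
Qed.

End bounded_fubini.

Section product_probability.
Context {R : realType}.
Notation RT := (measurableTypeR R).
Variable mu : probability RT R.

HB.instance Definition _ n := isMeasurableFun.Build _ _ _ _
  (@tcons R n) (@measurable_tcons R n).

(** The recursion is that of [vol], so that one induction on the first coordinate compares the two
    measures. *)
Fixpoint pprod (n : nat) : probability (n.-tuple RT) R :=
  if n is n'.+1 then distribution (mu \x pprod n')%E (@tcons R n') else \d_[tuple].

Lemma ge0_integral_pprodS n (F : n.+1.-tuple RT -> \bar R) :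
  measurable_fun setT F -> (forall x, 0 <= F x)%E ->
  (\int[pprod n.+1]_x F x =
   \int[mu]_y \int[pprod n]_t F (tcons (y, t)))%E.
Proof.
move=> mF F0; rewrite /= (@ge0_integral_distribution _ _ _ _ _ (mu \x pprod n)%E)//.
rewrite (@fubini_tonelli1 _ _ _ _ _ mu (pprod n) (F \o @tcons R n))//=.
by apply: measurableT_comp => //; exact: measurable_tcons.
Qed.

Lemma Rintegral_pprodS n (F : n.+1.-tuple RT -> R) :
  measurable_fun setT F -> (forall x, 0 <= F x <= 1) ->
  \int[pprod n.+1]_x F x = \int[mu]_y \int[pprod n]_t F (tcons (y, t)).
Proof.
move=> mF F01; rewrite -(@Rfubini1 _ _ _ _ _ mu (pprod n) (F \o @tcons R n))//=.
  rewrite /Rintegral; congr fine.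
  rewrite (@ge0_integral_distribution _ _ _ _ _ (mu \x pprod n)%E (@tcons R n) (EFin \o F))//=.
    exact/measurable_EFinP.
  by move=> y; rewrite lee_fin; case/andP: (F01 y).
by apply: measurableT_comp => //; exact: measurable_tcons.
Qed.

End product_probability.

Section vol_integral.
Context {R : realType}.
Notation RT := (measurableTypeR R).
Local Open Scope ereal_scope.

Lemma ge0_integral_volS n (F : n.+1.-tuple RT -> \bar R) :
  measurable_fun setT F -> (forall x, 0 <= F x) ->
  \int[vol n.+1]_x F x =
   \int[@lebesgue_measure R]_y \int[vol n]_t F (tcons (y, t)).
Proof.
move=> mF F0 /=.
transitivity (\int[(@lebesgue_measure R \x vol n)]_z (F \o @tcons R n) z).
  rewrite -(@ge0_integral_pushforward _ _ _ _ _ _ (measurable_tcons (n:=n)) (@lebesgue_measure R \x vol n) setT)//.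
by rewrite (@fubini_tonelli1 _ _ _ _ _ (@lebesgue_measure R) (vol n) (F \o @tcons R n))//=;
  apply: measurableT_comp => //; exact: measurable_tcons.
Qed.

Lemma integral_vol0 (F : 0.-tuple RT -> \bar R) : measurable_fun setT F ->
  \int[vol 0]_x F x = F [tuple].
Proof. by move=> mF; rewrite /= integral_dirac// diracT mul1e. Qed.

Lemma integral_pprod0 (mu : probability RT R) (F : 0.-tuple RT -> \bar R) : measurable_fun setT F ->
  \int[pprod mu 0]_x F x = F [tuple].
Proof. by move=> mF; rewrite /= integral_dirac// diracT mul1e. Qed.

Lemma tnth_tcons n (y : RT) (t : n.-tuple RT) :
  (tnth (tcons (y, t)) ord0 = y) * (forall i, tnth (tcons (y, t)) (lift ord0 i) = tnth t i).
Proof. by split => [//|i]; rewrite tnthS. Qed.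

Lemma measurable_fun_sum_tnth n (f : 'I_n -> RT -> R) :
  (forall i, measurable_fun setT (f i)) ->
  measurable_fun setT (fun x : n.-tuple RT => \sum_(i < n) f i (tnth x i))%R.
Proof.
move=> mf; apply: measurable_sum => i.
by apply: measurableT_comp => //; exact: measurable_tnth.
Qed.

Lemma measurable_fun_prod_tnth n (f : 'I_n -> RT -> R) :
  (forall i, measurable_fun setT (f i)) ->
  measurable_fun setT (fun x : n.-tuple RT => \prod_(i < n) f i (tnth x i))%R.
Proof.
move=> mf; apply: measurable_prod => i _.
by apply: measurableT_comp => //; exact: measurable_tnth.
Qed.

End vol_integral.

(** * Integration against a density and affine substitution *)

Section density.
Context d (T : measurableType d) (R : realType).
Variables (mu nu : {measure set T -> \bar R}) (h : T -> R).
Hypotheses (mh : measurable_fun setT h) (h0 : forall x, 0 <= h x).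
Hypothesis nuE : forall A, measurable A -> nu A = (\int[mu]_(x in A) (h x)%:E)%E.
Local Open Scope ereal_scope.
Import HBNNSimple.

Let nuT A : measurable A -> nu A = \int[mu]_x ((\1_A x)%:E * (h x)%:E).
Proof.
move=> mA; rewrite nuE// integral_mkcond; apply: eq_integral => x _.
by rewrite patchE indicE; case: ifP => xA; rewrite ?mul1e// mul0e.
Qed.

Let mhE : measurable_fun setT (EFin \o h).
Proof. exact/measurable_EFinP. Qed.

(** For an indicator this is [nuE]; linearity gives nonnegative simple functions, and monotone
    convergence along an increasing simple approximation gives the rest. It serves the normal law
    and the p-Gaussian law alike. *)
Lemma ge0_integral_density (f : T -> \bar R) : measurable_fun setT f ->
  (forall x, 0 <= f x) -> \int[nu]_x f x = \int[mu]_x (f x * (h x)%:E).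
Proof.
move=> mf f0; pose f_ := nnsfun_approx measurableT mf.
have fE x : limn (fun n => (f_ n x)%:E) = f x.
  by apply/cvg_lim => //; apply: cvg_nnsfun_approx.
transitivity (limn (fun n => \int[nu]_x (f_ n x)%:E)).
  rewrite -monotone_convergence//.
  - by apply: eq_integral => x _; rewrite fE.
  - by move=> n; exact/measurable_EFinP.
  - by move=> *; rewrite lee_fin.
  - by move=> x _ m n mn; rewrite lee_fin; exact/lefP/nd_nnsfun_approx.
rewrite [X in limn X](_ : _ =
    (fun n => \int[mu]_x ((f_ n x)%:E * (h x)%:E))).
  rewrite -monotone_convergence//; last 3 first.
  - by move=> n; apply: emeasurable_funM => //; exact/measurable_EFinP.
  - by move=> n x _ ; rewrite mule_ge0 ?lee_fin.
  - move=> x _ m n mn; rewrite lee_wpmul2r ?lee_fin//.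
    exact/lefP/nd_nnsfun_approx.
  apply: eq_integral => x _; apply/cvg_lim => //.
  by apply: cvgeZr => //; apply: cvg_nnsfun_approx.
apply/funext => n.
under eq_integral do rewrite fimfunE -fsumEFin//.
rewrite ge0_integral_fsum//; last 2 first.
- by move=> y; exact/measurable_EFinP/measurable_funM.
- by move=> y x _; rewrite nnfun_muleindic_ge0.
under [in RHS]eq_integral.
  move=> x _; rewrite fimfunE -fsumEFin// ge0_mule_fsuml; last first.
    by move=> r; rewrite nnfun_muleindic_ge0.
  over.
rewrite ge0_integral_fsum//; last 2 first.
- move=> y; apply: emeasurable_funM => //.
  exact/measurable_EFinP/measurable_funM.
- by move=> y x _; rewrite mule_ge0 ?nnfun_muleindic_ge0 ?lee_fin.
apply: eq_fsbigr => r rf.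
have r0 : (0 <= r)%R by move: rf; rewrite inE => -[t _ <-].
rewrite integralZl_indic_nnsfun// integral_indic// setIT nuT//.
rewrite -ge0_integralZl//; last 2 first.
- apply: emeasurable_funM => //; exact/measurable_EFinP/measurable_indic.
- by move=> x _; rewrite mule_ge0 ?lee_fin.
by apply: eq_integral => x _; rewrite EFinM muleA.
Qed.

End density.

Section affine_substitution.
Context {R : realType}.
Notation RT := (measurableTypeR R).
Notation mu := (@lebesgue_measure R).
Local Open Scope ereal_scope.

(** The pushforward of Lebesgue measure by the affine map, multiplied by [c], gives each half-open
    interval its length, hence is Lebesgue measure by uniqueness. *)
Lemma ge0_integral_affine (c b : R) (f : RT -> \bar R) : (0 < c)%R ->
  measurable_fun setT f -> (forall x, 0 <= f x) ->
  \int[mu]_x f (c * x + b)%R = c^-1%:E * \int[mu]_x f x.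
Proof.
move=> c0 mf f0.
have mphi : measurable_fun setT (fun x : RT => (c * x + b)%R : RT).
  by apply: measurable_funD => //; apply: measurable_funM.
pose phi := fun x : RT => (c * x + b)%R : RT.
transitivity (\int[pushforward mu phi]_x f x).
  by rewrite ge0_integral_pushforward.
have cV0 : (0 <= c^-1)%R by rewrite invr_ge0 ltW.
rewrite -(@ge0_integral_mscale _ _ _ mu _ measurableT (NngNum cV0))//.
apply: eq_measure_integral => A mA _; apply/esym.
have eqm : forall X : set RT, measurable X -> 
    mu X = mscale (NngNum (ltW c0)) (pushforward mu phi) X.
  move=> X mX.
  apply: (@lebesgue_measure_unique _ 
    (mscale (NngNum (ltW c0)) (pushforward mu phi))) => //.
  move=> _ [[x y]] _ <-.
  have phiE : phi @^-1` `]x, y]%classic = `]((x - b) / c)%R, ((y - b) / c)%R]%classic.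
    apply/seteqP; split => t /=; rewrite !in_itv/= /phi ltr_pdivrMr// ler_pdivlMr//.
      by rewrite ltrBlDr lerBrDr mulrC.
    by rewrite ltrBlDr lerBrDr mulrC.
  transitivity (c%:E * mu (phi @^-1` `]x, y]%classic)); last by [].
  rewrite phiE.
  rewrite !lebesgue_measure_itv/= !lte_fin ltr_pM2r ?invr_gt0// ltrD2r.
  case: ifP => _; last by rewrite mule0.
  by rewrite -!EFinB -EFinM; congr EFin; field; rewrite gt_eqF.
transitivity (c^-1%:E * mu A); first by [].
have -> : mu A = c%:E * pushforward mu phi A by exact: eqm.
by rewrite muleA -EFinM mulVf ?gt_eqF// mul1e.
Qed.

End affine_substitution.

(** * Stability of the normal law and Taylor bounds *)

Section normal_stability.
Context {R : realType}.
Notation RT := (measurableTypeR R).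
Notation mu := (@lebesgue_measure R).
Notation N := (@normal_prob R 0 1).
Notation phi := (@normal_pdf R 0 1).
Local Open Scope ereal_scope.

Lemma normal_pdf01E x : phi x = (normal_peak 1 * expR (- (x ^+ 2 / 2)))%R.
Proof.
rewrite normal_pdfE ?oner_neq0//= /normal_fun subr0 expr1n.
by congr (_ * expR _)%R; rewrite mulNr.
Qed.

Lemma ge0_integral_normal (F : RT -> \bar R) : measurable_fun setT F ->
  (forall x, 0 <= F x) -> \int[N]_x F x = \int[mu]_x (F x * (phi x)%:E).
Proof.
move=> mF F0; apply: (@ge0_integral_density _ _ _ mu N phi) => //.
  exact: measurable_normal_pdf.
by move=> x; exact: normal_pdf_ge0.
Qed.

Let mphi : measurable_fun setT (phi : RT -> R).
Proof. exact: measurable_normal_pdf. Qed.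

Let mphiE : measurable_fun setT (fun x : RT => (phi x)%:E).
Proof. exact/measurable_EFinP. Qed.

Let phi0 x : 0 <= (phi x)%:E.
Proof. by rewrite lee_fin normal_pdf_ge0. Qed.

Let maff (a b : R) : measurable_fun setT (fun x : RT => (a * x + b)%R : RT).
Proof. by apply: measurable_funD => //; apply: measurable_funM. Qed.

(** Substitute [t = a u + b w] in the inner integral, exchange the integrals and complete the square
    in [u]: what remains in [u] is again a normal density, of integral 1. The substitution divides
    by [b], and vanishing coefficients are settled at the outset. *)
Lemma ge0_integral_normal_conv (a b : R) (F : RT -> \bar R) :
  (0 <= a)%R -> (0 <= b)%R -> measurable_fun setT F -> (forall x, 0 <= F x) ->
  \int[N]_u \int[N]_w F (a * u + b * w)%R =
  \int[N]_u F (Num.sqrt (a ^+ 2 + b ^+ 2) * u)%R.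
Proof.
move=> a0 b0 mF F0.
have NT : N setT = 1 := probability_setT (normal_prob 0 1).
have [->|an0] := eqVneq a 0%R.
  under eq_integral do under eq_integral do rewrite mul0r add0r.
  by rewrite expr0n add0r sqrtr_sqr ger0_norm// integral_cst//= NT mule1.
have [->|bn0] := eqVneq b 0%R.
  under eq_integral do under eq_integral do rewrite mul0r addr0.
  under eq_integral do rewrite integral_cst//.
  by under eq_integral do rewrite /= NT mule1;
    rewrite expr0n addr0 sqrtr_sqr ger0_norm.
have {an0}a0 : (0 < a)%R by rewrite lt_neqAle eq_sym an0.
have {bn0}b0 : (0 < b)%R by rewrite lt_neqAle eq_sym bn0.
set c := Num.sqrt _.
have c2 : (c ^+ 2 = a ^+ 2 + b ^+ 2)%R.
  by rewrite sqr_sqrtr// addr_ge0// sqr_ge0.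
have c0 : (0 < c)%R by rewrite sqrtr_gt0 addr_gt0// exprn_gt0.
pose k (z : RT * RT) := b^-1%:E * F z.2 * (phi ((z.2 - a * z.1) / b))%:E * (phi z.1)%:E.
have mpos2 : measurable_fun setT (fun z : RT * RT => (phi ((z.2 - a * z.1) / b))%:E).
  apply/measurable_EFinP; apply: (measurableT_comp mphi).
  apply: measurable_funM => //; apply: measurable_funB => //.
  exact: measurable_funM.
have mk : measurable_fun setT k.
  apply: emeasurable_funM; last by apply: (measurableT_comp mphiE).
  apply: emeasurable_funM => //.
  apply: emeasurable_funM => //.
  exact: measurableT_comp.
have k0 z : 0 <= k z by rewrite !mule_ge0// lee_fin invr_ge0 ltW.
have inner (u : R) : \int[N]_w F (a * u + b * w)%R =
    \int[mu]_t (b^-1%:E * (F t * (phi ((t - a * u) / b))%:E)).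
  have mFw : measurable_fun setT (fun w : RT => F (a * u + b * w)%R).
    by under eq_fun do rewrite addrC; apply: (measurableT_comp mF); exact: maff.
  have mG : measurable_fun setT (fun t : RT => F t * (phi ((t - a * u) / b))%:E).
    apply: emeasurable_funM => //; apply/measurable_EFinP.
    apply: (measurableT_comp mphi); apply: measurable_funM => //.
    exact: measurable_funB.
  rewrite ge0_integral_normal// ge0_integralZl//; last 2 first.
  - by move=> t _; rewrite mule_ge0.
  - by rewrite lee_fin invr_ge0 ltW.
  have := @ge0_integral_affine _ _ (a * u)%R _ b0 mG (fun t => mule_ge0 (F0 t) (phi0 _)).
  move=> <-; apply: eq_integral => w _; rewrite addrC addrK mulrAC mulfV ?gt_eqF// mul1r.
  by rewrite addrC.
have mIn : measurable_fun setT (fun u : RT => \int[N]_w F (a * u + b * w)%R).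
  apply: (@measurable_fun_fubini_tonelli_F _ _ _ _ _ N
    (fun z : RT * RT => F (a * z.1 + b * z.2)%R)) => //.
  apply: (measurableT_comp mF); apply: measurable_funD.
    exact: measurable_funM.
  exact: measurable_funM.
rewrite ge0_integral_normal//; last by move=> u; exact: integral_ge0.
transitivity (\int[mu]_u \int[mu]_t k (u, t)).
  apply: eq_integral => u _; rewrite inner -ge0_integralZr//; last 2 first.
  - apply: emeasurable_funM => //; apply: emeasurable_funM => //.
    apply/measurable_EFinP.
    apply: (measurableT_comp mphi); apply: measurable_funM => //.
    exact: measurable_funB.
  - by move=> t _; rewrite !mule_ge0// lee_fin invr_ge0 ltW.
  by apply: eq_integral => t _; rewrite /k/= !muleA.
rewrite (@fubini_tonelli _ _ _ _ _ mu mu k)//.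
have mFc : measurable_fun setT (fun u : RT => F (c * u)%R).
  under eq_fun do rewrite -[(c * _)%R]addr0.
  by apply: (measurableT_comp mF); exact: maff.
rewrite ge0_integral_normal//.
have mH : measurable_fun setT (fun t : RT => F t * (phi (t / c))%:E).
  apply: emeasurable_funM => //; apply/measurable_EFinP.
  by apply: (measurableT_comp mphi); apply: measurable_funM.
transitivity (c^-1%:E * \int[mu]_t (F t * (phi (t / c))%:E)); last first.
  have := @ge0_integral_affine _ _ 0%R _ c0 mH (fun t => mule_ge0 (F0 t) (phi0 _)).
  by move=> <-; apply: eq_integral => u _; rewrite addr0 mulrAC mulfV ?gt_eqF// mul1r.
rewrite -ge0_integralZl//; last 2 first.
- by move=> t _; rewrite mule_ge0.
- by rewrite lee_fin invr_ge0 ltW.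
apply: eq_integral => t _; rewrite /k/=.
(* With c^2 = a^2 + b^2, u^2 + ((t - a u) / b)^2 = (t / c)^2 + ((c^2 u - a t) / (c b))^2. *)
transitivity (\int[mu]_u (b^-1%:E * F t * (phi (t / c))%:E *
    (phi (c / b * u + (- (a * t) / (c * b))))%:E)).
  apply: eq_integral => u _; rewrite -!muleA; congr (_ * (_ * _)).
  rewrite -!EFinM; congr EFin; rewrite !normal_pdf01E mulrACA [RHS]mulrACA -!expRD.
  congr (_ * expR _)%R; rewrite -!opprD; congr (- _)%R.
  have -> : (c / b * u + - (a * t) / (c * b) = (c ^+ 2 * u - a * t) / (c * b))%R.
    by field; rewrite !gt_eqF.
  rewrite !exprMn !exprVn !(@exprMn _ 2 c) c2.
  by field; rewrite gt_eqF//= gt_eqF// addr_gt0// exprn_gt0.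
have mphia (e f : R) : measurable_fun setT (fun u : RT => (phi (e * u + f))%:E).
  apply/measurable_EFinP; apply: (measurableT_comp mphi); exact: maff.
rewrite ge0_integralZl//; last by rewrite !mule_ge0// lee_fin invr_ge0 ltW.
have cb0 : (0 < c / b)%R by rewrite divr_gt0.
have := @ge0_integral_affine _ _ (- (a * t) / (c * b))%R _ cb0 mphiE phi0.
move=> ->; rewrite integral_normal_pdf mule1 muleC !muleA -EFinM; congr (_ * _ * _).
by congr EFin; rewrite invf_div; field; rewrite !gt_eqF.
Qed.

Lemma Rintegral_normal_conv (a b : R) (f : RT -> R) :
  (0 <= a)%R -> (0 <= b)%R -> measurable_fun setT f -> (forall x, 0 <= f x <= 1)%R ->
  (\int[N]_u \int[N]_w f (a * u + b * w) =
   \int[N]_u f (Num.sqrt (a ^+ 2 + b ^+ 2) * u))%R.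
Proof.
move=> a0 b0 mf f01; rewrite /Rintegral; congr fine.
rewrite -(@ge0_integral_normal_conv a b (EFin \o f))//=; last 2 first.
- exact/measurable_EFinP.
- by move=> x; rewrite lee_fin; case/andP: (f01 x).
apply: eq_integral => u _; rewrite fineK//; apply: integrable_fin_num => //.
apply: (@bounded_integrable _ _ _ _ _ 1%R).
  by under eq_fun do rewrite addrC; apply: (measurableT_comp mf); exact: maff.
by move=> x; rewrite ger0_norm; case/andP: (f01 (a * u + b * x)%R).
Qed.

End normal_stability.

Section taylor.
Context {R : realType}.
Implicit Types f g : R -> R.

(** The mean value theorem writes [f t] as [f' u * t] with [|u| <= |t|]. The constant is not divided
    by [k.+1], so that three applications give [c] where Taylor's formula has [c / 6]. *)
Lemma derive_bound f f' (c : R) (k : nat) :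
  (forall x : R, is_derive x (1 : R) f (f' x)) -> f 0 = 0 ->
  (forall t, `|f' t| <= c * `|t| ^+ k) -> forall t, `|f t| <= c * `|t| ^+ k.+1.
Proof.
move=> df f0 f'c t.
have c0 : 0 <= c by have := f'c 1; rewrite normr1 expr1n mulr1; apply: le_trans.
have cf : continuous f.
  by move=> x; apply/differentiable_continuous/derivable1_diffP/ex_derive.
suff [u ut ft] : exists2 u, `|u| <= `|t| & f t = f' u * t.
  rewrite ft normrM exprSr mulrA ler_wpM2r// (le_trans (f'c u))//.
  by rewrite ler_wpM2l// lerXn2r// nnegrE.
case: (leP 0 t) => t0.
  have [|u utI] := @MVT_segment R f f' 0 t t0 (fun x _ => df x).
    exact: continuous_subspaceT.
  rewrite f0 !subr0 => ftE; exists u => //.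
  by move: utI; rewrite in_itv/= => /andP[u0 ut]; rewrite !ger0_norm.
have [|u utI] := @MVT_segment R f f' t 0 (ltW t0) (fun x _ => df x).
  exact: continuous_subspaceT.
rewrite f0 !sub0r => ftE; exists u.
  by move: utI; rewrite in_itv/= => /andP[u0 ut]; rewrite !ler0_norm ?lerN2 ?(ltW t0).
by apply: oppr_inj; rewrite ftE mulrN.
Qed.

(** As functions of [y], the remainder and its first two derivatives vanish at 0, and its third
    derivative is [f3 (x + y)]; [derive_bound] is applied three times. *)
Lemma taylor3 f f1 f2 f3 (c : R) :
  (forall x : R, is_derive x (1 : R) f (f1 x)) -> (forall x : R, is_derive x (1 : R) f1 (f2 x)) ->
  (forall x : R, is_derive x (1 : R) f2 (f3 x)) -> (forall x, `|f3 x| <= c) ->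
  forall x y, `|f (x + y) - f x - f1 x * y - f2 x * y ^+ 2 / 2| <= c * `|y| ^+ 3.
Proof.
move=> df df1 df2 f3c x.
have sh g g' : (forall x : R, is_derive x (1 : R) g (g' x)) ->
    forall t : R, is_derive t (1 : R) (fun t => g (x + t)) (g' (x + t)).
  move=> dg t; have dg' := dg (x + t).
  have ds : is_derive t (1:R) (fun t => x + t) (1 : R).
    rewrite (_ : (fun t => x + t) = cst x + id)//.
    by apply: is_derive_eq; rewrite add0r.
  have := @is_derive1_comp R g (fun t => x + t) t _ _ dg' ds.
  by rewrite mulr1.
apply: (@derive_bound _ (fun t => f1 (x + t) - f1 x - f2 x * t)); last 2 first.
- by rewrite addr0 mulr0 expr0n/= mulr0 mul0r !subr0 subrr.
- apply: (@derive_bound _ (fun t => f2 (x + t) - f2 x)); last 2 first.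
  + by rewrite addr0 mulr0 subr0 subrr.
  + apply: (@derive_bound _ (fun t => f3 (x + t))); last 2 first.
    * by rewrite addr0 subrr.
    * by move=> t; rewrite expr0 mulr1.
    move=> t; have df2' := sh _ _ df2 t.
    rewrite (_ : (fun t => _) = (fun t => f2 (x + t)) - cst (f2 x))//.
    by apply: is_derive_eq; rewrite subr0.
  move=> t; have df1' := sh _ _ df1 t.
  rewrite (_ : (fun t => _) = (fun t => f1 (x + t)) - cst (f1 x) - (f2 x \*: id))//.
  by apply: is_derive_eq; rewrite subr0 /GRing.scale/= mulr1.
move=> t; have df' := sh _ _ df t.
rewrite (_ : (fun t => _) = (fun t => f (x + t)) - cst (f x) - (f1 x \*: id)
   - ((f2 x / 2) \*: (id ^+ 2))); last first.
  apply/funext => u; rewrite /GRing.scale/= !fctE /=.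
  by congr (_ - _); rewrite mulrAC.
apply: is_derive_eq; rewrite subr0 /GRing.scale/= !mulr1; congr (_ - _).
by rewrite expr1; field.
Qed.

(* The smooth step of the central limit theorem: its third derivative is bounded, so it can
   be fed to Lindeberg's replacement, and k -> oo in [logis (k * _)] recovers indicators. *)
Definition logis (x : R) : R := (1 + expR x)^-1.

Lemma logis_gt0 x : 0 < logis x.
Proof. by rewrite invr_gt0 addr_gt0// expR_gt0. Qed.

Lemma logis_lt1 x : logis x < 1.
Proof. by rewrite invf_lt1 ?addr_gt0 ?expR_gt0// ltrDl expR_gt0. Qed.

Lemma logis_01 x : 0 <= logis x <= 1.
Proof. by rewrite ltW ?logis_gt0//= ltW// logis_lt1. Qed.

Lemma is_derive_logis (x : R) : is_derive x (1 : R) logis (logis x ^+ 2 - logis x).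
Proof.
have x0 : 1 + expR x != 0 by rewrite gt_eqF// addr_gt0// expR_gt0.
rewrite (_ : logis = (fun y => ((cst 1 + expR) y)^-1))//.
have dd : is_derive x (1 : R) (cst 1 + expR) (expR x).
  by apply: is_derive_eq; rewrite add0r.
apply: is_derive_eq (is_deriveV (f:=cst 1 + expR) x0 dd) _.
rewrite /GRing.scale/= /logis !fctE.
by field.
Qed.

(** The third derivative of [logis] is (6 m - 1) m with m = logis - logis^2 in [0, 1/4], hence
    bounded by 1; the scaling contributes [k ^+ 3]. The coefficients [f1] and [f2] stay abstract
    because Lindeberg's replacement cancels them. *)
Lemma logis_scale_taylor (k a : R) : 0 <= k ->
  exists f1 f2 : R -> R, forall x y,
  `|logis (k * (x + y - a)) - logis (k * (x - a)) - f1 x * y - f2 x * y ^+ 2 / 2|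
    <= k ^+ 3 * `|y| ^+ 3.
Proof.
move=> k0.
pose g1 x := logis x ^+ 2 - logis x.
pose g2 x := (2 * logis x - 1) * g1 x.
pose g3 x := (6 * logis x ^+ 2 - 6 * logis x + 1) * g1 x.
have d1 (x : R) : is_derive x (1 : R) logis (g1 x) by exact: is_derive_logis.
have d2 (x : R) : is_derive x (1 : R) g1 (g2 x).
  rewrite (_ : g1 = logis ^+ 2 - logis); last by apply/funext => t; rewrite !fctE.
  have d := d1 x; apply: is_derive_eq; by rewrite /g2 /GRing.scale/= expr1 mulrBl mul1r.
have d3 (x : R) : is_derive x (1 : R) g2 (g3 x).
  rewrite (_ : g2 = (2 \*: logis - cst 1) * g1); last by apply/funext => t; rewrite !fctE.
  have d := d1 x; have d' := d2 x; apply: is_derive_eq.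
  rewrite /g2 /g3 /GRing.scale/= !fctE /GRing.scale/= /g2 /g1 /GRing.scale/=; ring.
have b3 x : `|g3 x| <= 1.
  have /andP[l0 l1] := logis_01 x; set l := logis x in l0 l1 *.
  rewrite /g3 /g1 -/l; have : 0 <= l - l ^+ 2 <= 1.
    by apply/andP; split; nra.
  set m := l - l ^+ 2 => /andP[m0 m1].
  have m4 : m <= 4^-1.
    have : 0 <= (l - 2^-1) ^+ 2 by exact: sqr_ge0.
    by rewrite /m; nra.
  have -> : (6 * l ^+ 2 - 6 * l + 1) * (l ^+ 2 - l) = (6 * m - 1) * m by rewrite /m; ring.
  by rewrite ler_norml; apply/andP; split; nra.
exists (fun x => k * g1 (k * (x - a))), (fun x => k ^+ 2 * g2 (k * (x - a))) => x y.
have := taylor3 d1 d2 d3 b3 (k * (x - a)) (k * y).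
have -> : k * (x + y - a) = k * (x - a) + k * y by ring.
rewrite normrM (ger0_norm k0) mul1r (exprMn 3 k) => H.
apply: le_trans H; rewrite le_eqVlt; apply/orP; left; apply/eqP; congr (`| _ |).
by rewrite /g1 /g2 /g1; field.
Qed.

End taylor.

(** * Moments of the p-Gaussian distribution *)

Section layer_cake.
Context d (T : measurableType d) (R : realType).
Variable m : {sigma_finite_measure set T -> \bar R}.
Notation mu := (@lebesgue_measure R).
Notation RT := (measurableTypeR R).
Variables (y : T -> R) (F : T -> \bar R).
Hypotheses (my : measurable_fun setT y) (mF : measurable_fun setT F).
Hypothesis F0 : forall x, (0 <= F x)%E.
Local Open Scope ereal_scope.

Let f (z : T * RT) : \bar R :=
  F z.1 * (\1_[set z : T * RT | (y z.1 <= z.2)%R] z * expR (- z.2))%:E.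

Let mle t : measurable [set x | (y x <= t)%R].
Proof. by rewrite -[X in measurable X]setTI; exact: measurable_fun_le. Qed.

(** [expR (- y x)] is the integral of [expR (- t)] over [t >= y x], and Tonelli exchanges the
    integrals. A density that is a function of [y] is traded for the sublevel sets of [y], which are
    balls when [y] is a power of a norm. *)
Lemma ge0_integral_layer_cake :
  \int[m]_x (F x * (expR (- y x))%:E) =
  \int[mu]_t ((expR (- t))%:E * \int[m]_(x in [set x | (y x <= t)%R]) F x).
Proof.
have mf : measurable_fun setT f.
  apply: emeasurable_funM; first by apply: (measurableT_comp mF); exact: measurable_fst.
  apply/measurable_EFinP; apply: measurable_funM.
    apply: measurable_indic; rewrite -[X in measurable X]setTI.
    apply: measurable_fun_le => //.
    by apply: (measurableT_comp my); exact: measurable_fst.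
  apply: measurableT_comp => //.
  by apply: measurableT_comp => //; exact: measurable_snd.
have f0 z : 0 <= f z by rewrite mule_ge0// lee_fin mulr_ge0 ?expR_ge0// indicE.
transitivity (\int[m]_x \int[mu]_t f (x, t)).
  apply: eq_integral => x _; rewrite -integral_expRN.
  rewrite -ge0_integralZl//; last by apply/measurable_EFinP; apply: measurableT_comp.
  rewrite integral_mkcond.
  apply: eq_integral => t _; rewrite /f/= indicE patchE mem_setE in_itv/= andbT.
  rewrite (_ : ((x, t) \in _) = (y x <= t)%R); last by apply/idP/idP; rewrite inE.
  by case: ifPn => ht; rewrite ?mul1r ?mul0r ?mule0.
rewrite (@fubini_tonelli _ _ _ _ _ m mu f)//=.
apply: eq_integral => t _.
rewrite -ge0_integralZl//; last exact: measurable_funTS.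
rewrite [RHS]integral_mkcond; apply: eq_integral => x _.
rewrite /f/= indicE patchE.
rewrite (_ : ((x, t) \in _) = (x \in [set x | (y x <= t)%R])); last first.
  by apply/idP/idP; rewrite !inE.
by case: ifPn => ht; rewrite ?mul1r ?mul0r ?mule0// muleC.
Qed.

End layer_cake.

Section even_integral.
Context {R : realType}.
Notation mu := (@lebesgue_measure R).
Notation RT := (measurableTypeR R).
Local Open Scope ereal_scope.

Lemma ge0_integral_even (f : RT -> \bar R) : measurable_fun setT f ->
  (forall x, 0 <= f x) -> (forall x, f (- x)%R = f x) ->
  \int[mu]_x f x = 2%:E * \int[mu]_(x in `]0%R, +oo[) f x.
Proof.
move=> mf f0 fN.
have mfS (A : set RT) : measurable_fun A f by exact: measurable_funTS.
rewrite -(setUv (`[0%R, +oo[%classic : set RT)) ge0_integral_setU//=; last 2 first.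
- by apply: measurableC.
- by rewrite disj_set2E setICr.
rewrite setCitvr integral_itv_bndo_bndc//.
rewrite -(@integral_itv_obnd_cbnd _ 0%R)//.
rewrite (_ : \int[mu]_(x in `]-oo, 0%R]) f x = \int[mu]_(x in `]0%R, +oo[) f x).
  by rewrite mule_natl mule2n.
rewrite [RHS]integral_itv_obnd_cbnd//.
have -> := ge0_integration_by_substitution0 mf f0.
by apply: eq_integral => x _; rewrite fN.
all: exact: mfS.
Qed.

End even_integral.

Section power_integrals.
Context {R : realType}.
Notation mu := (@lebesgue_measure R).
Notation RT := (measurableTypeR R).
Implicit Types a u r : R.

Lemma cvg_powR_at_right0 a : 0 < a -> x `^ a @[x --> (0:R)^'+] --> (0 : R) `^ a.
Proof. by move=> a0; rewrite powR0 ?gt_eqF//; exact: powR_cvg0. Qed.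

Lemma continuous_powR_gt0 a u : 0 < u -> {for u, continuous (fun x => x `^ a)}.
Proof.
move=> u0; apply/differentiable_continuous/derivable1_diffP.
by apply: derivable_powR; rewrite in_itv/= andbT.
Qed.

Lemma integral_powR a u : 0 < a -> 0 < u ->
  (\int[mu]_(x in `]0%R, u]) (x `^ a)%:E = (u `^ (a + 1) / (a + 1))%:E)%E.
Proof.
move=> a0 u0; have a1 : 0 < a + 1 by rewrite addr_gt0.
rewrite integral_itv_obnd_cbnd; last first.
  by apply/measurable_EFinP; apply: measurable_funTS; exact: measurable_powR.
rewrite (@continuous_FTC2 _ _ (fun x => x `^ (a + 1) / (a + 1)) 0 u)//.
- by rewrite powR0 ?gt_eqF// mul0r sube0.
- apply/(continuous_within_itvP _ u0); split.
  + by move=> x; rewrite in_itv/= => /andP[x0 _]; exact: continuous_powR_gt0.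
  + exact: cvg_powR_at_right0.
  + by apply/cvg_at_left_filter; exact: continuous_powR_gt0.
- split.
  + move=> x; rewrite in_itv/= => /andP[x0 _].
    have d := is_derive1_powR (a + 1) x0.
    apply: derivableM => //.
  + by apply: cvgMl; exact: cvg_powR_at_right0.
  + by apply: cvgMl; apply/cvg_at_left_filter; exact: continuous_powR_gt0.
- move=> x; rewrite in_itv/= => /andP[x0 _]; rewrite derive1E.
  have d := is_derive1_powR (a + 1) x0.
  rewrite (_ : (fun x : R => _) = (@powR R ^~ (a + 1)) * cst (a + 1)^-1)//.
  rewrite derive_val /GRing.scale/= mulr0 add0r addrK.
  by rewrite mulrA mulVf ?gt_eqF// mul1r.
Qed.

(** [Gamma (a + 1)] as an extended real, so that the integrals below can be handled before their
    finiteness is known. *)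
Definition igamma a : \bar R :=
  (\int[mu]_(t in `]0%R, +oo[) (t `^ a * expR (- t))%:E)%E.

Lemma igamma_fin a : 0 < a -> igamma a \is a fin_num.
Proof.
move=> a0; rewrite ge0_fin_numE; first exact: integral_Gamma_lty.
by rewrite ltW// integral_Gamma_gt0// ltW.
Qed.

Lemma igammaE a : 0 < a -> igamma a = (Gamma (a + 1))%:E.
Proof. by move=> a0; rewrite /Gamma addrK /Rintegral fineK//; exact: igamma_fin. Qed.

Lemma Gamma_gt0 a : 0 < a -> 0 < Gamma (a + 1).
Proof.
by move=> a0; rewrite -lte_fin -igammaE//; apply: integral_Gamma_gt0; exact: ltW.
Qed.

Lemma measurable_powRM_expR (A : set RT) a :
  measurable_fun A (fun t => (t `^ a * expR (- t))%:E).
Proof.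
apply/measurable_EFinP/measurable_funM.
  by apply: measurable_funTS; exact: measurable_powR.
by apply: measurable_funTS; apply: measurableT_comp.
Qed.

(** The layer-cake formula for [y = id] takes the place of integration by parts: [expR (- t)] ends
    up multiplied by the integral of the power [a] over []0, t]], which is t^(a + 1) / (a + 1). *)
Lemma GammaS a : 0 < a -> Gamma (a + 1 + 1) = (a + 1) * Gamma (a + 1).
Proof.
move=> a0; have a1 : 0 < a + 1 by rewrite addr_gt0.
apply: EFin_inj; rewrite EFinM -!igammaE//.
pose F (x : RT) := ((x `^ a)%:E * (\1_(`]0, +oo[%classic : set RT) x)%:E)%E.
have mF : measurable_fun setT F.
  apply: emeasurable_funM; apply/measurable_EFinP; first exact: measurable_powR.
  exact: measurable_indic.
have F0 x : (0 <= F x)%E by rewrite mule_ge0// lee_fin powR_ge0.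
have := @ge0_integral_layer_cake _ _ R mu id F (@measurable_id _ _ _) mF F0.
rewrite [X in X = _ -> _](_ : _ = igamma a); last first.
  rewrite /igamma [RHS]integral_mkcond; apply: eq_integral => x _.
  by rewrite patchE /F indicE; case: ifP => xI; rewrite ?mule1 ?mule0 ?mul0e// EFinM.
move=> ->.
suff -> : (\int[mu]_t ((expR (- t))%:E * \int[mu]_(x in [set x | (id x <= t)%R]) F x) =
    (a + 1)^-1%:E * igamma (a + 1))%E.
  by rewrite muleA -EFinM mulfV ?gt_eqF// mul1e.
rewrite /igamma -ge0_integralZl//; last 3 first.
- exact: measurable_powRM_expR.
- by move=> t _; rewrite lee_fin mulr_ge0 ?powR_ge0 ?expR_ge0.
- by rewrite lee_fin invr_ge0 ltW.
rewrite [RHS]integral_mkcond; apply: eq_integral => t _; rewrite patchE.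
case: ifPn => [|].
  rewrite inE/= in_itv/= andbT => t0.
  rewrite (_ : (\int[_]_(x in [set x | _]) F x)%E = \int[mu]_(x in `]0%R, t]) (x `^ a)%:E)%E.
    by rewrite integral_powR// -!EFinM; congr EFin; field; rewrite gt_eqF.
  rewrite integral_mkcond [RHS]integral_mkcond; apply: eq_integral => x _.
  rewrite !patchE /F indicE !mem_setE !in_itv/= andbT.
  rewrite (_ : (x \in _) = (x <= t)%R)//.
  by case: (x <= t)%R; case: (0 < x)%R; rewrite ?mule1 ?mule0.
rewrite notin_setE/= in_itv/= andbT => /negP; rewrite -leNgt => t0.
rewrite integral0_eq ?mule0// => x /= xt.
by rewrite /F indicE memNset ?mule0//= in_itv/= andbT; apply/negP; rewrite -leNgt (le_trans xt).
Qed.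

End power_integrals.

Section pgauss_moments.
Context {R : realType}.
Notation mu := (@lebesgue_measure R).
Notation RT := (measurableTypeR R).
Implicit Types a u r : R.
Implicit Types p : \bar R.

Lemma measurable_abs_powR a : measurable_fun setT (fun x : RT => `|x| `^ a).
Proof. by apply: (measurableT_comp (measurable_powR a)); exact: normr_measurable. Qed.

Lemma ge0_integral_pgauss p (F : RT -> \bar R) : measurable_fun setT F ->
  (forall x, 0 <= F x)%E ->
  (\int[pgauss p]_x F x = \int[mu]_x (F x * (pgauss_pdf p x)%:E))%E.
Proof.
move=> mF F0; apply: (@ge0_integral_density _ _ _ mu (pgauss p) (pgauss_pdf p)) => //.
  exact: measurable_pgauss_pdf.
by move=> x; exact: pgauss_pdf_ge0.
Qed.

Lemma integral_abs_powR_ball a u : 0 < a -> 0 < u ->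
  (\int[mu]_(x in [set x : RT | (`|x| <= u)%R]) (`|x| `^ a)%:E =
   (2 * u `^ (a + 1) / (a + 1))%:E)%E.
Proof.
move=> a0 u0.
have mB : measurable [set x : RT | (`|x| <= u)%R].
  by rewrite -[X in measurable X]setTI; apply: measurable_fun_le.
rewrite integral_mkcond ge0_integral_even; last 3 first.
- apply/(measurable_restrictT _ mB); apply/measurable_EFinP/measurable_funTS.
  exact: measurable_abs_powR.
- by move=> x; rewrite patchE; case: ifP => // _; rewrite lee_fin powR_ge0.
- move=> x; rewrite !patchE normrN; congr (if _ then _ else _).
  by apply/idP/idP; rewrite !inE /= normrN.
rewrite -mulrA EFinM; congr (_ * _)%E; rewrite -integral_powR//.
rewrite integral_mkcond [RHS]integral_mkcond; apply: eq_integral => x _.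
rewrite !patchE !mem_setE !in_itv/= andbT.
rewrite (_ : (x \in _) = (`|x| <= u))//.
by case: ltP => //= x0; rewrite gtr0_norm.
Qed.

Lemma abs_powR_le r t : 0 < r -> 0 <= t ->
  [set x : RT | `|x| `^ r / r <= t] = [set x : RT | `|x| <= (r * t) `^ r^-1].
Proof.
move=> r0 t0; apply/seteqP; split => x /=; rewrite ler_pdivrMr//.
- move=> xt.
  rewrite -[leLHS]powRr1// -(@mulfV _ r) ?gt_eqF// powRrM.
  by rewrite ge0_ler_powR ?nnegrE ?invr_ge0 ?powR_ge0 ?(ltW r0)// ?mulr_ge0 ?(ltW r0)// mulrC.
- move=> /(@ge0_ler_powR _ r (ltW r0)).
  rewrite !nnegrE normr_ge0 powR_ge0 => /(_ isT isT).
  by rewrite -powRrM mulVf ?gt_eqF// powRr1 ?mulr_ge0 ?(ltW r0)// mulrC.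
Qed.

(** The layer-cake formula leaves integrals of a power over the intervals |x| <= (r t)^(1/r). They
    are multiples of t^((a + 1) / r), and a Gamma integral remains. *)
Lemma integral_abs_powR_expR r a : 0 < r -> 0 < a ->
  (\int[mu]_x (`|x| `^ a * expR (- (`|x| `^ r / r)))%:E =
   (2 * r `^ ((a + 1) / r) / (a + 1) * Gamma ((a + 1) / r + 1))%:E)%E.
Proof.
move=> r0 a0; have ar0 : 0 < (a + 1) / r by rewrite divr_gt0// addr_gt0.
have ma := measurable_abs_powR.
have my : measurable_fun setT (fun x : RT => `|x| `^ r / r).
  by apply: measurable_funM.
under eq_integral do rewrite EFinM.
rewrite (@ge0_integral_layer_cake _ _ R mu _ (fun x => (`|x| `^ a)%:E) my)//; last exact/measurable_EFinP.
have c0 : 0 <= 2 * r `^ ((a + 1) / r) / (a + 1).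
  by rewrite divr_ge0 ?mulr_ge0 ?powR_ge0// addr_ge0// ltW.
rewrite EFinM -igammaE// /igamma -ge0_integralZl//; last 2 first.
- exact: measurable_powRM_expR.
- by move=> t _; rewrite lee_fin mulr_ge0 ?powR_ge0 ?expR_ge0.
rewrite [RHS]integral_mkcond; apply: eq_integral => t _; rewrite patchE.
case: ifPn => [|].
  rewrite inE/= in_itv/= andbT => t0.
  have rt0 : 0 < r * t by rewrite mulr_gt0.
  rewrite abs_powR_le ?(ltW t0)// integral_abs_powR_ball ?powR_gt0//.
  rewrite -powRrM mulrC -!EFinM; congr EFin.
  rewrite (mulrC r^-1) powRM ?(ltW t0) ?(ltW r0)//.
  set A := r `^ _; set B := t `^ _; ring.
(* For [t <= 0] the sublevel set is contained in [[set 0]], a null set. *)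
rewrite notin_setE/= in_itv/= andbT => /negP; rewrite -leNgt => t0.
rewrite (_ : (\int[_]_(x in _) _)%E = 0%E) ?mule0//.
apply/eqP; rewrite eq_le; apply/andP; split; last first.
  by apply: integral_ge0 => x _; rewrite lee_fin powR_ge0.
apply: (@le_trans _ _ (\int[mu]_(x in [set 0%R]) (`|x| `^ a)%:E)%E).
  apply: ge0_subset_integral => //.
  - by rewrite -[X in measurable X]setTI; apply: measurable_fun_le.
  - by apply/measurable_EFinP; exact: measurable_funTS.
  move=> x /= xt; have : `|x| `^ r <= 0.
    by rewrite -(@pmulr_lle0 _ r^-1) ?invr_gt0//; exact: le_trans xt t0.
  move=> xr; have /eqP : `|x| `^ r = 0 by apply/eqP; rewrite eq_le xr powR_ge0.
  by rewrite powR_eq0 normr_eq0 => /andP[/eqP].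
by rewrite integral_set1.
Qed.

End pgauss_moments.

Section pgauss_integrals.
Context {R : realType}.
Notation mu := (@lebesgue_measure R).
Notation RT := (measurableTypeR R).
Implicit Types a u r : R.
Implicit Types p : \bar R.

Definition pgauss_cst (r : R) : R := (2 * r `^ r^-1 * Gamma (r^-1 + 1))^-1.

Lemma pgauss_cst_gt0 r : 0 < r -> 0 < pgauss_cst r.
Proof.
by move=> r0; rewrite invr_gt0 !mulr_gt0 ?powR_gt0// Gamma_gt0// invr_gt0.
Qed.

Lemma pgauss_pdf_EFin r x : 0 < r ->
  pgauss_pdf r%:E x = pgauss_cst r * expR (- (`|x| `^ r / r)).
Proof. by move=> r0; rewrite /pgauss_pdf lte_fin r0 ltry. Qed.

Lemma integral_pgauss_abs_powR r a : 0 < r -> 0 < a ->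
  (\int[pgauss r%:E]_x (`|x| `^ a)%:E =
   (pgauss_cst r * (2 * r `^ ((a + 1) / r) / (a + 1) * Gamma ((a + 1) / r + 1)))%:E)%E.
Proof.
move=> r0 a0; have c0 := pgauss_cst_gt0 r0.
rewrite ge0_integral_pgauss//; last by apply/measurable_EFinP; exact: measurable_abs_powR.
rewrite EFinM -integral_abs_powR_expR// -ge0_integralZl//; last 2 first.
- apply/measurable_EFinP; apply: measurable_funM; first exact: measurable_abs_powR.
  apply: measurableT_comp => //; apply: measurableT_comp => //.
  by apply: measurable_funM => //; exact: measurable_abs_powR.
- by rewrite lee_fin ltW.
apply: eq_integral => x _; rewrite pgauss_pdf_EFin// -!EFinM; congr EFin.
by rewrite mulrCA.
Qed.

Lemma integrable_pgauss_abs_powR p a : 0 <= a ->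
  (pgauss p).-integrable setT (EFin \o (fun x : RT => `|x| `^ a)).
Proof.
rewrite le_eqVlt => /predU1P[<-|a0].
  apply: (@bounded_integrable _ _ _ _ _ 1) => /=.
    exact: measurable_abs_powR.
  by move=> x; rewrite powRr0 normr1.
have mE : measurable_fun setT (EFin \o (fun x : RT => `|x| `^ a)).
  by apply/measurable_EFinP; exact: measurable_abs_powR.
apply/integrableP; split => //.
rewrite [X in (X < _)%E](_ : _ = \int[pgauss p]_x (`|x| `^ a)%:E)%E; last first.
  by apply: eq_integral => x _ /=; rewrite ger0_norm ?powR_ge0.
have [p0|p0] := boolP (0 < p < +oo)%E.
  case: p p0 => [r||]//; rewrite ?ltxx ?andbF// lte_fin => /andP[r0 _].
  by rewrite integral_pgauss_abs_powR// ltry.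
rewrite ge0_integral_pgauss//.
apply: (@le_lt_trans _ _ (\int[mu]_x (pgauss_pdf p x)%:E)%E).
  apply: ge0_le_integral => //.
  - by move=> x _; rewrite mule_ge0// lee_fin pgauss_pdf_ge0.
  - apply: emeasurable_funM => //; apply/measurable_EFinP.
    exact: measurable_pgauss_pdf.
  - by apply/measurable_EFinP; exact: measurable_pgauss_pdf.
  move=> x _; rewrite /pgauss_pdf (negbTE p0) -EFinM lee_fin indicE.
  have [|] := boolP (x \in _); last by rewrite mulr0 mulr0.
  rewrite inE/= in_itv/= => x1; rewrite mulr1 ler_piMl ?invr_ge0//.
  have x1' : `|x| <= 1 by rewrite ler_norml.
  have <- : 1 `^ a = 1 :> R by rewrite powR1.
  by apply: ge0_ler_powR; rewrite ?nnegrE// ltW.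
rewrite -[X in (X < _)%E]/(pgauss p setT).
by have -> : pgauss p setT = 1%E := probability_setT (pgauss p); exact: ltry.
Qed.

Lemma pgauss_momentE p a :
  pgauss_moment p a = \int[pgauss p]_x (`|x| `^ a).
Proof. by rewrite /pgauss_moment unlock. Qed.

(** The division by [r] in the exponent of the density is what normalizes this moment. Together with
    the next lemma, |X|^r has mean 1 and variance [r]. *)
Lemma pgauss_moment_p r : 0 < r -> \int[pgauss r%:E]_x (`|x| `^ r) = 1.
Proof.
move=> r0; have r10 : 0 < r^-1 by rewrite invr_gt0.
have rn0 : r != 0 by rewrite gt_eqF.
have G0 := Gamma_gt0 r10.
rewrite /Rintegral integral_pgauss_abs_powR//= /pgauss_cst.
have -> : (r + 1) / r = r^-1 + 1 by field.
rewrite GammaS// powRD; last by rewrite rn0 implybT.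
rewrite powRr1 ?(ltW r0)//.
have : r `^ r^-1 != 0 by rewrite gt_eqF// powR_gt0.
move: (gt_eqF G0); set A := r `^ _; set B := Gamma _ => B0 A0.
by field; rewrite A0 B0 rn0 gt_eqF// addr_gt0.
Qed.

Lemma pgauss_moment_2p r : 0 < r -> \int[pgauss r%:E]_x (`|x| `^ (r + r)) = 1 + r.
Proof.
move=> r0; have r10 : 0 < r^-1 by rewrite invr_gt0.
have rn0 : r != 0 by rewrite gt_eqF.
have G0 := Gamma_gt0 r10.
rewrite /Rintegral integral_pgauss_abs_powR ?addr_gt0//= /pgauss_cst.
have -> : (r + r + 1) / r = r^-1 + 1 + 1 by field.
rewrite GammaS ?addr_gt0// GammaS//.
rewrite powRD; last by rewrite rn0 implybT.
rewrite powRD; last by rewrite rn0 implybT.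
rewrite powRr1 ?(ltW r0)//.
have : r `^ r^-1 != 0 by rewrite gt_eqF// powR_gt0.
move: (gt_eqF G0); set A := r `^ _; set B := Gamma _ => B0 A0.
by field; rewrite A0 B0 rn0 gt_eqF// !addr_gt0.
Qed.

End pgauss_integrals.

Section normal_moments.
Context {R : realType}.
Notation mu := (@lebesgue_measure R).
Notation RT := (measurableTypeR R).
Notation N := (@normal_prob R 0 1).

(** Both densities are multiples of e^(-x^2/2) of total mass 1, so their constants agree without
    evaluating Gamma at 3/2. The absolute moments of the normal law thus come from the p-Gaussian
    law with p = 2. *)
Lemma pgauss_pdf2 x : pgauss_pdf 2%:E x = normal_pdf 0 1 x :> R.
Proof.
have two0 : (0 : R) < 2 by [].
have c0 := pgauss_cst_gt0 two0.
have pk0 : 0 < normal_peak 1 :> R by rewrite normal_peak_gt0 ?oner_neq0.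
have pdfE (y : R) : pgauss_pdf 2%:E y = (pgauss_cst 2 / normal_peak 1) * normal_pdf 0 1 y.
  rewrite pgauss_pdf_EFin// normal_pdf01E powR_mulrn// real_normK ?num_real//.
  by field; rewrite gt_eqF.
have : pgauss 2%:E setT = 1%E := probability_setT (@pgauss R 2%:E).
rewrite /pgauss; under eq_integral do rewrite pdfE EFinM.
rewrite ge0_integralZl//; last 3 first.
- by apply/measurable_EFinP; exact: measurable_normal_pdf.
- by move=> y _; rewrite lee_fin normal_pdf_ge0.
- by rewrite lee_fin divr_ge0// ltW.
by rewrite integral_normal_pdf mule1 => -[cpk]; rewrite pdfE cpk mul1r.
Qed.

Lemma integral_normal_pgauss (f : RT -> \bar R) :
  (\int[N]_x f x = \int[pgauss 2%:E]_x f x)%E.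
Proof.
apply: eq_measure_integral => A mA _; rewrite /pgauss /normal_prob.
by apply: eq_integral => x _; rewrite pgauss_pdf2.
Qed.

Let normE n (x : RT) : `|x| `^ n%:R = `|x| ^+ n.
Proof. by rewrite powR_mulrn. Qed.

Lemma integrable_normal_cube :
  N.-integrable setT (EFin \o (fun x : RT => `|x| ^+ 3)).
Proof.
have /integrableP[mi fi] := @integrable_pgauss_abs_powR R 2%:E 3%:R (ler0n _ _).
apply/integrableP; split.
  by apply/measurable_EFinP; apply: measurable_funX; exact: normr_measurable.
move: fi; rewrite integral_normal_pgauss.
rewrite (_ : (fun x : RT => _) = (fun x : RT => `|(`|x| ^+ 3)%:E|%E))//.
by apply/funext => x; rewrite /= normE.
Qed.

Lemma Rintegral_normal_sqr : \int[N]_x (x ^+ 2) = 1.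
Proof.
have sq : (fun x : RT => (`|x| `^ 2)%:E : \bar R) = (fun x : RT => (x ^+ 2)%:E).
  by apply/funext => x; rewrite normE real_normK// num_real.
by rewrite -[RHS](@pgauss_moment_p R 2 (ltr0n _ 2)) /Rintegral sq integral_normal_pgauss.
Qed.

Lemma ge0_integral_normalN (F : RT -> \bar R) : measurable_fun setT F ->
  (forall x, 0 <= F x)%E -> (\int[N]_x F (- x)%R = \int[N]_x F x)%E.
Proof.
move=> mF F0.
have mFN : measurable_fun setT (fun x : RT => F (- x)%R : \bar R).
  exact: (measurableT_comp mF).
have mpdf : measurable_fun setT (fun x : RT => (normal_pdf 0 1 x)%:E : \bar R).
  by apply/measurable_EFinP; exact: measurable_normal_pdf.
have pdf0 (x : R) : (0 <= (normal_pdf 0 1 x)%:E)%E by rewrite lee_fin normal_pdf_ge0.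
rewrite !ge0_integral_normal//.
have mG : measurable_fun setT (fun x : RT => (F x * (normal_pdf 0 1 x)%:E)%E : \bar R).
  exact: emeasurable_funM.
have mopp : measurable_fun setT (-%R : RT -> RT) by exact: oppr_measurable.
have := @ge0_integral_pushforward _ _ _ _ _ _ mopp mu setT _ measurableT mG.
rewrite preimage_setT => pushE.
transitivity (\int[pushforward mu (-%R : RT -> RT)]_x (F x * (normal_pdf 0 1 x)%:E))%E.
  rewrite pushE; last by move=> x _; rewrite mule_ge0.
  by apply: eq_integral => x _; rewrite /= !normal_pdf01E sqrrN.
by apply: eq_measure_integral => A mA _; exact: lebesgue_measureN.
Qed.

Lemma Rintegral_normal_id : \int[N]_x x = 0.
Proof.
rewrite /Rintegral integralE.
have mid : measurable_fun setT (EFin : RT -> \bar R) by apply: (proj2 (measurable_EFinP _ id)).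
have -> : (\int[N]_x (EFin^\- x) = \int[N]_x (EFin^\+ x))%E.
  have mp : measurable_fun setT (EFin^\+ : RT -> \bar R)%E by exact: measurable_funepos.
  rewrite -[RHS](ge0_integral_normalN mp)//.
  by apply: eq_integral => x _; rewrite funeposE funenegE EFinN.
(* By symmetry the positive and negative parts have the same integral. Were it infinite, [fine]
   would return its default value, which is 0 as well. *)
have [|] := boolP ((\int[N]_x EFin^\+ x)%E \is a fin_num).
  by move=> Ifin; rewrite subee.
by case: (\int[N]_x EFin^\+ x)%E.
Qed.

End normal_moments.

(** * Central limit theorem *)

Section real_integrable.
Context d (T : measurableType d) (R : realType) (P : probability T R).
Implicit Types f g : T -> R.
Notation Int f := (P.-integrable setT (EFin \o f)).

Lemma integrable_RZ (a : R) f : Int f -> Int (fun x => a * f x).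
Proof. by move=> fi; have := integrableZl measurableT a fi; apply: eq_integrable. Qed.

Lemma integrable_RD f g : Int f -> Int g -> Int (fun x => f x + g x).
Proof. by move=> fi gi; have := integrableD measurableT fi gi; apply: eq_integrable. Qed.

Lemma integrable_Rcst (a : R) : Int (fun=> a).
Proof. by apply: finite_measure_integrable_cst. Qed.

Lemma integrable_Rle f g : measurable_fun setT f -> Int g ->
  (forall x, `|f x| <= g x) -> Int f.
Proof.
move=> mf gi fg; apply: (le_integrable measurableT _ _ gi).
  exact/measurable_EFinP.
by move=> x _ /=; rewrite lee_fin (le_trans (fg x))// ler_norm.
Qed.

Lemma integrable_measurable f : Int f -> measurable_fun setT f.
Proof. by move=> /(measurable_int P) /measurable_EFinP. Qed.

Lemma integrable_cube_le f (k : nat) : (k <= 3)%N -> measurable_fun setT f ->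
  Int (fun x => `|f x| ^+ 3) -> Int (fun x => f x ^+ k).
Proof.
move=> k3 mf f3; apply: (@integrable_Rle _ (fun x => 1 + `|f x| ^+ 3)).
- exact: measurable_funX.
- exact: integrable_RD (integrable_Rcst 1) f3.
move=> x; rewrite normrX; have [f1|f1] := leP `|f x| 1.
  by rewrite (le_trans (exprn_ile1 _ _ f1))// lerDl exprn_ge0.
rewrite (le_trans (_ : _ <= `|f x| ^+ 3)) ?lerDr//.
by rewrite ler_eXn2l.
Qed.

Lemma Rintegral_le f g : Int f -> Int g -> (forall x, f x <= g x) ->
  \int[P]_x f x <= \int[P]_x g x.
Proof. by move=> fi gi fg; apply: le_Rintegral. Qed.

Section taylor_expectation.
Variables (f f1 f2 : R -> R) (C : R).
Hypotheses (mf : measurable_fun setT (f : measurableTypeR R -> R))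
  (f01 : forall x, 0 <= f x <= 1).
Hypothesis fT : forall x y,
  `|f (x + y) - f x - f1 x * y - f2 x * y ^+ 2 / 2| <= C * `|y| ^+ 3.

(** The first-order term integrates to 0 because [X] is centered, so that up to the third absolute
    moment only the variance of [X] is seen. *)
Lemma taylor_expectation (X : T -> R) (x : R) : measurable_fun setT X ->
  Int (fun t => `|X t| ^+ 3) -> \int[P]_t X t = 0 ->
  `|\int[P]_t f (x + X t) - (f x + f2 x / 2 * \int[P]_t (X t ^+ 2))|
    <= C * \int[P]_t (`|X t| ^+ 3).
Proof.
move=> mX X3 EX.
have X1 : Int X.
  by have := @integrable_cube_le X 1 isT mX X3; apply: eq_integrable.
have X2 := @integrable_cube_le X 2 isT mX X3.
have fi : Int (fun t => f (x + X t)).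
  apply: (@bounded_integrable _ _ _ _ _ 1).
    apply: (measurableT_comp mf); exact: measurable_funD.
  by move=> t; rewrite ger0_norm; case/andP: (f01 (x + X t)).
have gi : Int (fun t => f1 x * X t + f2 x / 2 * X t ^+ 2).
  by apply: integrable_RD; apply: integrable_RZ.
have -> : f x + f2 x / 2 * \int[P]_t (X t ^+ 2) =
    \int[P]_t (f x + (f1 x * X t + f2 x / 2 * X t ^+ 2)).
  rewrite RintegralD//; last exact: integrable_Rcst.
  rewrite Rintegral_cst1 RintegralD//; try exact: integrable_RZ.
  by rewrite !RintegralZl// EX mulr0 add0r.
rewrite -RintegralZl//; apply: Rintegral_dist => //.
- exact: integrable_RD (integrable_Rcst _) gi.
- exact: integrable_RZ.
move=> t; apply: le_trans (fT x (X t)); rewrite le_eqVlt; apply/orP; left.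
by apply/eqP; congr (`| _ |); rewrite !opprD !addrA [in RHS]mulrAC.
Qed.

(** Lyapunov's inequality, by integrating the pointwise bound |X|^3 >= (3/2) l X^2 - l^3/2, an
    equality at |X| = l. It lets the third moment of [X] control that of its Gaussian substitute. *)
Lemma sqrt_var_cube (X : T -> R) : measurable_fun setT X ->
  Int (fun t => `|X t| ^+ 3) ->
  Num.sqrt (\int[P]_t (X t ^+ 2)) ^+ 3 <= \int[P]_t (`|X t| ^+ 3).
Proof.
move=> mX X3; have X2 := @integrable_cube_le X 2 isT mX X3.
set v := \int[P]_t (X t ^+ 2).
have v0 : 0 <= v by apply: Rintegral_ge0 => t _; exact: sqr_ge0.
set l := Num.sqrt v; have l0 : 0 <= l := sqrtr_ge0 v.
have l2 : l ^+ 2 = v by rewrite sqr_sqrtr.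
have -> : l ^+ 3 = \int[P]_t ((3 / 2 * l) * X t ^+ 2 + - (l ^+ 3 / 2)).
  rewrite RintegralD//; [|exact: integrable_RZ|exact: integrable_Rcst].
  by rewrite RintegralZl// Rintegral_cst1 -/v -l2; field.
apply: Rintegral_le => //.
  by apply: integrable_RD; [exact: integrable_RZ|exact: integrable_Rcst].
move=> t; rewrite -[X in _ * X + _]real_normK ?num_real//.
set a := `|X t|; have a0 : 0 <= a by exact: normr_ge0.
(* AM-GM: the difference is [(a - l)^2 (2 a + l) / 2] *)
have : 0 <= (a - l) ^+ 2 * (2 * a + l).
  by rewrite mulr_ge0 ?sqr_ge0// addr_ge0// mulr_ge0.
by nra.
Qed.

End taylor_expectation.
End real_integrable.

Section lindeberg.
Context {R : realType}.
Notation RT := (measurableTypeR R).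
Notation N := (@normal_prob R 0 1).
Variable mu : probability RT R.
Variables (f f1 f2 : R -> R) (C : R).
Hypotheses (mf : measurable_fun setT (f : RT -> R)) (f01 : forall x, 0 <= f x <= 1).
Hypothesis fT : forall x y,
  `|f (x + y) - f x - f1 x * y - f2 x * y ^+ 2 / 2| <= C * `|y| ^+ 3.

Definition normal_m3 : R := \int[N]_u (`|u| ^+ 3).

Let C0 : 0 <= C.
Proof. by have := fT 0 1; rewrite normr1 !expr1n !mulr1; apply: le_trans. Qed.

(* The Gaussian with the variance of [X] has the same second-order Taylor expansion. *)
Lemma lindeberg_replacement (X : RT -> R) (x : R) : measurable_fun setT X ->
  mu.-integrable setT (EFin \o (fun t => `|X t| ^+ 3)) -> \int[mu]_t X t = 0 ->
  `|\int[mu]_t f (x + X t) - \int[N]_u f (x + Num.sqrt (\int[mu]_t (X t ^+ 2)) * u)|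
  <= C * (1 + normal_m3) * \int[mu]_t (`|X t| ^+ 3).
Proof.
move=> mX X3 EX; have v3 := sqrt_var_cube mX X3.
set v := \int[mu]_t (X t ^+ 2) in v3 *; set l := Num.sqrt v in v3 *.
have v0 : 0 <= v by apply: Rintegral_ge0 => t _; exact: sqr_ge0.
have l0 : 0 <= l := sqrtr_ge0 v.
have T1 := taylor_expectation mf f01 fT x mX X3 EX.
have N3 := @integrable_normal_cube R.
have Y3 : N.-integrable setT (EFin \o (fun u : RT => `|l * u| ^+ 3)).
  have := integrable_RZ (l ^+ 3) N3; apply: eq_integrable => // u _ /=.
  by rewrite normrM exprMn (ger0_norm l0).
have mY : measurable_fun setT (fun u : RT => l * u) by exact: measurable_funM.
have mN : measurable_fun setT (id : RT -> R) by [].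
have EY : \int[N]_u (l * u) = 0.
  rewrite RintegralZl//; first by rewrite Rintegral_normal_id mulr0.
  by have := @integrable_cube_le _ _ _ N id 1 isT mN N3; apply: eq_integrable.
have T2 := taylor_expectation mf f01 fT x mY Y3 EY.
have E2 : \int[N]_u ((l * u) ^+ 2) = v.
  under eq_Rintegral do rewrite exprMn.
  rewrite RintegralZl//; last exact: (@integrable_cube_le _ _ _ N id 2 isT mN N3).
  by rewrite Rintegral_normal_sqr mulr1 sqr_sqrtr.
have E3 : \int[N]_u (`|l * u| ^+ 3) = l ^+ 3 * normal_m3.
  rewrite -RintegralZl//; apply: eq_Rintegral => u _.
  by rewrite normrM exprMn (ger0_norm l0).
rewrite E2 E3 in T2.
have m30 : 0 <= normal_m3 by apply: Rintegral_ge0 => u _; rewrite exprn_ge0.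
have {}v3 := ler_wpM2r m30 v3.
rewrite distrC in T2; have := le_trans (ler_distD _ _ _) (lerD T1 T2).
move=> /le_trans; apply; rewrite -mulrDr -mulrA ler_wpM2l//.
by rewrite mulrDl mul1r lerD2l [leRHS]mulrC.
Qed.

(** Induction on [n] with [x] free. For a fixed first coordinate, the induction hypothesis replaces
    all the others by one normal variable; after an exchange of integrals the first coordinate is
    replaced too, and stability of the normal law merges the two normal variables. A single integral
    against [N] is thus carried along, and no product of normal laws is formed. *)
Lemma lindeberg_bound n (zeta : 'I_n -> RT -> R) (x : R) :
  (forall i, measurable_fun setT (zeta i)) ->
  (forall i, mu.-integrable setT (EFin \o (fun t => `|zeta i t| ^+ 3))) ->
  (forall i, \int[mu]_t zeta i t = 0) ->
  `|\int[pprod mu n]_t f (x + \sum_(i < n) zeta i (tnth t i))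
    - \int[N]_u f (x + Num.sqrt (\sum_(i < n) \int[mu]_t (zeta i t ^+ 2)) * u)|
  <= C * (1 + normal_m3) * \sum_(i < n) \int[mu]_t (`|zeta i t| ^+ 3).
Proof.
have fi d (T : measurableType d) (P : probability T R) (X : T -> R) :
    measurable_fun setT X -> P.-integrable setT (EFin \o (fun t => f (X t))).
  move=> mX; apply: (@bounded_integrable _ _ _ _ _ 1).
    exact: (measurableT_comp mf).
  by move=> t; rewrite ger0_norm; case/andP: (f01 (X t)).
elim: n zeta x => [|n IHn] zeta x mz z3 Ez.
  rewrite !big_ord0 mulr0 sqrtr0.
  rewrite (_ : \int[_]_t _ = f x); last first.
    rewrite /Rintegral integral_pprod0//; first by rewrite big_ord0 addr0.
    under eq_fun do rewrite big_ord0; exact: measurable_cst.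
  rewrite (_ : \int[_]_t _ = f x); last first.
    by under eq_Rintegral do rewrite mul0r addr0; rewrite Rintegral_cst1.
  by rewrite subrr normr0.
pose z' i := zeta (lift ord0 i).
set v0 := \int[mu]_t (zeta ord0 t ^+ 2).
set V := \sum_(i < n) \int[mu]_t (z' i t ^+ 2).
have v00 : 0 <= v0 by apply: Rintegral_ge0 => t _; exact: sqr_ge0.
have V0 : 0 <= V.
  by apply: sumr_ge0 => i _; apply: Rintegral_ge0 => t _; exact: sqr_ge0.
have mS (y : R) : measurable_fun setT
    (fun t : n.-tuple RT => y + \sum_(i < n) z' i (tnth t i)).
  by apply: measurable_funD => //; apply: (@measurable_fun_sum_tnth _ _ z') => i; exact: mz.
have mz0 := mz ord0.
have E1 : \int[pprod mu n.+1]_t f (x + \sum_(i < n.+1) zeta i (tnth t i)) =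
    \int[mu]_y \int[pprod mu n]_t f (x + zeta ord0 y + \sum_(i < n) z' i (tnth t i)).
  have mfS : measurable_fun setT
      (fun t : n.+1.-tuple RT => f (x + \sum_(i < n.+1) zeta i (tnth t i))).
    apply: (measurableT_comp mf); apply: measurable_funD => //.
    exact: (@measurable_fun_sum_tnth _ _ zeta mz).
  have -> := @Rintegral_pprodS _ mu n _ mfS (fun t => f01 _).
  apply: eq_Rintegral => y _; apply: eq_Rintegral => t _.
  rewrite big_ord_recl (tnth_tcons y t) addrA; congr (f (_ + _)).
  by apply: eq_bigr => i _; rewrite (tnth_tcons y t).
have mI1 : measurable_fun setT (fun y : RT =>
    \int[pprod mu n]_t f (x + zeta ord0 y + \sum_(i < n) z' i (tnth t i))).
  apply: (@measurable_Rintegral_snd _ _ _ _ _ (pprod mu n) (fun z : RT * n.-tuple RT =>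
    f (x + zeta ord0 z.1 + \sum_(i < n) z' i (tnth z.2 i)))) => //.
  apply: (measurableT_comp mf); apply: measurable_funD.
    apply: measurable_funD => //; exact: measurableT_comp.
  apply: (measurableT_comp (@measurable_fun_sum_tnth _ _ z' _)) => //.
  by move=> i; exact: mz.
have mg2 : measurable_fun setT (fun z : RT * RT =>
    f (x + zeta ord0 z.1 + Num.sqrt V * z.2)).
  apply: (measurableT_comp mf); apply: measurable_funD.
    apply: measurable_funD => //; exact: measurableT_comp.
  by apply: measurable_funM => //; exact: measurable_snd.
have mI2 : measurable_fun setT (fun y : RT =>
    \int[N]_u f (x + zeta ord0 y + Num.sqrt V * u)).
  exact: (@measurable_Rintegral_snd _ _ _ _ _ N _ mg2).
have I01 (g : RT -> R) : measurable_fun setT g -> (forall y, 0 <= g y <= 1) ->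
    mu.-integrable setT (EFin \o g).
  move=> mg g01; apply: (@bounded_integrable _ _ _ _ _ 1) => // t.
  by rewrite ger0_norm; case/andP: (g01 t).
have I01N (g : RT -> R) : measurable_fun setT g -> (forall y, 0 <= g y <= 1) ->
    N.-integrable setT (EFin \o g).
  move=> mg g01; apply: (@bounded_integrable _ _ _ _ _ 1) => // t.
  by rewrite ger0_norm; case/andP: (g01 t).
set K := C * (1 + normal_m3).
have step1 : `|\int[mu]_y \int[pprod mu n]_t f (x + zeta ord0 y + \sum_(i < n) z' i (tnth t i))
    - \int[mu]_y \int[N]_u f (x + zeta ord0 y + Num.sqrt V * u)|
    <= K * \sum_(i < n) \int[mu]_t (`|z' i t| ^+ 3).
  rewrite -[leRHS](Rintegral_cst1 mu); apply: Rintegral_dist.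
  - apply: I01 => // y; apply: Rintegral_01 => //.
    by apply: (measurableT_comp mf); exact: mS.
  - apply: I01 => // y; apply: Rintegral_01 => //.
    by apply: (measurableT_comp mf); apply: measurable_funD => //; exact: measurable_funM.
  - exact: integrable_Rcst.
  by move=> y; apply: IHn => i; [exact: mz|exact: z3|exact: Ez].
have step2 : \int[mu]_y \int[N]_u f (x + zeta ord0 y + Num.sqrt V * u) =
    \int[N]_u \int[mu]_y f (x + Num.sqrt V * u + zeta ord0 y).
  have -> := Rfubini mu N mg2 (fun z => f01 _).
  by apply: eq_Rintegral => u _; apply: eq_Rintegral => y _; rewrite addrAC.
have mg3 : measurable_fun setT (fun z : RT * RT =>
    f (x + Num.sqrt V * z.2 + zeta ord0 z.1)).
  by under eq_fun do rewrite addrAC.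
have mg4 : measurable_fun setT (fun z : RT * RT =>
    f (x + Num.sqrt V * z.1 + Num.sqrt v0 * z.2)).
  apply: (measurableT_comp mf); apply: measurable_funD.
    apply: measurable_funD => //; apply: measurable_funM => //; exact: measurable_fst.
  by apply: measurable_funM => //; exact: measurable_snd.
have S3 : `|\int[N]_u \int[mu]_y f (x + Num.sqrt V * u + zeta ord0 y) -
    \int[N]_u \int[N]_w f (x + Num.sqrt V * u + Num.sqrt v0 * w)| <=
    K * \int[mu]_t (`|zeta ord0 t| ^+ 3).
  rewrite -[leRHS](Rintegral_cst1 N); apply: Rintegral_dist.
  - apply: I01N; first exact: (@measurable_Rintegral_fst _ _ _ _ _ mu _ mg3).
    move=> y; apply: Rintegral_01 => //.
    by apply: (measurableT_comp mf); exact: measurable_funD.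
  - apply: I01N; first exact: (@measurable_Rintegral_snd _ _ _ _ _ N _ mg4).
    move=> y; apply: Rintegral_01 => //.
    by apply: (measurableT_comp mf); apply: measurable_funD => //; exact: measurable_funM.
  - exact: integrable_Rcst.
  by move=> u; exact: lindeberg_replacement.
have S4 : \int[N]_u \int[N]_w f (x + Num.sqrt V * u + Num.sqrt v0 * w) =
    \int[N]_u f (x + Num.sqrt (\sum_(i < n.+1) \int[mu]_t (zeta i t ^+ 2)) * u).
  pose g (t : RT) := f (x + t).
  have mg : measurable_fun setT g.
    by apply: (measurableT_comp mf); exact: measurable_funD.
  have := @Rintegral_normal_conv R (Num.sqrt V) (Num.sqrt v0) g
     (sqrtr_ge0 _) (sqrtr_ge0 _) mg (fun t => f01 (x + t)).
  rewrite !sqr_sqrtr// => convE.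
  transitivity (\int[N]_u \int[N]_w g (Num.sqrt V * u + Num.sqrt v0 * w)).
    by apply: eq_Rintegral => u _; apply: eq_Rintegral => w _; rewrite /g addrA.
  by rewrite convE big_ord_recl addrC.
rewrite step2 in step1; rewrite E1 -S4 [in leRHS]big_ord_recl mulrDr [leRHS]addrC.
exact: le_trans (ler_distD _ _ _) (lerD step1 S3).
Qed.

End lindeberg.

Section smoothing.
Context d (T : measurableType d) (R : realType) (P : probability T R).
Variables (X : T -> R) (mX : measurable_fun setT X).

Definition prob_le (y : R) : R := fine (P [set t | X t <= y]).

Lemma measurable_set_le y : measurable [set t | X t <= y].
Proof. by rewrite -[X in measurable X]setTI; exact: measurable_fun_le. Qed.

Lemma prob_leE y : prob_le y = \int[P]_t \1_[set t | X t <= y] t.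
Proof.
by rewrite /Rintegral integral_indic ?setIT//; exact: measurable_set_le.
Qed.

Lemma integrable_set_le y : P.-integrable setT (EFin \o (\1_[set t | X t <= y] : T -> R)).
Proof.
apply: (@bounded_integrable _ _ _ _ _ 1).
  by apply: measurable_indic; exact: measurable_set_le.
by move=> t; rewrite indicE ger0_norm//; case: (_ \in _).
Qed.

Lemma measurable_logis : measurable_fun setT (@logis R : measurableTypeR R -> R).
Proof.
apply: continuous_measurable_fun => x.
have dl := @is_derive_logis R x.
exact/differentiable_continuous/derivable1_diffP/ex_derive.
Qed.

Lemma measurable_logisM (k a : R) :
  measurable_fun setT (fun x : measurableTypeR R => logis (k * (x - a))).
Proof.
apply: (measurableT_comp measurable_logis); apply: measurable_funM => //.
exact: measurable_funB.
Qed.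

Variables (k dlt : R).
Hypotheses (k0 : 0 < k) (dlt0 : 0 < dlt).

Lemma integrable_logisM a : P.-integrable setT (EFin \o (fun t => logis (k * (X t - a)))).
Proof.
apply: (@bounded_integrable _ _ _ _ _ 1).
  exact: (measurableT_comp (measurable_logisM k a) mX).
by move=> t; rewrite ger0_norm; case/andP: (logis_01 (k * (X t - a))).
Qed.

Lemma logis_le (x : R) : logis x <= expR (- x).
Proof.
rewrite /logis expRN lef_pV2 ?posrE ?expR_gt0// ?addr_gt0 ?expR_gt0//.
by rewrite lerDr.
Qed.

Lemma logis_ge (x : R) : 1 - expR x <= logis x.
Proof.
have e0 := expR_gt0 x.
rewrite /logis -[leRHS]div1r ler_pdivlMr ?addr_gt0//.
have := sqr_ge0 (expR x); nra.
Qed.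

(** The function [logis (k * (x - a))] decreases from 1 to 0, and at distance [dlt] from [a] it is
    within [expR (- (k * dlt))] of its limits. It therefore stands for the indicator of [x <= a] up
    to a shift of the threshold by [dlt]; the next lemma is the other direction. *)
Lemma prob_le_logis a :
  prob_le (a - dlt) <= \int[P]_t logis (k * (X t - a)) + expR (- (k * dlt)).
Proof.
rewrite -(Rintegral_cst1 P (expR _)) prob_leE -RintegralD//; last 2 first.
- exact: integrable_logisM.
- exact: integrable_Rcst.
apply: Rintegral_le.
- exact: integrable_set_le.
- exact: integrable_RD (integrable_logisM a) (integrable_Rcst _ _).
move=> t; rewrite indicE; have [|_] := boolP (t \in _); last first.
  by rewrite addr_ge0 ?expR_ge0// ltW// logis_gt0.
rewrite inE /= => Xt; rewrite -lerBlDr; apply: le_trans (logis_ge _).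
rewrite lerD2l lerN2 ler_expR -mulrN ler_pM2l//; lra.
Qed.

Lemma logis_prob_le a :
  \int[P]_t logis (k * (X t - a)) <= prob_le (a + dlt) + expR (- (k * dlt)).
Proof.
rewrite -(Rintegral_cst1 P (expR _)) prob_leE -RintegralD//; last 2 first.
- exact: integrable_set_le.
- exact: integrable_Rcst.
apply: Rintegral_le.
- exact: integrable_logisM.
- exact: integrable_RD (integrable_set_le _) (integrable_Rcst _ _).
move=> t; rewrite indicE; have [_|] := boolP (t \in _).
  by rewrite (le_trans (ltW (logis_lt1 _)))// lerDl expR_ge0.
rewrite notin_setE /= => /negP; rewrite -ltNge add0r => Xt.
apply: le_trans (logis_le _) _.
by rewrite ler_expR lerN2 ler_pM2l//; lra.
Qed.

End smoothing.

Section normal_cdf.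
Context {R : realType}.
Notation RT := (measurableTypeR R).
Notation N := (@normal_prob R 0 1).
Notation mu := (@lebesgue_measure R).

Definition cdfN (y : R) : R := prob_le N (id : RT -> R) y.

Lemma cdfNE y : (cdfN y)%:E = N [set u | u <= y].
Proof. by rewrite /cdfN /prob_le fineK//; exact: fin_num_measure (measurable_set_le _ _). Qed.

Lemma cdfN_lipschitz (y h : R) : 0 <= h -> cdfN (y + h) <= cdfN y + normal_peak 1 * h.
Proof.
move=> h0; rewrite -lee_fin EFinD !cdfNE.
have mA : measurable ([set u : RT | u <= y] : set RT) by exact: measurable_set_le.
have mB : measurable (`]y, y + h] : set RT) by [].
apply: (@le_trans _ _ (N ([set u : RT | u <= y] `|` `]y, y + h]))).
  apply: le_measure; rewrite ?inE//.
  - exact: measurable_set_le.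
  - exact: measurableU.
  move=> u /= uyh; rewrite in_itv/= uyh andbT.
  by case: (leP u y); [left|right].
apply: le_trans; first by apply: (measureU2 (normal_prob 0 1)).
apply: leeD => //; rewrite -[X in (X <= _)%E]/(normal_prob 0 1 _) /normal_prob.
apply: (@le_trans _ _ (\int[mu]_(x in `]y, (y + h)%R]) (normal_peak 1)%:E)%E).
  apply: ge0_le_integral => //.
  - by move=> x _; rewrite lee_fin normal_pdf_ge0.
  - by apply/measurable_EFinP; apply: measurable_funTS; exact: measurable_normal_pdf.
  - by move=> x _; rewrite lee_fin normal_pdf_ub// oner_neq0.
rewrite integral_cst// EFinM; apply: lee_wpmul2l; first by rewrite lee_fin normal_peak_ge0.
rewrite /= lebesgue_measure_itv/=; case: ifP => _; last by rewrite lee_fin.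
by rewrite -EFinB lee_fin addrC addKr.
Qed.

End normal_cdf.

Section uniform_clt.
Context {R : realType}.
Notation RT := (measurableTypeR R).
Notation N := (@normal_prob R 0 1).
Variable mu : probability RT R.

(** The smooth step is centered at [y + dlt] for the upper bound and at [y - dlt] for the lower one.
    On the normal side the threshold has then moved by [2 * dlt], which costs at most
    [normal_peak 1] times as much. Each bound pays [expR (- (k * dlt))] twice, and Lindeberg's
    bound, with constant [k ^+ 3], once. *)
Lemma clt_bound n (zeta : 'I_n -> RT -> R) (k dlt y : R) :
  0 < k -> 0 < dlt ->
  (forall i, measurable_fun setT (zeta i)) ->
  (forall i, mu.-integrable setT (EFin \o (fun t => `|zeta i t| ^+ 3))) ->
  (forall i, \int[mu]_t zeta i t = 0) ->
  \sum_(i < n) \int[mu]_t (zeta i t ^+ 2) = 1 ->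
  `|prob_le (pprod mu n) (fun t => \sum_(i < n) zeta i (tnth t i)) y - cdfN y| <=
  normal_peak 1 * (2 * dlt) + 2 * expR (- (k * dlt)) +
  k ^+ 3 * (1 + normal_m3) * \sum_(i < n) \int[mu]_t (`|zeta i t| ^+ 3).
Proof.
move=> k0 d0 mz z3 Ez V1.
have mS : measurable_fun setT (fun t : n.-tuple RT => \sum_(i < n) zeta i (tnth t i)).
  exact: measurable_fun_sum_tnth.
set E := k ^+ 3 * _ * _.
have L a : `|\int[pprod mu n]_t logis (k * (\sum_(i < n) zeta i (tnth t i) - a)) -
    \int[N]_u logis (k * (u - a))| <= E.
  have [f1 [f2 fT]] := logis_scale_taylor a (ltW k0).
  have := @lindeberg_bound R mu (fun x => logis (k * (x - a))) f1 f2 (k ^+ 3)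
    (measurable_logisM k a) (fun x => logis_01 _) fT n zeta 0 mz z3 Ez.
  rewrite V1 sqrtr1.
  under eq_Rintegral do rewrite add0r.
  have -> : \int[N]_u logis (k * (0 + 1 * u - a)) = \int[N]_u logis (k * (u - a)).
    by apply: eq_Rintegral => u _; rewrite add0r mul1r.
  by [].
have mid : measurable_fun setT (id : RT -> R) by [].
have e0 := expR_gt0 (- (k * dlt)).
have Ua := prob_le_logis (pprod mu n) mS dlt k0 (y + dlt).
have Ub := logis_prob_le N mid dlt k0 (y + dlt).
have La := logis_prob_le (pprod mu n) mS dlt k0 (y - dlt).
have Lb := prob_le_logis N mid dlt k0 (y - dlt).
have := L (y + dlt); have := L (y - dlt); rewrite !ler_norml.
move=> /andP[l1 l2] /andP[u1 u2].
rewrite addrK in Ua; rewrite subrK in La.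
rewrite -/(cdfN (y + dlt + dlt)) in Ub; rewrite -/(cdfN (y - dlt - dlt)) in Lb.
have d20 : 0 <= 2 * dlt by rewrite mulr_ge0 ?ltW.
have := cdfN_lipschitz y d20; have := cdfN_lipschitz (y - dlt - dlt) d20.
have -> : y - dlt - dlt + 2 * dlt = y by ring.
have -> : y + 2 * dlt = y + dlt + dlt by ring.
move=> c1 c2.
move: Ua Ub La Lb u1 u2 l1 l2 c1 c2; rewrite /=.
set p := prob_le _ _ y; set c := cdfN y; set c1 := cdfN _; set c2 := cdfN _.
set i1 := \int[_]_t _; set i2 := \int[_]_t _; set i3 := \int[_]_t _; set i4 := \int[_]_t _.
move=> *; apply/andP; split; lra.
Qed.

(** Uniformity in [y] allows thresholds that depend on [n]. The variance is asked to be 1 only for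
    large [n] because the application divides by a standard deviation whose positivity is known only
    from its limit. *)
Lemma uniform_clt (zeta : forall n, 'I_n -> RT -> R) :
  (forall n i, measurable_fun setT (zeta n i)) ->
  (forall n i, mu.-integrable setT (EFin \o (fun t => `|zeta n i t| ^+ 3))) ->
  (forall n i, \int[mu]_t zeta n i t = 0) ->
  (\forall n \near \oo, \sum_(i < n) \int[mu]_t (zeta n i t ^+ 2) = 1) ->
  \sum_(i < n) \int[mu]_t (`|zeta n i t| ^+ 3) @[n --> \oo] --> (0 : R) ->
  forall e, 0 < e -> \forall n \near \oo, forall y,
  `|prob_le (pprod mu n) (fun t => \sum_(i < n) zeta n i (tnth t i)) y - cdfN y| <= e.
Proof.
move=> mz z3 Ez V1 L e e0.
have pk0 : 0 < normal_peak 1 :> R by rewrite normal_peak_gt0 ?oner_neq0.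
have m30 : 0 <= @normal_m3 R by apply: Rintegral_ge0 => u _; rewrite exprn_ge0.
(* [dlt] makes the first term of [clt_bound] equal to [e / 4]. Below, [k] is such that
   [k * dlt = 8 / e], so that twice the exponential is at most [e / 4] because [1 + u <= expR u]. *)
pose dlt := e / (4 * 2 * normal_peak 1).
have d0 : 0 < dlt by rewrite divr_gt0// !mulr_gt0.
pose k := 8 / (e * dlt).
have k0 : 0 < k by rewrite divr_gt0// mulr_gt0.
have ek : expR (- (k * dlt)) <= e / 8.
  rewrite expRN -[leRHS]invrK lef_pV2 ?posrE ?expR_gt0 ?invr_gt0 ?divr_gt0//.
  apply: le_trans (expR_ge1Dx _); rewrite /k.
  have -> : 8 / (e * dlt) * dlt = (e / 8)^-1 by field; rewrite !gt_eqF.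
  by rewrite lerDr.
pose K := k ^+ 3 * (1 + normal_m3).
have K0 : 0 < K by rewrite mulr_gt0 ?exprn_gt0// ltr_wpDr.
have eK : 0 < e / 4 / K by rewrite !divr_gt0.
move/cvgrPdist_le : L => /(_ _ eK) L.
near=> n => y.
have V : \sum_(i < n) \int[mu]_t (zeta n i t ^+ 2) = 1 by near: n.
have Ln : `|0 - \sum_(i < n) \int[mu]_t (`|zeta n i t| ^+ 3)| <= e / 4 / K by near: n.
apply: le_trans (clt_bound y k0 d0 (mz n) (z3 n) (Ez n) V) _.
have t0 : 0 <= \sum_(i < n) \int[mu]_t (`|zeta n i t| ^+ 3).
  by apply: sumr_ge0 => i _; apply: Rintegral_ge0 => t _; rewrite exprn_ge0.
rewrite sub0r normrN ger0_norm// ler_pdivlMr// mulrC -/K in Ln.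
have -> : normal_peak 1 * (2 * dlt) = e / 4 by rewrite /dlt; field; rewrite gt_eqF.
move: Ln; rewrite -/K; set X := K * _ => Ln; lra.
Unshelve. all: by end_near. Qed.

End uniform_clt.

(** * Volumes and p-Gaussian probabilities of cones *)

Section density_product.
Context {R : realType}.
Notation RT := (measurableTypeR R).
Variable p : \bar R.
Local Open Scope ereal_scope.

Lemma measurable_slice n (F : n.+1.-tuple RT -> \bar R) y : measurable_fun setT F ->
  measurable_fun setT (fun t : n.-tuple RT => F (tcons (y, t))).
Proof.
move=> mF; apply: (measurableT_comp mF).
apply: (measurableT_comp (@measurable_tcons R n)); exact: pair1_measurable.
Qed.

Lemma measurable_tcons_comp n (F : n.+1.-tuple RT -> \bar R) : measurable_fun setT F ->
  measurable_fun setT (F \o @tcons R n).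
Proof. by move=> mF; apply: (measurableT_comp mF); exact: measurable_tcons. Qed.

Lemma measurable_prod_pdf n :
  measurable_fun setT (fun x : n.-tuple RT => (\prod_(i < n) pgauss_pdf p (tnth x i))%:E).
Proof.
apply/measurable_EFinP; apply: (@measurable_fun_prod_tnth _ n (fun _ => pgauss_pdf p)).
by move=> i; exact: measurable_pgauss_pdf.
Qed.

Lemma ge0_integral_pprod_pgauss n (F : n.-tuple RT -> \bar R) :
  measurable_fun setT F -> (forall x, 0 <= F x) ->
  \int[pprod (pgauss p) n]_x F x =
  \int[vol n]_x (F x * (\prod_(i < n) pgauss_pdf p (tnth x i))%:E).
Proof.
elim: n F => [|n IHn] F mF F0.
  rewrite integral_pprod0// integral_vol0 ?big_ord0 ?mule1//.
  by apply: emeasurable_funM => //; exact: measurable_prod_pdf.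
have pdf0 m (t : m.-tuple RT) : 0 <= (\prod_(i < m) pgauss_pdf p (tnth t i))%:E.
  by rewrite lee_fin prodr_ge0// => i _; exact: pgauss_pdf_ge0.
rewrite ge0_integral_pprodS// ge0_integral_volS//; last 2 first.
- by apply: emeasurable_funM => //; exact: measurable_prod_pdf.
- by move=> x; rewrite mule_ge0.
rewrite ge0_integral_pgauss; last 2 first.
- apply: (@measurable_fun_fubini_tonelli_F _ _ _ _ _ (pprod (pgauss p) n)
    (F \o @tcons R n)); [exact: measurable_tcons_comp|by move=> z; exact: F0].
- by move=> y; apply: integral_ge0.
apply: eq_integral => y _.
have mFy := measurable_slice y mF.
rewrite (IHn _ mFy)// -ge0_integralZr//; last 3 first.
- by apply: emeasurable_funM => //; exact: measurable_prod_pdf.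
- by move=> t _; rewrite mule_ge0.
- by rewrite lee_fin pgauss_pdf_ge0.
apply: eq_integral => t _.
rewrite -muleA -EFinM; congr (_ * _%:E)%E; rewrite big_ord_recl (tnth_tcons y t) mulrC.
by congr (_ * _)%R; apply: eq_bigr => i _; rewrite (tnth_tcons y t).
Qed.

End density_product.

Section vol_scaling.
Context {R : realType}.
Notation RT := (measurableTypeR R).
Notation leb := (@lebesgue_measure R).

(** Constant factors give the dilations of cones and balls; the inverses of the semi-axes carry an
    ellipsoid onto a ball. *)
Definition vscale n (c : 'I_n -> R) (x : n.-tuple RT) : n.-tuple RT :=
  [tuple c i * tnth x i | i < n].

Lemma measurable_vscale n (c : 'I_n -> R) : measurable_fun setT (vscale c).
Proof.
apply/measurable_fun_tnthP => i /=.
rewrite (_ : _ \o _ = (fun x : n.-tuple RT => c i * tnth x i)); last first.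
  by apply/funext => x; rewrite /= tnth_mktuple.
by apply: measurable_funM => //; exact: measurable_tnth.
Qed.

Lemma vscale_tcons n (c : 'I_n.+1 -> R) y (t : n.-tuple RT) :
  vscale c (tcons (y, t)) = tcons (c ord0 * y, vscale (c \o lift ord0) t).
Proof.
apply: eq_from_tnth => i; rewrite tnth_mktuple.
have [j ->|->] := unliftP ord0 i.
  by rewrite !(tnth_tcons _ _).2 tnth_mktuple.
by rewrite !(tnth_tcons _ _).1.
Qed.

Lemma ge0_integral_vscale n (c : 'I_n -> R) (F : n.-tuple RT -> \bar R) :
  (forall i, 0 < c i) -> measurable_fun setT F -> (forall x, (0 <= F x)%E) ->
  (\int[vol n]_x F (vscale c x) = (\prod_(i < n) c i)^-1%:E * \int[vol n]_x F x)%E.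
Proof.
elim: n c F => [|n IHn] c F c0 mF F0.
  rewrite big_ord0 invr1 mul1e !integral_vol0//; first by congr F; apply: eq_from_tnth => -[].
  by apply: (measurableT_comp mF); exact: measurable_vscale.
rewrite !ge0_integral_volS//; last first.
  by apply: (measurableT_comp mF); exact: measurable_vscale.
pose c' := c \o lift ord0.
pose H y := (\int[vol n]_t F (tcons (y, t)))%E.
have mH : measurable_fun setT (H : RT -> \bar R).
  apply: (@measurable_fun_fubini_tonelli_F _ _ _ _ _ (vol n)
    (F \o @tcons R n)); [exact: measurable_tcons_comp|by move=> z; exact: F0].
have H0 y : (0 <= H y)%E by apply: integral_ge0.
have P0 : (0 <= (\prod_(i < n) c' i)^-1%:E)%E.
  by rewrite lee_fin invr_ge0 prodr_ge0// => i _; exact/ltW/c0.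
transitivity (\int[leb]_y ((\prod_(i < n) c' i)^-1%:E * H (c ord0 * y + 0)%R))%E.
  apply: eq_integral => y _; rewrite addr0 -(IHn c' (fun t => F (tcons (c ord0 * y, t)))).
  - by apply: eq_integral => t _; rewrite vscale_tcons.
  - by move=> i; exact: c0.
  - exact: measurable_slice.
  - by [].
have mHa : measurable_fun setT (fun y : RT => H (c ord0 * y + 0)%R).
  by apply: (measurableT_comp mH); apply: measurable_funD => //; exact: measurable_funM.
have -> := ge0_integralZl leb measurableT mHa (fun y _ => H0 _) P0.
have -> := ge0_integral_affine 0 (c0 ord0) mH H0; rewrite muleA -EFinM.
by rewrite -invfM big_ord_recl mulrC.
Qed.

Lemma vol_vscale n (c : 'I_n -> R) (A : set (n.-tuple RT)) :
  (forall i, 0 < c i) -> measurable A ->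
  (vol n [set x | A (vscale c x)] = (\prod_(i < n) c i)^-1%:E * vol n A)%E.
Proof.
move=> c0 mA.
have mI : measurable_fun setT (fun x => (\1_A x)%:E : \bar R).
  by apply/measurable_EFinP; exact: measurable_indic.
have volE (B : set (n.-tuple RT)) : measurable B -> (\int[vol n]_x (\1_B x)%:E)%E = vol n B.
  by move=> mB; rewrite integral_indic// setIT.
have mAc : measurable [set x | A (vscale c x)].
  by rewrite -[X in measurable X]setTI; exact: measurable_vscale.
by rewrite -(volE _ mAc) -(volE _ mA) -(@ge0_integral_vscale n c _ c0 mI)//.
Qed.

End vol_scaling.

Section cones.
Context {R : realType}.
Notation RT := (measurableTypeR R).

Definition cone n (K : set (n.-tuple RT)) :=
  forall (s : R) x, 0 < s -> K x -> K (vscale (fun=> s) x).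

Lemma vscaleK n (s : R) (x : n.-tuple RT) : 0 < s ->
  vscale (fun=> s) (vscale (fun=> s^-1) x) = x.
Proof.
move=> s0; apply: eq_from_tnth => i; rewrite !tnth_mktuple mulrA mulfV ?gt_eqF//.
by rewrite mul1r.
Qed.

Lemma coneP n (K : set (n.-tuple RT)) s x : cone K -> 0 < s ->
  K (vscale (fun=> s) x) <-> K x.
Proof.
move=> ratio_event s0; split; last exact: ratio_event.
have sV : 0 < s^-1 by rewrite invr_gt0.
by move=> /(ratio_event _ _ sV); rewrite -{2}(invrK s) vscaleK.
Qed.

Definition lp_sum n r (x : n.-tuple RT) : R := \sum_(i < n) `|tnth x i| `^ r.

Lemma lp_sum_ge0 n r (x : n.-tuple RT) : 0 <= lp_sum r x.
Proof. by apply: sumr_ge0 => i _; exact: powR_ge0. Qed.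

Lemma measurable_lp_sum n r : measurable_fun setT (@lp_sum n r).
Proof.
apply: (@measurable_fun_sum_tnth _ n (fun _ y => `|y| `^ r)) => i.
exact: measurable_abs_powR.
Qed.

Lemma lp_ball_sum n r : 0 < r ->
  lp_ball n r%:E = [set x : n.-tuple RT | lp_sum r x <= 1].
Proof.
move=> r0; apply/seteqP; split => x /=; rewrite /lp_ball /lp_norm /= -/(lp_sum r x) => x1.
- have := ge0_ler_powR (ltW r0) (_ : _ \in Num.nneg) (_ : _ \in Num.nneg) x1.
  rewrite !nnegrE powR_ge0 ler01 powR1 -powRrM mulVf ?gt_eqF// powRr1 ?lp_sum_ge0//.
  by apply.
- have r'0 : 0 <= r^-1 by rewrite invr_ge0 ltW.
  have := ge0_ler_powR r'0 (_ : _ \in Num.nneg) (_ : _ \in Num.nneg) x1.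
  by rewrite !nnegrE lp_sum_ge0 ler01 powR1; apply.
Qed.

Lemma lp_sum_vscale n r s (x : n.-tuple RT) : 0 <= s ->
  lp_sum r (vscale (fun=> s) x) = s `^ r * lp_sum r x.
Proof.
move=> s0; rewrite /lp_sum mulr_sumr; apply: eq_bigr => i _.
by rewrite tnth_mktuple normrM powRM// ger0_norm.
Qed.

Lemma measurable_lp_ball n r : 0 < r -> measurable (lp_ball n r%:E : set (n.-tuple RT)).
Proof.
move=> r0; rewrite lp_ball_sum// -[X in measurable X]setTI.
by apply: measurable_fun_le => //; exact: measurable_lp_sum.
Qed.

Lemma lp_sum_le_scale n r t (x : n.-tuple RT) : 0 < r -> 0 < t ->
  lp_sum r x / r <= t <-> lp_ball n r%:E (vscale (fun=> ((r * t) `^ r^-1)^-1) x).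
Proof.
move=> r0 t0; rewrite lp_ball_sum//=.
have rt0 : 0 < r * t by rewrite mulr_gt0.
rewrite lp_sum_vscale ?invr_ge0 ?powR_ge0//.
rewrite -powRN -powRrM mulNr mulVf ?gt_eqF// powRN powRr1 ?(ltW rt0)//.
by rewrite [(_ * t)^-1 * _]mulrC !ler_pdivrMr// mul1r (mulrC t).
Qed.

(** The constant in the form in which the layer-cake integration yields it. The powers of [r]
    cancel, which leaves Gamma(n/r + 1) / (2 Gamma(1/r + 1))^n. *)
Definition ball_cst n r : R :=
  pgauss_cst r ^+ n * (r `^ (n%:R / r) * Gamma (n%:R / r + 1)).

Lemma ball_cst_gt0 n r : (0 < n)%N -> 0 < r -> 0 < ball_cst n r.
Proof.
move=> n0 r0; rewrite mulr_gt0 ?exprn_gt0 ?pgauss_cst_gt0// mulr_gt0 ?powR_gt0//.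
by rewrite Gamma_gt0// divr_gt0// ltr0n.
Qed.

Lemma prod_pgauss_pdf n r (x : n.-tuple RT) : 0 < r ->
  \prod_(i < n) pgauss_pdf r%:E (tnth x i) =
  pgauss_cst r ^+ n * expR (- (lp_sum r x / r)).
Proof.
move=> r0; under eq_bigr do rewrite pgauss_pdf_EFin//.
rewrite big_split/= prodr_const card_ord; congr (_ * _).
by rewrite -expR_sum sumrN /lp_sum mulr_suml.
Qed.

Lemma lp_sum_gt0 n r (x : n.-tuple RT) : 0 < r ->
  lp_sum r x <= 0 -> forall i, tnth x i = 0.
Proof.
move=> r0 x0 i; have /eqP : lp_sum r x = 0.
  by apply/eqP; rewrite eq_le x0 lp_sum_ge0.
rewrite psumr_eq0; last by move=> j _; exact: powR_ge0.
move=> /allP /(_ i (mem_index_enum _)) /=; rewrite powR_eq0 normr_eq0.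
by move=> /andP[/eqP].
Qed.

Local Open Scope ereal_scope.

(* The density of the product depends on [x] only through [lp_sum r x], so the layer-cake formula
   slices [K] into dilates of [K `&` lp_ball n r%:E]. *)
Lemma pprod_cone n r (K : set (n.-tuple RT)) : (0 < n)%N -> (0 < r)%R ->
  measurable K -> cone K ->
  pprod (pgauss r%:E) n K = (ball_cst n r)%:E * vol n (K `&` lp_ball n r%:E).
Proof.
move=> n0 r0 mK coneK.
have mB := @measurable_lp_ball n r r0.
have mI : measurable_fun setT (fun x => (\1_K x)%:E : \bar R).
  by apply/measurable_EFinP; exact: measurable_indic.
have c0 := pgauss_cst_gt0 r0.
have my : measurable_fun setT (fun x : n.-tuple RT => lp_sum r x / r)%R.
  by apply: measurable_funM => //; exact: measurable_lp_sum.
rewrite -[LHS](_ : \int[pprod (pgauss r%:E) n]_x (\1_K x)%:E = _); last first.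
  by rewrite integral_indic// setIT.
rewrite ge0_integral_pprod_pgauss//.
under eq_integral do rewrite prod_pgauss_pdf// EFinM muleCA.
rewrite ge0_integralZl//; last 2 first.
- apply: emeasurable_funM => //; apply/measurable_EFinP; apply: measurableT_comp => //.
  exact: measurableT_comp.
- by rewrite lee_fin exprn_ge0// ltW.
rewrite (@ge0_integral_layer_cake _ _ R (vol n) _ _ my mI)//.
rewrite /ball_cst EFinM -muleA; congr (_ * _).
have nr0 : (0 < n%:R / r)%R by rewrite divr_gt0// ltr0n.
rewrite EFinM -igammaE// /igamma.
set V := vol n _.
rewrite muleAC -ge0_integralZl//; last 3 first.
- exact: measurable_powRM_expR.
- by move=> t _; rewrite lee_fin mulr_ge0 ?powR_ge0 ?expR_ge0.
- by rewrite mule_ge0 ?lee_fin ?powR_ge0// /V measure_ge0.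
rewrite [RHS]integral_mkcond; apply: eq_integral => t _; rewrite patchE.
have mle (u : R) : measurable [set x : n.-tuple RT | (lp_sum r x / r <= u)%R].
  by rewrite -[X in measurable X]setTI; exact: measurable_fun_le.
rewrite integral_indic//.
case: ifPn => [|].
  rewrite inE/= in_itv/= andbT => t0.
  have rt0 : (0 < r * t)%R by rewrite mulr_gt0.
  set s := ((r * t) `^ r^-1)%R.
  have s0 : (0 < s)%R by rewrite powR_gt0.
  have sV0 : (0 < s^-1)%R by rewrite invr_gt0.
  have -> : K `&` [set x : n.-tuple RT | (lp_sum r x / r <= t)%R] =
     [set x | (K `&` lp_ball n r%:E) (vscale (fun=> s^-1)%R x)].
    apply/seteqP; split => x /= [Kx xt]; split.
    - exact/coneP.
    - exact/(lp_sum_le_scale _ r0 t0).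
    - exact/(coneP _ coneK sV0).
    - exact/(lp_sum_le_scale _ r0 t0).
  rewrite (@vol_vscale _ n (fun=> s^-1)%R)//; last exact: measurableI.
  rewrite prodr_const card_ord -/V exprVn invrK.
  have -> : (s ^+ n = r `^ (n%:R / r) * t `^ (n%:R / r))%R.
    by rewrite /s -powR_mulrn ?powR_ge0// -powRrM powRM ?(ltW t0) ?(ltW r0)// (mulrC r^-1)%R.
  rewrite muleA -EFinM [RHS]muleAC -EFinM; congr (_%:E * _).
  by rewrite mulrC mulrA.
rewrite notin_setE/= in_itv/= andbT => /negP; rewrite -leNgt => t0.
rewrite (_ : vol n _ = 0) ?mule0//; apply/eqP; rewrite eq_le measure_ge0 andbT.
(* For [t <= 0] the slice lies in the box reduced to the origin, which is null because [n > 0]. *)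
apply: (@le_trans _ _ (vol n [set x | forall i, [set 0%R] (tnth x i)])).
  apply: le_measure; rewrite ?inE.
  - exact: measurableI.
  - by apply: (@measurable_box R n (fun _ => [set 0%R])) => i.
  move=> x /= [_ xt] i; apply: (lp_sum_gt0 r0).
  by rewrite -(pmulr_lle0 _ (_ : 0 < r^-1)%R) ?invr_gt0//; exact: le_trans xt t0.
rewrite (@vol_box R n (fun _ => [set 0%R])).
  by move: n0; rewrite lt0n; case: (n) => // m _; rewrite big_ord_recl lebesgue_measure_set1 mul0e.
by move=> i.
Qed.

End cones.

Section ball_volumes.
Context {R : realType}.
Notation RT := (measurableTypeR R).
Implicit Types (p : \bar R) (n : nat).

(* The reciprocal of the volume of [lp_ball n p], see [vol_lp_ball]. *)
Definition lp_cst p n : R := if p is r%:E then ball_cst n r else 2^-1 ^+ n.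

Lemma lp_cst_gt0 p n : (0 < n)%N -> (0 < p)%E -> 0 < lp_cst p n.
Proof.
move=> n0; case: p => [r||]//=; first by rewrite lte_fin => r0; exact: ball_cst_gt0.
Qed.

Lemma lp_ball_pinfty n : lp_ball n +oo%E =
  [set x : n.-tuple RT | forall i, `[-1, 1]%classic (tnth x i)].
Proof.
apply/seteqP; split => x; rewrite /lp_ball /lp_norm /=.
  by move=> /bigmax_leP[_ x1] i; rewrite /= in_itv/= -ler_norml; exact: x1.
move=> x1; apply/bigmax_leP; split => // i _.
by have := x1 i; rewrite /= in_itv/= -ler_norml.
Qed.

Lemma measurable_lp_ballp n p : (0 < p)%E ->
  measurable (lp_ball n p : set (n.-tuple RT)).
Proof.
case: p => [r||]//; first by rewrite lte_fin; exact: measurable_lp_ball.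
move=> _; rewrite lp_ball_pinfty.
by apply: (@measurable_box R n (fun _ => `[-1, 1]%classic)) => i.
Qed.

Lemma pprod_ball n p (K : set (n.-tuple RT)) : (0 < n)%N -> (0 < p)%E ->
  measurable K -> ((p < +oo)%E -> cone K) ->
  pprod (pgauss p) n K = ((lp_cst p n)%:E * vol n (K `&` lp_ball n p))%E.
Proof.
move=> n0; case: p => [r||]//.
  by rewrite lte_fin => r0 mK coneK; apply: pprod_cone => //; apply: coneK; rewrite ltry.
move=> _ mK _.
have mB := @measurable_lp_ballp n +oo%E (ltry 0).
have mI : measurable_fun setT (fun x => (\1_K x)%:E : \bar R).
  by apply/measurable_EFinP; exact: measurable_indic.
transitivity (\int[pprod (pgauss +oo) n]_x (\1_K x)%:E)%E.
  by rewrite integral_indic// setIT.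
rewrite ge0_integral_pprod_pgauss//.
transitivity (\int[vol n]_x ((lp_cst +oo n)%:E * (\1_(K `&` lp_ball n +oo%E) x)%:E))%E.
  apply: eq_integral => x _.
  rewrite (_ : \prod_(i < n) _ = 2^-1 ^+ n * \1_(lp_ball n +oo%E) x); last first.
    rewrite /pgauss_pdf ltxx andbF big_split/= prodr_const card_ord; congr (_ * _).
    rewrite lp_ball_pinfty indicE; have [|] := boolP (x \in _).
      rewrite inE /= => x1; apply: big1 => i _; rewrite indicE mem_set//.
      exact: x1.
    rewrite notin_setE => nx.
    have [i xi] : exists i, ~ `[-1, 1]%classic (tnth x i) by apply/existsNP.
    by rewrite (bigD1 i)//= indicE memNset// mul0r.
  by rewrite -!EFinM indicI /=; congr EFin; ring.
rewrite ge0_integralZl//; last 2 first.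
- by apply/measurable_EFinP; apply: measurable_indic; exact: measurableI.
- by rewrite lee_fin ltW// lp_cst_gt0.
by rewrite integral_indic ?setIT//; exact: measurableI.
Qed.

(** The case [K = setT] of [pprod_ball], as the product law has mass 1. The same equation excludes
    an infinite volume, [lp_cst] being positive. *)
Lemma vol_lp_ball n p : (0 < n)%N -> (0 < p)%E ->
  vol n (lp_ball n p) = ((lp_cst p n)^-1)%:E.
Proof.
move=> n0 p0; have d0 := lp_cst_gt0 n0 p0.
have := @pprod_ball n p setT n0 p0 measurableT (fun _ _ _ _ _ => I).
have -> : pprod (pgauss p) n setT = 1%E := probability_setT (pprod (pgauss p) n).
rewrite setTI; case: (vol n _) (measure_ge0 (vol n) (lp_ball n p)) => [v||]//.
  by move=> _; rewrite -EFinM => -[dv]; congr EFin; rewrite -[RHS]mulr1 dv mulKf ?gt_eqF.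
  by move=> _; rewrite gt0_muley// lte_fin.
by move=> _; rewrite gt0_muleNy// lte_fin.
Qed.

Lemma powRV (x a : R) : 0 <= x -> x^-1 `^ a = (x `^ a)^-1.
Proof. by move=> x0; rewrite -(powR_inv1 x0) -powRrM mulN1r powRN. Qed.

Lemma lp_radiusE n p : (0 < n)%N -> (0 < p)%E ->
  lp_radius n p = lp_cst p n `^ n%:R^-1.
Proof.
move=> n0 p0; rewrite /lp_radius /unit_vol_factor vol_lp_ball//=.
have d0 := lp_cst_gt0 n0 p0.
by rewrite powRN powRV ?(ltW d0)// invrK.
Qed.

Lemma lp_radius_gt0 n p : (0 < n)%N -> (0 < p)%E -> 0 < lp_radius n p.
Proof. by move=> n0 p0; rewrite lp_radiusE// powR_gt0// lp_cst_gt0. Qed.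

Lemma powR_invnK n (x : R) : (0 < n)%N -> 0 <= x -> (x `^ n%:R^-1) ^+ n = x.
Proof.
move=> n0 x0; rewrite -powR_mulrn ?powR_ge0// -powRrM mulVf ?powRr1//.
by rewrite pnatr_eq0 -lt0n.
Qed.

Definition ell_sum n q (sigma : 'I_n -> R) (x : n.-tuple RT) : R :=
  \sum_(i < n) sigma i `^ (- q) * `|tnth x i| `^ q.

Lemma measurable_ell_sum n q (sigma : 'I_n -> R) : measurable_fun setT (ell_sum q sigma).
Proof.
apply: (@measurable_fun_sum_tnth _ n (fun i y => sigma i `^ (- q) * `|y| `^ q)) => i.
by apply: measurable_funM => //; exact: measurable_abs_powR.
Qed.

Lemma ell_sum_vscale n q (sigma : 'I_n -> R) s x : 0 <= s ->
  ell_sum q sigma (vscale (fun=> s) x) = s `^ q * ell_sum q sigma x.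
Proof.
move=> s0; rewrite /ell_sum mulr_sumr; apply: eq_bigr => i _.
by rewrite tnth_mktuple normrM powRM// ger0_norm// mulrCA.
Qed.

Lemma ellipsoidE n q (sigma : 'I_n -> R) : (forall i, 0 < sigma i) ->
  ellipsoid q sigma = [set x : n.-tuple RT | ell_sum q sigma x <= 1].
Proof.
move=> s0; rewrite /ellipsoid /ell_sum; apply/seteqP; split => x /=.
- congr (_ <= _); apply: eq_bigr => i _; rewrite normrM powRM// mulrC; congr (_ * _).
  by rewrite gtr0_norm ?invr_gt0// powRV ?(ltW (s0 i))// powRN.
- congr (_ <= _); apply: eq_bigr => i _; rewrite normrM powRM// mulrC; congr (_ * _).
  by rewrite gtr0_norm ?invr_gt0// powRV ?(ltW (s0 i))// powRN.
Qed.

Lemma measurable_ell_le n q (sigma : 'I_n -> R) (c : R) :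
  measurable [set x : n.-tuple RT | ell_sum q sigma x <= c].
Proof.
rewrite -[X in measurable X]setTI; apply: measurable_fun_le => //.
exact: measurable_ell_sum.
Qed.

Lemma vol_ellipsoid n q (sigma : 'I_n -> R) : (0 < n)%N -> 0 < q ->
  (forall i, 0 < sigma i) ->
  vol n (ellipsoid q sigma) = ((\prod_(i < n) sigma i) / lp_cst q%:E n)%:E.
Proof.
move=> n0 q0 s0.
have sV i : 0 < (sigma i)^-1 by rewrite invr_gt0.
have -> : ellipsoid q sigma =
    [set x : n.-tuple RT | lp_ball n q%:E (vscale (fun i => (sigma i)^-1) x)].
  have E x : lp_sum q (vscale (fun i => (sigma i)^-1) x) = ell_sum q sigma x.
    apply: eq_bigr => i _; rewrite tnth_mktuple normrM powRM//.
    by rewrite gtr0_norm ?invr_gt0// powRV ?(ltW (s0 i))// powRN.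
  by rewrite ellipsoidE// lp_ball_sum//; apply/seteqP; split => x /=; rewrite E.
rewrite vol_vscale//; last exact: measurable_lp_ball.
by rewrite vol_lp_ball// -EFinM prodfV invrK.
Qed.

Lemma dilateE n c (A : set (n.-tuple RT)) : 0 < c ->
  dilate c A = [set x | A (vscale (fun=> c^-1) x)].
Proof.
move=> c0; have cV : 0 < c^-1 by rewrite invr_gt0.
apply/seteqP; split => x /=.
  by move=> [y Ay <-]; have := vscaleK y cV; rewrite invrK => ->.
by move=> Ax; exists (vscale (fun=> c^-1) x) => //; exact: vscaleK.
Qed.

Lemma vscaleM n (a b : R) (x : n.-tuple RT) :
  vscale (fun=> a) (vscale (fun=> b) x) = vscale (fun=> a * b) x.
Proof. by apply: eq_from_tnth => i; rewrite !tnth_mktuple mulrA. Qed.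

(* Rescaling [lp_ball n p] to volume 1 turns the dilated ellipsoid into
   [sum_i |x_i / sigma_i|^q <= scale_kappa^q]. *)
Definition scale_kappa n p q (sigma : 'I_n -> R) (t : R) : R :=
  t * ((\prod_(i < n) sigma i) `^ (- n%:R^-1) * lp_radius n q%:E) / lp_radius n p.

Lemma scale_kappa_gt0 n p q (sigma : 'I_n -> R) t : (0 < n)%N -> (0 < p)%E -> 0 < q ->
  (forall i, 0 < sigma i) -> 0 < t -> 0 < scale_kappa p q sigma t.
Proof.
move=> n0 p0 q0 s0 t0.
have P0 : 0 < \prod_(i < n) sigma i by apply: prodr_gt0.
by rewrite divr_gt0 ?lp_radius_gt0// !mulr_gt0 ?lp_radius_gt0 ?powR_gt0.
Qed.

Lemma vol_intersection n p q (sigma : 'I_n -> R) t : (0 < n)%N -> (0 < p)%E -> 0 < q ->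
  (forall i, 0 < sigma i) -> 0 < t ->
  vol n (unit_dilation (lp_ball n p) `&` dilate t (unit_dilation (ellipsoid q sigma))) =
  ((lp_cst p n)%:E * vol n ([set x | (ell_sum q sigma x <= scale_kappa p q sigma t `^ q)%R]
     `&` lp_ball n p))%E.
Proof.
move=> n0 p0 q0 s0 t0; have q0' : (0 < q%:E)%E by rewrite lte_fin.
have P0 : 0 < \prod_(i < n) sigma i by apply: prodr_gt0.
have rp0 := lp_radius_gt0 n0 p0; have rq0 := lp_radius_gt0 n0 q0'.
have dq0 := lp_cst_gt0 n0 q0'; have dp0 := lp_cst_gt0 n0 p0.
set c := (\prod_(i < n) sigma i) `^ (- n%:R^-1) * lp_radius n q%:E.
have c0 : 0 < c by rewrite mulr_gt0// powR_gt0.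
have cE : unit_vol_factor (ellipsoid q sigma) = c.
  rewrite /unit_vol_factor vol_ellipsoid//= /c lp_radiusE// powRM ?invr_ge0 ?(ltW P0) ?(ltW dq0)//.
  by congr (_ * _); rewrite powRN powRV ?(ltW dq0)// invrK.
have k0 := scale_kappa_gt0 n0 p0 q0 s0 t0.
set k := scale_kappa p q sigma t in k0 *.
have kE : k = t * c / lp_radius n p by [].
rewrite /unit_dilation cE -/(lp_radius n p) !dilateE//.
set A := _ `&` lp_ball n p.
have -> : ([set x | lp_ball n p (vscale (fun=> (lp_radius n p)^-1) x)] `&`
   [set x | [set x0 | ellipsoid q sigma (vscale (fun=> c^-1) x0)] (vscale (fun=> t^-1) x)]) =
   [set x | A (vscale (fun=> (lp_radius n p)^-1) x)].
  have eqv x : ellipsoid q sigma (vscale (fun=> c^-1) (vscale (fun=> t^-1) x)) <->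
    ell_sum q sigma (vscale (fun=> (lp_radius n p)^-1) x) <= k `^ q.
    rewrite ellipsoidE//= vscaleM !ell_sum_vscale ?mulr_ge0 ?invr_ge0 ?(ltW c0) ?(ltW t0) ?(ltW rp0)//.
    have -> : (c^-1 * t^-1) = (lp_radius n p)^-1 * k^-1.
      by rewrite kE; field; rewrite !gt_eqF.
    rewrite powRM ?invr_ge0 ?(ltW rp0) ?(ltW k0)// mulrAC (powRV _ (ltW k0)).
    by rewrite ler_pdivrMr ?mul1r// powR_gt0.
  by apply/seteqP; split => x /= [h1 h2]; split => //; apply/eqv.
rewrite (@vol_vscale _ n (fun=> (lp_radius n p)^-1)) //; last 2 first.
- by move=> _; rewrite invr_gt0.
- by apply: measurableI; [exact: measurable_ell_le|exact: measurable_lp_ballp].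
rewrite prodr_const card_ord exprVn invrK lp_radiusE// powR_invnK// ltW//.
Qed.

(** The last factor is the power [q] of the r-norm, so that both sides are homogeneous of degree
    [q]. *)
Definition ell_cone n r q (sigma : 'I_n -> R) (k : R) : set (n.-tuple RT) :=
  [set x | ell_sum q sigma x <= k `^ q * lp_sum r x `^ (q / r)].

Lemma measurable_ell_cone n r q (sigma : 'I_n -> R) k : measurable (ell_cone r q sigma k).
Proof.
rewrite -[X in measurable X]setTI; apply: measurable_fun_le => //.
  exact: measurable_ell_sum.
apply: measurable_funM => //; apply: (measurableT_comp (measurable_powR _)).
exact: measurable_lp_sum.
Qed.

Lemma cone_ell_cone n r q (sigma : 'I_n -> R) k : 0 < r -> cone (ell_cone r q sigma k).
Proof.
move=> r0 s x s0 xK; rewrite /ell_cone /=.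
have -> := ell_sum_vscale q sigma x (ltW s0).
have -> := lp_sum_vscale r x (ltW s0).
have s00 := powR_ge0 s r; have L0 := lp_sum_ge0 r x.
have rq : r * (q / r) = q by rewrite mulrCA mulfV ?gt_eqF// mulr1.
rewrite (powRM _ s00 L0) -powRrM rq mulrCA.
by rewrite ler_pM2l// powR_gt0.
Qed.

Local Open Scope ereal_scope.

(** In the ball [lp_sum r x <= 1], so there the condition that defines the cone is the stronger
    one. *)
Lemma ell_cone_lower n r q (sigma : 'I_n -> R) k : (0 < n)%N -> (0 < r)%R -> (0 < q)%R ->
  pprod (pgauss r%:E) n (ell_cone r q sigma k) <=
  (lp_cst r%:E n)%:E * vol n ([set x | (ell_sum q sigma x <= k `^ q)%R] `&` lp_ball n r%:E).
Proof.
move=> n0 r0 q0; have r0' : 0 < r%:E by rewrite lte_fin.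
rewrite pprod_ball//; [|exact: measurable_ell_cone|by move=> _; exact: cone_ell_cone].
apply: lee_wpmul2l; first by rewrite lee_fin ltW// lp_cst_gt0.
apply: le_measure; rewrite ?inE.
- by apply: measurableI; [exact: measurable_ell_cone|exact: measurable_lp_ballp].
- by apply: measurableI; [exact: measurable_ell_le|exact: measurable_lp_ballp].
rewrite lp_ball_sum// => x [Kx /= x1]; split => //=.
apply: le_trans Kx _; rewrite ler_piMr ?powR_ge0//.
have := @ge0_ler_powR R (q / r) (divr_ge0 (ltW q0) (ltW r0)) (lp_sum r x) 1%R.
by rewrite !nnegrE lp_sum_ge0 ler01 powR1; apply.
Qed.

(* A point of the ball that is outside of the ball of radius [1 - e] has almost unit norm. *)
Lemma ell_cone_upper n r q (sigma : 'I_n -> R) k e : (0 < n)%N -> (0 < r)%R -> (0 < q)%R ->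
  (0 < k)%R -> (0 < e < 1)%R ->
  (lp_cst r%:E n)%:E * vol n ([set x | (ell_sum q sigma x <= k `^ q)%R] `&` lp_ball n r%:E)
  <= pprod (pgauss r%:E) n (ell_cone r q sigma (k / (1 - e))) + ((1 - e) ^+ n)%:E.
Proof.
move=> n0 r0 q0 k0 /andP[e0 e1]; have r0' : 0 < r%:E by rewrite lte_fin.
have d0 := lp_cst_gt0 n0 r0'.
have f0 : (0 < 1 - e)%R by rewrite subr_gt0.
have fV0 : (0 < (1 - e)^-1)%R by rewrite invr_gt0.
rewrite pprod_ball//; [|exact: measurable_ell_cone|by move=> _; exact: cone_ell_cone].
(* The ball of radius [1 - e], whose share of the unit ball is [(1 - e) ^+ n]. *)
set S := [set x : n.-tuple RT | lp_ball n r%:E (vscale (fun=> (1 - e)^-1)%R x)].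
have mB := @measurable_lp_ballp n r%:E r0'.
have mK := measurable_ell_cone r q sigma (k / (1 - e)).
have mS : measurable S.
  rewrite -[X in measurable X]setTI.
  by apply: (measurable_vscale (fun=> (1 - e)^-1)%R) => //.
have -> : ((1 - e) ^+ n)%:E = (lp_cst r%:E n)%:E * vol n S.
  rewrite /S (@vol_vscale _ n (fun=> (1 - e)^-1)%R)// vol_lp_ball//.
  rewrite prodr_const card_ord exprVn invrK -!EFinM; congr EFin.
  by rewrite mulrCA mulfV ?gt_eqF// mulr1.
rewrite -ge0_muleDr//; apply: lee_wpmul2l; first by rewrite lee_fin ltW.
apply: (@le_trans _ _ (vol n ((ell_cone r q sigma (k / (1 - e)) `&` lp_ball n r%:E) `|` S))).
  apply: le_measure; rewrite ?inE.
  - exact: measurableI (measurable_ell_le _ _ _) mB.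
  - exact: measurableU (measurableI _ _ mK mB) mS.
  move=> x /= [xk xB].
  have [xS|xS] := leP (lp_sum r (vscale (fun=> (1 - e)^-1)%R x)) 1%R.
    by right; rewrite /S /= lp_ball_sum.
  left; split => //; rewrite /ell_cone /=; apply: le_trans xk _.
  rewrite powRM ?(ltW k0) ?(ltW fV0)// -mulrA ler_peMr ?powR_ge0//.
  move: xS; rewrite lp_sum_vscale ?(ltW fV0)// => xS.
  have -> : (((1 - e)^-1 `^ q) = ((1 - e)^-1 `^ r) `^ (q / r))%R.
    by rewrite -powRrM mulrCA mulfV ?gt_eqF// mulr1.
  rewrite -powRM ?powR_ge0 ?lp_sum_ge0//.
  have := @ge0_ler_powR R (q / r) (divr_ge0 (ltW q0) (ltW r0)) 1%R
     ((1 - e)^-1 `^ r * lp_sum r x)%R.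
  by rewrite !nnegrE ler01 mulr_ge0 ?powR_ge0 ?lp_sum_ge0// powR1; apply => //; exact: ltW.
exact: measureU2 (measurableI _ _ mK mB) mS.
Qed.

End ball_volumes.

(** * Asymptotics of the radii of the balls *)

Section gamma_bounds.
Context {R : realType}.
Notation RT := (measurableTypeR R).
Notation leb := (@lebesgue_measure R).

Lemma ln_le_subr1 (x : R) : 0 < x -> ln x <= x - 1.
Proof.
move=> x0; have := @le_ln1Dx R (x - 1); rewrite addrCA subrr addr0; apply.
by rewrite ltrBrDr addrC subrr.
Qed.

Lemma powR_expR (x a : R) : 0 < x -> x `^ a = expR (a * ln x).
Proof. by move=> x0; rewrite /powR gt_eqF. Qed.

Lemma integral_expR_scale (a : R) : 0 < a ->
  (\int[leb]_(t in `]0%R, +oo[) (expR (- (a * t)))%:E = (a^-1)%:E)%E.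
Proof.
move=> a0; have me : measurable_fun setT (fun t : RT => (expR (- t))%:E : \bar R).
  by apply/measurable_EFinP; apply: measurableT_comp.
pose f (t : RT) : \bar R := ((expR (- t))%:E * (\1_(`]0%R, +oo[ : set RT) t)%:E)%E.
have mf : measurable_fun setT f.
  by apply: emeasurable_funM => //; apply/measurable_EFinP; exact: measurable_indic.
have f0 t : (0 <= f t)%E by rewrite mule_ge0.
have := ge0_integral_affine 0 a0 mf f0.
have -> : (\int[leb]_t f t = 1)%E.
  have := @integral_expRN R 0; rewrite oppr0 expR0 => <-.
  rewrite -integral_itv_obnd_cbnd; last exact: measurable_funTS.
  rewrite [RHS]integral_mkcond; apply: eq_integral => t _.
  by rewrite patchE /f indicE; case: ifP; rewrite ?mule1 ?mule0.
rewrite mule1 => <-; rewrite integral_mkcond; apply: eq_integral => t _.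
rewrite patchE /f indicE addr0 !mem_setE !in_itv/= !andbT pmulr_rgt0//.
by case: ifP; rewrite ?mule1 ?mule0.
Qed.

(* [t^x e^-t] is at most [e^(x ln x - x + 2) e^(-t/x)], from [ln u <= u - 1] at [u = (1 - 1/x) t / x]. *)
Lemma Gamma_ub (x : R) : 2 <= x -> ln (Gamma (x + 1)) <= x * ln x - x + 2 + ln x.
Proof.
move=> x2; have x0 : 0 < x by lra.
have xn0 : x != 0 by rewrite gt_eqF.
(* The part 1/x of the decay rate of e^-t is kept for integrability and contributes the factor [x].
   The rest, [c], absorbs the power t^x at the cost of c^(-x), which is at most e^2 for [x >= 2]. *)
pose c := 1 - x^-1.
have xV : x^-1 <= 2^-1 by rewrite lef_pV2 ?posrE.
have xV0 : 0 < x^-1 by rewrite invr_gt0.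
have c0 : 0 < c by rewrite /c; lra.
have cn0 : c != 0 by rewrite gt_eqF.
have K0 : (0 : R) <= expR (x * ln x - x + 2) by exact: expR_ge0.
have bnd t : 0 < t -> t `^ x * expR (- t) <= expR (x * ln x - x + 2) * expR (- (x^-1 * t)).
  move=> t0; rewrite powR_expR// -!expRD ler_expR.
  have u0 : 0 < c * t / x by rewrite divr_gt0// mulr_gt0.
  have := ln_le_subr1 u0; rewrite ln_div ?posrE ?mulr_gt0// lnM ?posrE//.
  have : - ln c <= c^-1 - 1.
    by rewrite -lnV ?posrE//; apply: ln_le_subr1; rewrite invr_gt0.
  have -> : c^-1 - 1 = (x * c)^-1.
    have xE : x^-1 = 1 - c by rewrite /c; ring.
    by rewrite invfM xE mulrBl mul1r mulfV.
  move=> h1 h2.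
  have h3 := ler_wpM2l (ltW x0) h1; have h4 := ler_wpM2l (ltW x0) h2.
  have e1 : x * (x * c)^-1 = c^-1 by rewrite invfM mulVKf.
  have e2 : x * (c * t / x - 1) = t - x^-1 * t - x by rewrite /c; field; rewrite xn0.
  have c2 : c^-1 <= 2 by rewrite -[leRHS]invrK lef_pV2 ?posrE ?invr_gt0// /c; lra.
  rewrite e1 in h3; rewrite e2 in h4.
  rewrite !mulrDr !mulrN in h3 h4.
  lra.
have Gx0 := Gamma_gt0 x0.
suff : Gamma (x + 1) <= expR (x * ln x - x + 2) * x.
  rewrite -ler_ln ?posrE ?mulr_gt0 ?expR_gt0// => /le_trans; apply.
  by rewrite lnM ?posrE ?expR_gt0// expRK.
rewrite -lee_fin -igammaE// EFinM -[X in (_ <= _ * X%:E)%E]invrK -integral_expR_scale//.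
have me : measurable_fun (`]0%R, +oo[ : set RT) (fun t : RT => (expR (- (x^-1 * t)))%:E : \bar R).
  apply: measurable_funTS; apply/measurable_EFinP; apply: measurableT_comp => //.
  by apply: measurableT_comp => //; exact: measurable_funM.
rewrite -ge0_integralZl//; apply: ge0_le_integral => //.
- by move=> t _; rewrite lee_fin mulr_ge0 ?powR_ge0 ?expR_ge0.
- exact: measurable_powRM_expR.
- exact: emeasurable_funM.
- by move=> t; rewrite /= in_itv/= andbT => t0; rewrite -EFinM lee_fin bnd.
Qed.

(** Only the interval [[x, x + 1]] is kept, on which t^x >= x^x and e^-t >= e^(-x - 1). *)
Lemma Gamma_lb (x : R) : 0 < x -> x * ln x - x - 1 <= ln (Gamma (x + 1)).
Proof.
move=> x0; have Gx0 := Gamma_gt0 x0.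
rewrite -(expRK (_ - 1)) ler_ln ?posrE ?expR_gt0//.
rewrite -lee_fin -igammaE//.
apply: (@le_trans _ _ (\int[leb]_(t in `[x, (x + 1)%R]) (expR (x * ln x - x - 1))%:E)%E).
  rewrite integral_cst//= lebesgue_measure_itv/= lte_fin ltrDl ltr01 -EFinB.
  have -> : x + 1 - x = 1 by ring.
  by rewrite mule1.
have mg (D : set RT) : measurable D -> measurable_fun D (fun t : RT => (t `^ x * expR (- t))%:E).
  by move=> _; exact: measurable_powRM_expR.
apply: (@le_trans _ _ (\int[leb]_(t in `[x, (x + 1)%R]) (t `^ x * expR (- t))%:E)%E).
  apply: ge0_le_integral => //.
  - by apply: mg.
  move=> t /=; rewrite in_itv/= => /andP[xt tx].
  have t0 : 0 < t by exact: lt_le_trans xt.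
  rewrite lee_fin powR_expR// -expRD ler_expR.
  have : x * ln x <= x * ln t by rewrite ler_pM2l// ler_ln.
  by lra.
apply: ge0_subset_integral => //.
- exact: mg.
- by move=> t _; rewrite lee_fin mulr_ge0 ?powR_ge0 ?expR_ge0.
- by move=> t /=; rewrite !in_itv/= andbT => /andP[xt _]; exact: lt_le_trans xt.
Qed.

End gamma_bounds.

Section radius_asymptotics.
Context {R : realType}.
Implicit Types (p : \bar R) (n : nat).

Definition lp_nradius n p : R := n%:R `^ (- fine p^-1%E) * lp_radius n p.

Lemma lp_nradius_gt0 n p : (0 < n)%N -> (0 < p)%E -> 0 < lp_nradius n p.
Proof. by move=> n0 p0; rewrite mulr_gt0 ?lp_radius_gt0// powR_gt0// ltr0n. Qed.

Lemma fine_inve (r : R) : r != 0 -> fine (r%:E)^-1%E = r^-1.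
Proof. by move=> r0; rewrite inver (negbTE r0). Qed.

(** The radius is the n-th root of [ball_cst]. With x = n/r, the main term x ln x - x of Stirling's
    formula is split off from ln Gamma(x + 1); its ln n part cancels against the normalization by
    n^(-1/r), and the last bracket is O(ln n). *)
Lemma ln_lp_nradiusE n (r : R) : (0 < n)%N -> 0 < r ->
  ln (lp_nradius n r%:E) = (ln (pgauss_cst r) - r^-1) + n%:R^-1 *
    (ln (Gamma (n%:R / r + 1)) - (n%:R / r * ln (n%:R / r) - n%:R / r)).
Proof.
move=> n0 r0; have r0' : (0 < r%:E)%E by rewrite lte_fin.
have nR : (0 : R) < n%:R by rewrite ltr0n.
have d0 := lp_cst_gt0 n0 r0'; have c0 := pgauss_cst_gt0 r0.
have G0 : 0 < Gamma (n%:R / r + 1) by apply: Gamma_gt0; rewrite divr_gt0.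
rewrite /lp_nradius lp_radiusE// fine_inve ?gt_eqF//.
rewrite lnM ?posrE ?powR_gt0// !ln_powR /= /ball_cst.
rewrite lnM ?posrE ?exprn_gt0 ?mulr_gt0 ?powR_gt0// lnXn//.
rewrite lnM ?posrE ?powR_gt0// ln_powR ln_div ?posrE// -mulr_natl.
by field; rewrite !gt_eqF.
Qed.

Lemma cvg_natr_sqrt_inv : (Num.sqrt (n%:R : R))^-1 @[n --> \oo] --> (0 : R).
Proof.
apply/gtr0_cvgV0; first by near=> n; rewrite sqrtr_gt0 ltr0n; near: n; exact: nbhs_infty_gt.
apply/cvgryPge => A; near=> n.
have [A0|A0] := leP A 0; first exact: le_trans A0 (sqrtr_ge0 _).
rewrite -(ger0_norm (ltW A0)) -sqrtr_sqr ler_sqrt ?ler0n//.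
by near: n; exact: nbhs_infty_ger.
Unshelve. all: by end_near. Qed.

(** The precision o(n^(-1/2)) is imposed by the later multiplication by [wratio], which can be of
    order n^(1/2). For [p = +oo] the normalized radius is exactly 1/2. *)
Lemma ln_lp_nradius_cvg p : (0 < p)%E ->
  exists l, Num.sqrt n%:R * (ln (lp_nradius n p) - l) @[n --> \oo] --> (0 : R).
Proof.
case: p => [r||]//; last first.
  move=> _; exists (ln 2^-1); apply: cvg_near_cst; near=> n.
  have n0 : (0 < n)%N by near: n; exact: nbhs_infty_gt.
  rewrite /lp_nradius lp_radiusE//= oppr0 powRr0 mul1r.
  by rewrite -powR_mulrn ?invr_ge0// -powRrM mulfV ?pnatr_eq0 -?lt0n// powRr1 ?invr_ge0// subrr mulr0.
rewrite lte_fin => r0; exists (ln (pgauss_cst r) - r^-1).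
pose s n : R := Num.sqrt n%:R.
(* The fourth root of [n]: from ln n = 4 ln u <= 4 u one gets ln n / n^(1/2) <= 4 / u. *)
pose u n : R := Num.sqrt (Num.sqrt n%:R).
have rV0 : 0 < r^-1 by rewrite invr_gt0.
have su : (s n)^-1 @[n --> \oo] --> (0 : R) := cvg_natr_sqrt_inv.
have uu : (u n)^-1 @[n --> \oo] --> (0 : R).
  apply/cvgrPdist_lt => e e0; move/cvgrPdist_lt : su => /(_ (e ^+ 2) (exprn_gt0 _ e0)) su.
  near=> n; have : `|0 - (s n)^-1| < e ^+ 2 by near: n.
  rewrite !sub0r !normrN !ger0_norm ?invr_ge0 ?sqrtr_ge0// => sn.
  rewrite -(@ltr_pXn2r _ 2) ?nnegrE ?invr_ge0 ?sqrtr_ge0 ?(ltW e0)//.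
  by rewrite exprVn sqr_sqrtr ?sqrtr_ge0.
pose K := 2 + `|ln r^-1|.
apply: (@squeeze_cvgr _ _ _ _ (fun n => - (s n)^-1) (fun n => K * (s n)^-1 + 4 * (u n)^-1)).
- near=> n.
  have n0 : (0 < n)%N by near: n; exact: nbhs_infty_gt.
  have nR : (0 : R) < n%:R by rewrite ltr0n.
  have s0 : 0 < s n by rewrite sqrtr_gt0.
  have u0 : 0 < u n by rewrite sqrtr_gt0.
  have s2 : s n ^+ 2 = n%:R by rewrite sqr_sqrtr// ltW.
  have u2 : u n ^+ 2 = s n by rewrite sqr_sqrtr// ltW.
  have x2 : 2 <= n%:R / r by rewrite ler_pdivlMr//; near: n; exact: nbhs_infty_ger.
  have x0 : 0 < n%:R / r by rewrite divr_gt0.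
  rewrite ln_lp_nradiusE//; set A := ln _ - r^-1; rewrite [A + _]addrC addrK -/(s n).
  have -> : forall a : R, s n * (n%:R^-1 * a) = a / s n.
    by move=> a; rewrite -s2; field; rewrite gt_eqF.
  have lb := Gamma_lb x0; have ub := Gamma_ub x2.
  have lnx : ln (n%:R / r) <= 4 * u n + `|ln r^-1|.
    have l4 : ln (n%:R : R) = 4 * ln (u n).
      by rewrite -s2 -u2 -exprM lnXn// mulr_natl.
    rewrite lnM ?posrE// l4 lerD ?ler_norm//.
    by rewrite ler_pM2l//; exact/ltW/ln_sublinear.
  apply/andP; split.
    by rewrite -mulN1r ler_pM2r ?invr_gt0//; lra.
  have -> : K * (s n)^-1 + 4 * (u n)^-1 = (K + 4 * u n) / s n.
    by rewrite -u2; field; rewrite gt_eqF.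
  by rewrite ler_pM2r ?invr_gt0// /K; lra.
- by rewrite -[X in _ --> X]oppr0; exact: cvgN.
- rewrite -[X in _ --> X](_ : K * 0 + 4 * 0 = 0 :> R); last by rewrite !mulr0 addr0.
  by apply: cvgD; apply: cvgMr.
Unshelve. all: by end_near. Qed.

Lemma cvg_sqrt_small (f : nat -> R) (l : R) :
  Num.sqrt n%:R * (f n - l) @[n --> \oo] --> (0 : R) -> f n @[n --> \oo] --> l.
Proof.
move=> h.
have h0 : (Num.sqrt n%:R)^-1 * (Num.sqrt n%:R * (f n - l)) @[n --> \oo] --> (0 : R).
  by rewrite -[X in _ --> X](mul0r (0 : R)); apply: cvgM => //; exact: cvg_natr_sqrt_inv.
have : (Num.sqrt n%:R)^-1 * (Num.sqrt n%:R * (f n - l)) + l @[n --> \oo] --> l.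
  by rewrite -[X in _ --> X]add0r; apply: cvgD => //; exact: cvg_cst.
apply: cvg_trans.
apply: near_eq_cvg; near=> n => /=.
rewrite /= mulrA mulVf ?mul1r ?subrK// gt_eqF// sqrtr_gt0 ltr0n.
by near: n; exact: nbhs_infty_gt.
Unshelve. all: by end_near. Qed.

(** [l] is the logarithm of the limit in the definition of [Apq]. The second clause sharpens that
    limit to an error o(n^(-1/2)), small enough to survive the multiplication by [wratio]. *)
Lemma ApqE p (q : R) : (0 < p)%E -> 0 < q ->
  exists l : R, Apq p q = pgauss_moment p q `^ (- q^-1) * expR l /\
  Num.sqrt n%:R * (ln (lp_nradius n q%:E / lp_nradius n p) - l) @[n --> \oo] --> (0 : R).
Proof.
move=> p0 q0; have q0' : (0 < q%:E)%E by rewrite lte_fin.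
have [lp hp] := ln_lp_nradius_cvg p0; have [lq hq] := ln_lp_nradius_cvg q0'.
have h : Num.sqrt n%:R * (ln (lp_nradius n q%:E / lp_nradius n p) - (lq - lp)) @[n --> \oo] --> (0 : R).
  have : Num.sqrt n%:R * (ln (lp_nradius n q%:E) - lq) - Num.sqrt n%:R * (ln (lp_nradius n p) - lp)
      @[n --> \oo] --> (0 : R).
    by rewrite -[X in _ --> X](subr0 (0 : R)); apply: cvgB.
  apply: cvg_trans; apply: near_eq_cvg; near=> n => /=.
  have n0 : (0 < n)%N by near: n; exact: nbhs_infty_gt.
  by rewrite ln_div ?posrE ?lp_nradius_gt0//; ring.
exists (lq - lp); split => //; rewrite /Apq; congr (_ * _); apply/cvg_lim => //.
have hl := cvg_sqrt_small h.
have : expR (ln (lp_nradius n q%:E / lp_nradius n p)) @[n --> \oo] --> expR (lq - lp).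
  by apply: continuous_cvg => //; exact: continuous_expR.
apply: cvg_trans; apply: near_eq_cvg.
near=> n => /=.
have n0 : (0 < n)%N by near: n; exact: nbhs_infty_gt.
rewrite lnK ?posrE ?divr_gt0 ?lp_nradius_gt0// /lp_nradius fine_inve ?gt_eqF//.
Unshelve. all: by end_near. Qed.

End radius_asymptotics.

Lemma measurable_set_gt d (T : measurableType d) (R : realType) (X : T -> R) (y : R) :
  measurable_fun setT X -> measurable [set t | y < X t].
Proof.
move=> mX; rewrite (_ : [set t | y < X t] = ~` [set t | X t <= y]).
  by apply: measurableC; exact: measurable_set_le.
by apply/seteqP; split => t /=; rewrite ltNge => /negP.
Qed.

(** * Linearization of the ratio *)

Section second_moment.
Context {R : realType}.
Notation RT := (measurableTypeR R).
Variable mu : probability RT R.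

(** The cross terms vanish because the [f i] are centered. The constant [c] makes room in the
    induction for the coordinate already fixed. *)
Lemma ge0_integral_sqr_sum n (f : 'I_n -> RT -> R) (c : R) :
  (forall i, measurable_fun setT (f i)) ->
  (forall i, mu.-integrable setT (EFin \o f i)) ->
  (forall i, mu.-integrable setT (EFin \o (fun y => f i y ^+ 2))) ->
  (forall i, \int[mu]_y f i y = 0) ->
  (\int[pprod mu n]_t ((c + \sum_(i < n) f i (tnth t i)) ^+ 2)%:E =
   (c ^+ 2 + \sum_(i < n) \int[mu]_y (f i y ^+ 2))%:E)%E.
Proof.
elim: n f c => [|n IHn] f c mf f1 f2 Ef.
  rewrite integral_pprod0; first by rewrite !big_ord0 !addr0.
  by under eq_fun do rewrite big_ord0; exact: measurable_cst.
rewrite ge0_integral_pprodS; last 2 first.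
- apply/measurable_EFinP; apply: measurable_funX; apply: measurable_funD => //.
  exact: (@measurable_fun_sum_tnth _ _ f mf).
- by move=> t; rewrite lee_fin sqr_ge0.
set V := \sum_(i < n) \int[mu]_y (f (lift ord0 i) y ^+ 2).
transitivity (\int[mu]_y ((c + f ord0 y) ^+ 2 + V)%:E)%E.
  apply: eq_integral => y _.
  rewrite -(IHn (fun i => f (lift ord0 i)))//; apply: eq_integral => t _.
  rewrite big_ord_recl (tnth_tcons y t) addrA.
  by congr ((_ + _) ^+ 2)%:E; apply: eq_bigr => i _; rewrite (tnth_tcons y t).
have i2 : mu.-integrable setT (EFin \o (fun y => 2 * c * f ord0 y + f ord0 y ^+ 2)).
  by apply: integrable_RD => //; exact: integrable_RZ.
rewrite (eq_integral (EFin \o (fun y => (c ^+ 2 + V) + (2 * c * f ord0 y + f ord0 y ^+ 2)))); last first.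
  by move=> y _ /=; congr EFin; ring.
rewrite ge0_Rintegral; last exact: integrable_RD (integrable_Rcst _ _) i2.
rewrite RintegralD//; last exact: integrable_Rcst.
rewrite Rintegral_cst1 RintegralD//; last exact: integrable_RZ.
rewrite RintegralZl// Ef mulr0 add0r big_ord_recl -/V.
by congr EFin; rewrite -addrA; congr (_ + _); rewrite addrC.
Qed.

Lemma chebyshev_sum n (f : 'I_n -> RT -> R) (k : R) : 0 < k ->
  (forall i, measurable_fun setT (f i)) ->
  (forall i, mu.-integrable setT (EFin \o f i)) ->
  (forall i, mu.-integrable setT (EFin \o (fun y => f i y ^+ 2))) ->
  (forall i, \int[mu]_y f i y = 0) ->
  (pprod mu n [set t | (k < `|\sum_(i < n) f i (tnth t i)|)%R] <=
   ((\sum_(i < n) \int[mu]_y (f i y ^+ 2)) / k ^+ 2)%:E)%E.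
Proof.
move=> k0 mf f1 f2 Ef.
have mS := @measurable_fun_sum_tnth _ _ f mf.
have mA : measurable [set t : n.-tuple RT | (k < `|\sum_(i < n) f i (tnth t i)|)%R].
  by apply: measurable_set_gt; exact: measurableT_comp.
have k2 : 0 < k ^+ 2 by rewrite exprn_gt0.
have := @ge0_integral_sqr_sum n f 0 mf f1 f2 Ef.
rewrite expr0n add0r mulrC EFinM => <-.
rewrite -(setIT [set t : n.-tuple RT | _]) -integral_indic//.
have mE : measurable_fun setT
    (fun t : n.-tuple RT => ((0 + \sum_(i < n) f i (tnth t i)) ^+ 2)%:E : \bar R).
  by apply/measurable_EFinP; apply: measurable_funX; exact: measurable_funD.
rewrite -ge0_integralZl//; last 2 first.
- by move=> t _; rewrite lee_fin sqr_ge0.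
- by rewrite lee_fin invr_ge0 ltW.
apply: ge0_le_integral => //.
- by apply/measurable_EFinP; exact: measurable_indic.
- exact: emeasurable_funM.
move=> t _; rewrite -EFinM lee_fin add0r indicE.
have [|_] := boolP (t \in _); last by rewrite mulr_ge0 ?sqr_ge0// invr_ge0 ltW.
rewrite inE /= => kS; rewrite mulrC ler_pdivlMr// mul1r -[leRHS]real_normK ?num_real//.
by rewrite lerXn2r ?nnegrE ?(ltW k0)// ltW.
Qed.

End second_moment.

Section log_bounds.
Context {R : realType}.
Implicit Types u : R.

Lemma ln_1D_ub u : -1 < u -> ln (1 + u) <= u.
Proof. exact: le_ln1Dx. Qed.

(** The bound ln v <= v - 1 at v = 1/(1 + u) gives ln(1 + u) >= u/(1 + u), and u/(1 + u) - u + 2 u^2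
    = u^2 (1 + 2 u)/(1 + u). *)
Lemma ln_1D_lb u : - 2^-1 <= u -> u - 2 * u ^+ 2 <= ln (1 + u).
Proof.
move=> u2; have u1 : 0 < 1 + u by lra.
have : ln (1 + ((1 + u)^-1 - 1)) <= (1 + u)^-1 - 1.
  by apply: le_ln1Dx; rewrite ltrBrDr addrC subrr invr_gt0.
rewrite addrCA subrr addr0 lnV ?posrE// => h.
suff : (1 + u)^-1 - 1 <= - u + 2 * u ^+ 2 by lra.
rewrite lerBlDr -[leLHS]div1r ler_pdivrMr//.
have : 0 <= u ^+ 2 * (1 + 2 * u) by rewrite mulr_ge0 ?sqr_ge0//; lra.
by nra.
Qed.

End log_bounds.

Section ratio_event_bounds.
Context {R : realType}.
Notation RT := (measurableTypeR R).
Variable mu : probability RT R.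
Variables (a b : RT -> R) (q w : R).
Hypotheses (q0 : 0 < q) (w0 : 0 <= w).
Hypotheses (ma : measurable_fun setT a) (mb : measurable_fun setT b).
Hypotheses (Ea : \int[mu]_y (a y - 1) = 0) (Eb : \int[mu]_y (b y - 1) = 0).
Hypothesis a3 : mu.-integrable setT (EFin \o (fun y => `|a y - 1| ^+ 3)).
Hypothesis b3 : mu.-integrable setT (EFin \o (fun y => `|b y - 1| ^+ 3)).

Definition numer_dev y := (a y - 1) / q.
Definition denom_dev y := w * (b y - 1).
Definition wsum n (B : 'I_n -> R) : R := \sum_(i < n) B i.
Definition wnorm n (B : 'I_n -> R) : R := Num.sqrt (\sum_(i < n) B i ^+ 2).
(** For variables of mean and variance 1, this is the mean of their [B]-weighted sum in units of its
    standard deviation. With [B i] the power [- q] of the i-th semi-axis it is a_n. *)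
Definition wratio n (B : 'I_n -> R) : R := wsum B / wnorm B.
(* [wratio B] times the linearization at the mean of the logarithm of the ratio
   [(sum_i B i * a x_i / wsum B)^(1/q) / (mean of b x_i)^w] is the sum of the [lin_summand B i x_i]. *)
Definition lin_summand n (B : 'I_n -> R) (i : 'I_n) (y : RT) : R :=
  B i / wnorm B * numer_dev y - wratio B / n%:R * denom_dev y.
(** The ratio is compared with [expR rho], after raising to the power [q] and multiplying out;
    without division the condition makes sense at every point. *)
Definition ratio_event n (B : 'I_n -> R) (rho : R) : set (n.-tuple RT) :=
  [set x | \sum_(i < n) B i * a (tnth x i) <=
    wsum B * expR (q * rho) * (n%:R^-1 * \sum_(i < n) b (tnth x i)) `^ (q * w)].

Let ma1 : measurable_fun setT (fun y => a y - 1).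
Proof. exact: measurable_funB. Qed.
Let mb1 : measurable_fun setT (fun y => b y - 1).
Proof. exact: measurable_funB. Qed.

Lemma measurable_lin_summand n (B : 'I_n -> R) i : measurable_fun setT (lin_summand B i).
Proof.
apply: measurable_funB; apply: measurable_funM => //; first exact: measurable_funM.
exact: measurable_funM.
Qed.

Lemma measurable_ratio_event n (B : 'I_n -> R) rho : measurable (ratio_event B rho).
Proof.
rewrite -[X in measurable X]setTI; apply: measurable_fun_le => //.
  apply: (@measurable_fun_sum_tnth _ n (fun i y => B i * a y)) => i.
  exact: measurable_funM.
apply: measurable_funM => //; apply: (measurableT_comp (measurable_powR _)).
apply: measurable_funM => //.
exact: (@measurable_fun_sum_tnth _ n (fun _ => b)).
Qed.

Let Va := \int[mu]_y ((a y - 1) ^+ 2).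
Let Vb := \int[mu]_y ((b y - 1) ^+ 2).

Section fixed_n.
Variables (n : nat) (B : 'I_n -> R).
Hypotheses (n0 : (0 < n)%N) (B0 : forall i, 0 < B i).

Let nR : (0 : R) < n%:R. Proof. by rewrite ltr0n. Qed.

Lemma sum_sqr_gt0 : 0 < \sum_(i < n) B i ^+ 2.
Proof.
rewrite lt_neqAle eq_sym psumr_neq0; last by move=> i _; exact: sqr_ge0.
rewrite sumr_ge0 ?andbT; last by move=> i _; exact: sqr_ge0.
by apply/hasP; exists (Ordinal n0); rewrite ?mem_index_enum//= exprn_gt0.
Qed.

Lemma wsum_gt0 : 0 < wsum B.
Proof.
rewrite /wsum lt_neqAle eq_sym psumr_neq0; last by move=> i _; exact: ltW.
rewrite sumr_ge0 ?andbT; last by move=> i _; exact: ltW.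
by apply/hasP; exists (Ordinal n0); rewrite ?mem_index_enum//=.
Qed.

Lemma wnorm_gt0 : 0 < wnorm B. Proof. by rewrite sqrtr_gt0 sum_sqr_gt0. Qed.

Lemma wnorm_sqr : wnorm B ^+ 2 = \sum_(i < n) B i ^+ 2.
Proof. by rewrite sqr_sqrtr// ltW// sum_sqr_gt0. Qed.

Lemma wratio_gt0 : 0 < wratio B. Proof. by rewrite divr_gt0 ?wsum_gt0 ?wnorm_gt0. Qed.

(** Cauchy-Schwarz against the constant vector, read off from the nonnegative sum of the squared
    deviations of the weights from their mean [m]. *)
Lemma wratio_sqr_le : wratio B ^+ 2 <= n%:R.
Proof.
rewrite expr_div_n wnorm_sqr ler_pdivrMr ?sum_sqr_gt0//.
pose m := wsum B / n%:R.
have : 0 <= \sum_(i < n) (B i - m) ^+ 2 by apply: sumr_ge0 => i _; exact: sqr_ge0.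
have -> : \sum_(i < n) (B i - m) ^+ 2 =
    \sum_(i < n) B i ^+ 2 + (- (2 * m) * wsum B + n%:R * m ^+ 2).
  have -> : n%:R * m ^+ 2 = \sum_(i < n) m ^+ 2 by rewrite sumr_const card_ord mulr_natl.
  rewrite mulr_sumr -!big_split.
  by apply: eq_bigr => i _ /=; ring.
have -> : n%:R * m ^+ 2 = wsum B ^+ 2 / n%:R by rewrite /m; field; rewrite gt_eqF.
have -> : - (2 * m) * wsum B = - (2 * (wsum B ^+ 2 / n%:R)).
  by rewrite /m; field; rewrite gt_eqF.
move=> h; rewrite mulrC -ler_pdivrMr//; lra.
Qed.

Let P := pprod mu n.
Let xi (x : n.-tuple RT) : R := \sum_(i < n) B i / wsum B * (a (tnth x i) - 1).
Let eta (x : n.-tuple RT) : R := \sum_(i < n) n%:R^-1 * (b (tnth x i) - 1).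

Let xiE x : \sum_(i < n) B i * a (tnth x i) = wsum B * (1 + xi x).
Proof.
rewrite mulrDr mulr1 /xi mulr_sumr /wsum -big_split /=.
by apply: eq_bigr => i _; rewrite -/(wsum B); field; rewrite gt_eqF// wsum_gt0.
Qed.

Let etaE x : n%:R^-1 * \sum_(i < n) b (tnth x i) = 1 + eta x.
Proof.
rewrite /eta -mulr_sumr sumrB sumr_const card_ord mulrBr mulVf ?gt_eqF//.
by rewrite addrC subrK.
Qed.

Let sumZ x : \sum_(i < n) lin_summand B i (tnth x i) = wratio B * (xi x / q - w * eta x).
Proof.
rewrite /xi /eta mulrBr mulr_suml !mulr_sumr -sumrB; apply: eq_bigr => i _.
rewrite /lin_summand /numer_dev /denom_dev /wratio; field.
by rewrite !gt_eqF ?wsum_gt0 ?wnorm_gt0.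
Qed.

Variable kap rho : R.
Hypothesis kap0 : 0 < kap <= 2^-1.

(** The factor 2 comes from [ln_1D_lb], the two summands are the coefficients of the two
    logarithms. *)
Let C := 2 * (q^-1 + w).
Let Good := [set x | `|xi x| <= kap] `&` [set x | `|eta x| <= kap].

Let k0 : 0 < kap. Proof. by case/andP: kap0. Qed.
Let k2 : kap <= 2^-1. Proof. by case/andP: kap0. Qed.

Let good_lb u : `|u| <= kap -> - 2^-1 <= u /\ -1 < u.
Proof. by rewrite ler_norml => /andP[h1 h2]; have k2' := k2; split; lra. Qed.

Let sqr_kap u : `|u| <= kap -> u ^+ 2 <= kap ^+ 2.
Proof.
by move=> uk; rewrite -real_normK ?num_real// lerXn2r ?nnegrE// ltW.
Qed.

Let KE x : Good x -> ratio_event B rho x <-> ln (1 + xi x) / q - w * ln (1 + eta x) <= rho.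
Proof.
move=> [/= /good_lb[_ xg] /good_lb[_ eg]].
have x0 : 0 < 1 + xi x by lra.
have e0 : 0 < 1 + eta x by lra.
rewrite /ratio_event /= xiE etaE -mulrA ler_pM2l ?wsum_gt0//.
rewrite -ler_ln ?posrE ?mulr_gt0 ?expR_gt0 ?powR_gt0//.
rewrite lnM ?posrE ?expR_gt0 ?powR_gt0// expRK ln_powR.
rewrite lerBlDr ler_pdivrMr// mulrDl mulrC.
by have -> : w * ln (1 + eta x) * q = q * w * ln (1 + eta x) by ring.
Qed.

Let good_diff x : Good x ->
  `|ln (1 + xi x) / q - w * ln (1 + eta x) - (xi x / q - w * eta x)| <= C * kap ^+ 2.
Proof.
move=> [/= xg eg]; have [xg2 xg1] := good_lb xg; have [eg2 eg1] := good_lb eg.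
have := ln_1D_ub xg1; have := ln_1D_ub eg1.
have := ln_1D_lb xg2; have := ln_1D_lb eg2.
have := sqr_kap xg; have := sqr_kap eg.
have qV : 0 < q^-1 by rewrite invr_gt0.
set lx := ln (1 + xi x); set le := ln (1 + eta x).
set X := xi x; set E := eta x.
move=> e2 x2 le1 lx1 le2 lx2.
have dx : 0 <= (X - lx) * q^-1 by rewrite mulr_ge0 ?(ltW qV)//; lra.
have dx2 : (X - lx) * q^-1 <= 2 * kap ^+ 2 * q^-1 by rewrite ler_pM2r//; lra.
have de : 0 <= w * (E - le) by rewrite mulr_ge0//; lra.
have de2 : w * (E - le) <= w * (2 * kap ^+ 2) by rewrite ler_wpM2l//; lra.
rewrite mulrBl in dx dx2; rewrite mulrBr in de de2.
have -> : C * kap ^+ 2 = 2 * kap ^+ 2 * q^-1 + w * (2 * kap ^+ 2) by rewrite /C; ring.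
rewrite ler_norml; apply/andP; split; lra.
Qed.

Let Bad := [set x | kap < `|xi x|] `|` [set x | kap < `|eta x|].

Let mxi : measurable_fun setT xi.
Proof.
apply: (@measurable_fun_sum_tnth _ n (fun i y => B i / wsum B * (a y - 1))) => i.
exact: measurable_funM.
Qed.

Let meta : measurable_fun setT eta.
Proof.
apply: (@measurable_fun_sum_tnth _ n (fun i y => n%:R^-1 * (b y - 1))) => i.
exact: measurable_funM.
Qed.

Let mltk (f : n.-tuple RT -> R) : measurable_fun setT f -> measurable [set x : n.-tuple RT | kap < `|f x|].
Proof.
by move=> mf; apply: measurable_set_gt; exact: measurableT_comp.
Qed.

Let mBad : measurable Bad.
Proof. by apply: measurableU; exact: mltk. Qed.

Let int1 (f : RT -> R) : measurable_fun setT f ->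
  mu.-integrable setT (EFin \o (fun y => `|f y| ^+ 3)) ->
  mu.-integrable setT (EFin \o f).
Proof. by move=> mf f3; have := integrable_cube_le (isT : (1 <= 3)%N) mf f3; apply: eq_integrable. Qed.

(** Chebyshev's inequality for both deviations. The variance of [xi] is [Va / wratio B ^+ 2], that
    of [eta] is [Vb / n], and [wratio_sqr_le] brings the second to the denominator of the first. *)
Let Pbad : (P Bad <= ((Va + Vb) / (wratio B * kap) ^+ 2)%:E)%E.
Proof.
apply: le_trans (measureU2 P (mltk mxi) (mltk meta)) _.
rewrite mulrDl EFinD; apply: leeD.
- have ia := int1 ma1 a3; have ia2 := integrable_cube_le (isT : (2 <= 3)%N) ma1 a3.
  have ch := @chebyshev_sum R mu n (fun i y => B i / wsum B * (a y - 1)) kap k0.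
  apply: (le_trans (ch _ _ _ _)).
  + by move=> i; exact: measurable_funM.
  + by move=> i; exact: integrable_RZ.
  + by move=> i; under eq_fun do rewrite exprMn; exact: integrable_RZ.
  + by move=> i; rewrite RintegralZl// Ea mulr0.
  rewrite lee_fin; under eq_bigr do under eq_Rintegral do rewrite exprMn.
  under eq_bigr do rewrite RintegralZl// -/Va expr_div_n.
  rewrite -mulr_suml -mulr_suml -wnorm_sqr /wratio le_eqVlt; apply/orP; left; apply/eqP.
  by field; rewrite !gt_eqF ?wsum_gt0 ?wnorm_gt0.
- have ib := int1 mb1 b3; have ib2 := integrable_cube_le (isT : (2 <= 3)%N) mb1 b3.
  have ch := @chebyshev_sum R mu n (fun i y => n%:R^-1 * (b y - 1)) kap k0.
  apply: (le_trans (ch _ _ _ _)).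
  + by move=> i; exact: measurable_funM.
  + by move=> i; exact: integrable_RZ.
  + by move=> i; under eq_fun do rewrite exprMn; exact: integrable_RZ.
  + by move=> i; rewrite RintegralZl// Eb mulr0.
  rewrite lee_fin; under eq_bigr do under eq_Rintegral do rewrite exprMn.
  under eq_bigr do rewrite RintegralZl// -/Vb.
  rewrite sumr_const card_ord -mulr_natl.
  have Vb0 : 0 <= Vb by apply: Rintegral_ge0 => y _; exact: sqr_ge0.
  rewrite [leLHS](_ : _ = Vb / (n%:R * kap ^+ 2)); last first.
    by field; rewrite !gt_eqF.
  have ak2 : 0 < wratio B ^+ 2 * kap ^+ 2.
    by apply: mulr_gt0; apply: exprn_gt0 => //; exact: wratio_gt0.
  have nk2 : 0 < n%:R * kap ^+ 2 by apply: mulr_gt0 => //; exact: exprn_gt0.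
  rewrite ler_wpM2l// exprMn lef_pV2 ?posrE//.
  by rewrite ler_pM2r ?exprn_gt0// wratio_sqr_le.
Qed.

Let mZ : measurable_fun setT (fun x : n.-tuple RT => \sum_(i < n) lin_summand B i (tnth x i)).
Proof. by apply: measurable_fun_sum_tnth => i; exact: measurable_lin_summand. Qed.

Let notBad x : ~ Bad x -> Good x.
Proof.
by move=> /not_orP[/= /negP + /negP]; rewrite -!leNgt.
Qed.

Let P_fine A : measurable A -> P A = (fine (P A))%:E.
Proof. by move=> mA; rewrite fineK// fin_num_measure. Qed.

(** Outside of [Bad] the logarithm of the ratio and its linearization differ by at most
    [C * kap ^+ 2]. The event thus passes to the sum of the [lin_summand], with its threshold moved
    by that amount times [wratio B]. *)
Lemma ratio_event_upper :
  fine (P (ratio_event B rho)) <=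
  prob_le P (fun x => \sum_(i < n) lin_summand B i (tnth x i)) (wratio B * rho + wratio B * (C * kap ^+ 2))
  + (Va + Vb) / (wratio B * kap) ^+ 2.
Proof.
set y := wratio B * rho + _.
have mX := measurable_set_le mZ y.
rewrite -lee_fin -P_fine; last exact: measurable_ratio_event.
rewrite EFinD /prob_le -P_fine//.
apply: le_trans (leeD2l _ Pbad).
apply: le_trans (measureU2 P mX mBad).
apply: le_measure; rewrite ?inE.
- exact: measurable_ratio_event.
- exact: measurableU.
move=> x Kx; have [xb|/notBad xg] := pselect (Bad x); [by right|left].
rewrite /= sumZ /y -mulrDr ler_pM2l ?wratio_gt0//.
have := good_diff xg; have h := (KE xg).1 Kx.
rewrite ler_norml => /andP[h1 h2]; lra.
Qed.

Lemma ratio_event_lower :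
  prob_le P (fun x => \sum_(i < n) lin_summand B i (tnth x i)) (wratio B * rho - wratio B * (C * kap ^+ 2))
  <= fine (P (ratio_event B rho)) + (Va + Vb) / (wratio B * kap) ^+ 2.
Proof.
set y := wratio B * rho - _.
have mX := measurable_set_le mZ y.
have mK := measurable_ratio_event B rho.
rewrite -lee_fin EFinD /prob_le -!P_fine//.
apply: le_trans (leeD2l _ Pbad).
apply: le_trans (measureU2 P mK mBad).
apply: le_measure; rewrite ?inE//.
  exact: measurableU.
move=> x /=; rewrite sumZ /y -mulrBr ler_pM2l ?wratio_gt0// => Lx.
have [xb|/notBad xg] := pselect (Bad x); [by right|left].
apply/(KE xg); have := good_diff xg.
rewrite ler_norml => /andP[h1 h2]; lra.
Qed.

End fixed_n.
End ratio_event_bounds.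

(** * Limits of the normal distribution function *)

Section normal_cdf_limits.
Context {R : realType}.
Notation RT := (measurableTypeR R).
Notation N := (@normal_prob R 0 1).

Definition Phir (y : \bar R) : R := fine (Phi y).

Lemma measurable_Phi_set (y : \bar R) : measurable [set u : RT | (u%:E <= y)%E].
Proof.
case: y => [r||].
- rewrite (_ : [set u : RT | _] = [set u : RT | u <= r]).
    exact: measurable_set_le.
  by apply/seteqP; split => u /=; rewrite lee_fin.
- rewrite (_ : [set u : RT | _] = setT)//.
  by apply/seteqP; split => u //= _; exact: leey.
- rewrite (_ : [set u : RT | _] = set0)//.
  by apply/seteqP; split => u //=.
Qed.

Lemma PhirE y : (Phir y)%:E = Phi y.
Proof. by rewrite /Phir fineK//; exact: fin_num_measure (measurable_Phi_set y). Qed.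

Lemma Phir_fin r : Phir r%:E = cdfN r.
Proof.
rewrite /Phir /Phi /cdfN /prob_le; congr (fine (_ _)).
Qed.

Lemma Phir_pinfty : Phir +oo%E = 1.
Proof.
rewrite /Phir /Phi (_ : [set u : R | _] = setT).
  by have -> : N setT = 1%E := probability_setT N.
by apply/seteqP; split => u //= _; exact: leey.
Qed.

Lemma Phir_ninfty : Phir -oo%E = 0.
Proof.
rewrite /Phir /Phi (_ : [set u : R | _] = set0) ?measure0//.
by apply/seteqP; split => u //=.
Qed.

Lemma cdfN_mono (x y : R) : x <= y -> cdfN x <= cdfN y.
Proof.
move=> xy; rewrite -lee_fin !cdfNE; apply: le_measure; rewrite ?inE.
- exact: (@measurable_set_le _ _ _ (id : RT -> R)).
- exact: (@measurable_set_le _ _ _ (id : RT -> R)).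
- by move=> u /= /le_trans; apply.
Qed.

Lemma cdfN_dist (x y : R) : `|cdfN x - cdfN y| <= normal_peak 1 * `|x - y|.
Proof.
wlog xy : x y / x <= y.
  move=> H; case: (leP x y) => [|/ltW] xy; first exact: H.
  by rewrite distrC (distrC x); exact: H.
rewrite distrC (distrC x) !ger0_norm ?subr_ge0 ?cdfN_mono//.
rewrite lerBlDl; have h : 0 <= y - x by rewrite subr_ge0.
by have := cdfN_lipschitz x h; rewrite addrCA subrr addr0.
Qed.

Lemma normal_tail (k : R) : 0 < k ->
  (N [set u : RT | (k < `|u|)%R] <= (k ^- 2)%:E)%E.
Proof.
move=> k0; have k2 : 0 < k ^+ 2 by rewrite exprn_gt0.
have mn : measurable_fun setT (fun u : RT => `|u|) by exact: normr_measurable.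
have mA := measurable_set_gt k mn.
have N2 := integrable_cube_le (isT : (2 <= 3)%N) (@measurable_id _ RT setT) (@integrable_normal_cube R).
have : (\int[N]_u (u ^+ 2)%:E = 1)%E.
  by rewrite ge0_Rintegral// Rintegral_normal_sqr.
rewrite -[X in (_ <= X)%E]mule1 => <-.
rewrite -(setIT [set u : RT | _]) -integral_indic//.
have mE : measurable_fun setT (fun u : RT => (u ^+ 2)%:E : \bar R).
  by apply/measurable_EFinP; apply: measurable_funX.
rewrite -ge0_integralZl//; last 2 first.
- by move=> t _; rewrite lee_fin sqr_ge0.
- by rewrite lee_fin invr_ge0 ltW.
apply: ge0_le_integral => //.
- by apply/measurable_EFinP; exact: measurable_indic.
- exact: emeasurable_funM.
move=> t _; rewrite -EFinM lee_fin indicE.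
have [|_] := boolP (t \in _); last by rewrite mulr_ge0 ?sqr_ge0// invr_ge0 ltW.
rewrite inE /= => kS; rewrite mulrC ler_pdivlMr// mul1r -[leRHS]real_normK ?num_real//.
by rewrite lerXn2r ?nnegrE ?(ltW k0)// ltW.
Qed.

Lemma cdfN_01 (x : R) : 0 <= cdfN x <= 1.
Proof.
rewrite -!lee_fin cdfNE measure_ge0 /=.
by apply: (@probability_le1 _ _ _ N); exact: (@measurable_set_le _ _ _ (id : RT -> R)).
Qed.

(** The extra 1 turns [u <= - k - 1] into the strict inequality [k < |u|] that [normal_tail] speaks
    of. *)
Lemma cdfN_ub (k : R) : 0 < k -> cdfN (- k - 1) <= k ^- 2.
Proof.
move=> k0; rewrite -lee_fin cdfNE; apply: le_trans (normal_tail k0).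
have mn : measurable_fun setT (fun u : RT => `|u|) by exact: normr_measurable.
apply: le_measure; rewrite ?inE.
- exact: (@measurable_set_le _ _ _ (id : RT -> R)).
- exact: measurable_set_gt.
move=> u /= uk; have u0 : u <= 0 by lra.
by rewrite ler0_norm//; lra.
Qed.

Lemma cdfN_lb (k : R) : 0 < k -> 1 - k ^- 2 <= cdfN k.
Proof.
move=> k0; rewrite lerBlDr -lee_fin EFinD cdfNE.
have mn : measurable_fun setT (fun u : RT => `|u|) by exact: normr_measurable.
have mA := measurable_set_gt k mn.
have mB := @measurable_set_le _ _ _ (id : RT -> R) (@measurable_id _ RT setT) k.
apply: le_trans (leeD2l _ (normal_tail k0)).
have <- : N setT = 1%E := probability_setT N.
apply: le_trans (measureU2 N mB mA).
apply: le_measure; rewrite ?inE//; first exact: measurableU.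
move=> u _ /=; case: (leP u k) => uk; [by left|right].
by rewrite (lt_le_trans uk)// ler_norm.
Qed.

Lemma cvg_cdfN (u : nat -> R) (y : \bar R) :
  (u n)%:E @[n --> \oo] --> y -> cdfN (u n) @[n --> \oo] --> Phir y.
Proof.
have pk0 : 0 < normal_peak 1 :> R by rewrite normal_peak_gt0 ?oner_neq0.
case: y => [r||] uy.
- have {}uy : u n @[n --> \oo] --> r by move/fine_cvgP : uy => [_].
  rewrite Phir_fin; apply/cvgrPdist_le => e e0.
  move/cvgrPdist_le : uy => /(_ (e / normal_peak 1) (divr_gt0 e0 pk0)) uy.
  near=> n; apply: le_trans (cdfN_dist _ _) _.
  by rewrite mulrC -ler_pdivlMr//; near: n.
- rewrite Phir_pinfty; apply/cvgrPdist_le => e e0.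
  (* The choice k = e^(-1/2) makes the tail bound [k ^- 2] equal to [e]. *)
  have k0 : 0 < (Num.sqrt e)^-1 by rewrite invr_gt0 sqrtr_gt0.
  have := cdfN_lb k0; rewrite exprVn invrK sqr_sqrtr ?(ltW e0)// => lbk.
  move/cvgeryP/cvgryPge : uy => /(_ (Num.sqrt e)^-1) uy.
  near=> n; have /andP[_ h] := cdfN_01 (u n).
  rewrite ger0_norm ?subr_ge0// lerBlDl -lerBlDr (le_trans lbk)// cdfN_mono//.
  by near: n.
- rewrite Phir_ninfty; apply/cvgrPdist_le => e e0.
  have k0 : 0 < (Num.sqrt e)^-1 by rewrite invr_gt0 sqrtr_gt0.
  have := cdfN_ub k0; rewrite exprVn invrK sqr_sqrtr ?(ltW e0)// => lbk.
  move/cvgerNyP/cvgrNyPle : uy => /(_ (- (Num.sqrt e)^-1 - 1)) uy.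
  near=> n; have /andP[h _] := cdfN_01 (u n).
  rewrite sub0r normrN ger0_norm// (le_trans _ lbk)// cdfN_mono//.
  by near: n.
Unshelve. all: by end_near. Qed.

End normal_cdf_limits.

Lemma cvg_sqrt0 (R : realType) (u : nat -> R) :
  u n @[n --> \oo] --> (0 : R) -> Num.sqrt (u n) @[n --> \oo] --> (0 : R).
Proof.
move=> h; rewrite -[X in _ --> X](sqrtr0 R).
by apply: continuous_cvg => //; exact: sqrt_continuous.
Qed.

(** * Central limit theorem for the ratio *)

Section ratio_event_clt.
Context {R : realType}.
Notation RT := (measurableTypeR R).
Variable mu : probability RT R.
Variables (a b : RT -> R) (q w : R).
Hypotheses (q0 : 0 < q) (w0 : 0 <= w).
Hypotheses (ma : measurable_fun setT a) (mb : measurable_fun setT b).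
Hypotheses (Ea : \int[mu]_y (a y - 1) = 0) (Eb : \int[mu]_y (b y - 1) = 0).
Hypothesis a3 : mu.-integrable setT (EFin \o (fun y => `|a y - 1| ^+ 3)).
Hypothesis b3 : mu.-integrable setT (EFin \o (fun y => `|b y - 1| ^+ 3)).

Let Y := numer_dev a q.
Let W := denom_dev b w.

Let mY : measurable_fun setT Y.
Proof. by apply: measurable_funM => //; exact: measurable_funB. Qed.
Let mW : measurable_fun setT W.
Proof. by apply: measurable_funM => //; exact: measurable_funB. Qed.

Let Y3 : mu.-integrable setT (EFin \o (fun y => `|Y y| ^+ 3)).
Proof.
have := integrable_RZ (`|q^-1| ^+ 3) a3; apply: eq_integrable => // y _ /=.
by rewrite /Y /numer_dev normrM exprMn mulrC.
Qed.
Let W3 : mu.-integrable setT (EFin \o (fun y => `|W y| ^+ 3)).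
Proof.
have := integrable_RZ (`|w| ^+ 3) b3; apply: eq_integrable => // y _ /=.
by rewrite /W /denom_dev normrM exprMn.
Qed.

Let int1 (f : RT -> R) : measurable_fun setT f ->
  mu.-integrable setT (EFin \o (fun y => `|f y| ^+ 3)) ->
  mu.-integrable setT (EFin \o f).
Proof. by move=> mf f3; have := integrable_cube_le (isT : (1 <= 3)%N) mf f3; apply: eq_integrable. Qed.

Let Y1 := int1 mY Y3.
Let W1 := int1 mW W3.
Let Y2 := integrable_cube_le (isT : (2 <= 3)%N) mY Y3.
Let W2 := integrable_cube_le (isT : (2 <= 3)%N) mW W3.

Let YW : mu.-integrable setT (EFin \o (fun y => Y y * W y)).
Proof.
apply: (integrable_Rle _ (integrable_RD Y2 W2)); first exact: measurable_funM.
move=> y; rewrite normrM -(real_normK (num_real (Y y))) -(real_normK (num_real (W y))).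
have := sqr_ge0 (`|Y y| - `|W y|); have := normr_ge0 (Y y); have := normr_ge0 (W y).
by nra.
Qed.

Let EY : \int[mu]_y Y y = 0.
Proof.
have i1 : mu.-integrable setT (EFin \o (fun y => a y - 1)).
  by apply: int1 => //; exact: measurable_funB.
by under eq_Rintegral do rewrite /Y /numer_dev mulrC; rewrite RintegralZl// Ea mulr0.
Qed.

Let EW : \int[mu]_y W y = 0.
Proof.
have i1 : mu.-integrable setT (EFin \o (fun y => b y - 1)).
  by apply: int1 => //; exact: measurable_funB.
by rewrite /W /denom_dev RintegralZl// Eb mulr0.
Qed.

(** When [wratio B ^+ 2 / n] tends to [G ^+ 2], the limit is [s2] in the form of [s2E]. *)
Definition lin_variance n (B : 'I_n -> R) : R :=
  \int[mu]_y (Y y ^+ 2) - 2 * (wratio B ^+ 2 / n%:R) * \int[mu]_y (Y y * W y)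
  + wratio B ^+ 2 / n%:R * \int[mu]_y (W y ^+ 2).

Let cZi al be : mu.-integrable setT (EFin \o (fun y => `|al * Y y - be * W y| ^+ 3)).
Proof.
apply: (integrable_Rle _ (integrable_RD (integrable_RZ (4 * `|al| ^+ 3) Y3)
    (integrable_RZ (4 * `|be| ^+ 3) W3))).
  apply: measurable_funX; apply: measurableT_comp => //.
  by apply: measurable_funB; exact: measurable_funM.
move=> y /=; rewrite normrX normr_id.
have -> : 4 * `|al| ^+ 3 * `|Y y| ^+ 3 + 4 * `|be| ^+ 3 * `|W y| ^+ 3 =
  4 * (`|al * Y y| ^+ 3 + `|be * W y| ^+ 3) by rewrite !normrM !exprMn; ring.
set x := al * Y y; set z := be * W y.
have xz : `|x - z| <= `|x| + `|z| by rewrite -(normrN z) ler_normD.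
apply: (@le_trans _ _ ((`|x| + `|z|) ^+ 3)).
  by rewrite lerXn2r ?nnegrE ?addr_ge0.
(* Convexity of the cube: for x, z >= 0, 4 (x^3 + z^3) - (x + z)^3 = 3 (x + z) (x - z)^2. *)
have : 0 <= (`|x| + `|z|) * (`|x| - `|z|) ^+ 2 by rewrite mulr_ge0 ?sqr_ge0 ?addr_ge0.
by have := normr_ge0 x; have := normr_ge0 z; nra.
Qed.

Let lin_third al be : 0 <= al -> 0 <= be ->
  \int[mu]_y (`|al * Y y - be * W y| ^+ 3) <=
  4 * al ^+ 3 * \int[mu]_y (`|Y y| ^+ 3) + 4 * be ^+ 3 * \int[mu]_y (`|W y| ^+ 3).
Proof.
move=> al0 be0; rewrite -!RintegralZl// -RintegralD//; [|exact: integrable_RZ..].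
apply: Rintegral_le; first exact: cZi.
  exact: integrable_RD (integrable_RZ _ Y3) (integrable_RZ _ W3).
move=> y /=.
have -> : 4 * al ^+ 3 * `|Y y| ^+ 3 + 4 * be ^+ 3 * `|W y| ^+ 3 =
  4 * ((al * `|Y y|) ^+ 3 + (be * `|W y|) ^+ 3) by rewrite !exprMn; ring.
set x := al * Y y; set z := be * W y.
have -> : al * `|Y y| = `|x| by rewrite /x (normrM al) (ger0_norm al0).
have -> : be * `|W y| = `|z| by rewrite /z (normrM be) (ger0_norm be0).
have xz : `|x - z| <= `|x| + `|z| by rewrite -(normrN z) ler_normD.
apply: (@le_trans _ _ ((`|x| + `|z|) ^+ 3)).
  by rewrite lerXn2r ?nnegrE ?addr_ge0.
have : 0 <= (`|x| + `|z|) * (`|x| - `|z|) ^+ 2 by rewrite mulr_ge0 ?sqr_ge0 ?addr_ge0.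
by have := normr_ge0 x; have := normr_ge0 z; nra.
Qed.

Let lin_summand_mean n (B : 'I_n -> R) i : \int[mu]_y lin_summand a b q w B i y = 0.
Proof.
rewrite -[LHS]/(\int[mu]_y (B i / wnorm B * Y y - wratio B / n%:R * W y)).
rewrite RintegralB//; [|exact: integrable_RZ..].
by rewrite (@RintegralZl _ _ _ _ _ Y)// (@RintegralZl _ _ _ _ _ W)// EY EW !mulr0 subrr.
Qed.

Let lin_var al be : \int[mu]_y ((al * Y y - be * W y) ^+ 2) =
  al ^+ 2 * \int[mu]_y (Y y ^+ 2) - 2 * al * be * \int[mu]_y (Y y * W y)
  + be ^+ 2 * \int[mu]_y (W y ^+ 2).
Proof.
rewrite (@eq_Rintegral _ _ _ _ _ (fun y => al ^+ 2 * Y y ^+ 2 +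
    (- (2 * al * be) * (Y y * W y) + be ^+ 2 * W y ^+ 2))); last by move=> y _; ring.
have i1 := integrable_RZ (al ^+ 2) Y2.
have i2 := integrable_RZ (- (2 * al * be)) YW.
have i3 := integrable_RZ (be ^+ 2) W2.
rewrite RintegralD//; last exact: integrable_RD.
by rewrite RintegralD// !RintegralZl// addrA mulNr.
Qed.

(** The coefficients [B i / wnorm B] have sum [wratio B] and sum of squares 1. The common
    coefficient [wratio B / n] therefore contributes [wratio B ^+ 2 / n] both to the cross term and
    to the last one. *)
Lemma lin_summand_var_sum n (B : 'I_n -> R) : (0 < n)%N -> (forall i, 0 < B i) ->
  \sum_(i < n) \int[mu]_y (lin_summand a b q w B i y ^+ 2) = lin_variance B.
Proof.
move=> n0 B0; have s20 := wnorm_gt0 n0 B0; have nR : (0 : R) < n%:R by rewrite ltr0n.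
under eq_bigr do rewrite lin_var.
rewrite /lin_variance !big_split/= sumrN -!mulr_suml; congr (_ - _ + _).
- rewrite -[RHS]mul1r; congr (_ * _).
  under eq_bigr do rewrite expr_div_n.
  by rewrite -mulr_suml -(wnorm_sqr n0 B0) mulfV// sqrf_eq0 gt_eqF.
- congr (_ * _).
  rewrite (eq_bigr (fun i => B i * (2 / wnorm B))); last by move=> i _; ring.
  by rewrite -mulr_suml -/(wsum B) /wratio; field; rewrite !gt_eqF.
- congr (_ * _); rewrite sumr_const card_ord -mulr_natl.
  by rewrite /wratio; field; rewrite !gt_eqF.
Qed.

(** Lyapunov's condition. Each [B i / wnorm B] is at most [Num.sqrt m] and their squares sum to 1,
    so their cubes sum to at most [Num.sqrt m]; the [n] cubes of [wratio B / n] sum to at most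
    n^(-1/2) by [wratio_sqr_le]. *)
Lemma lin_summand_third_sum n (B : 'I_n -> R) (m : R) : (0 < n)%N -> (forall i, 0 < B i) ->
  0 <= m -> (forall i, B i ^+ 2 <= m * \sum_(i < n) B i ^+ 2) ->
  \sum_(i < n) \int[mu]_y (`|lin_summand a b q w B i y| ^+ 3) <=
  4 * \int[mu]_y (`|Y y| ^+ 3) * Num.sqrt m +
  4 * \int[mu]_y (`|W y| ^+ 3) * (Num.sqrt n%:R)^-1.
Proof.
move=> n0 B0 m0 Bm; have s20 := wnorm_gt0 n0 B0; have nR : (0 : R) < n%:R by rewrite ltr0n.
have an0 := wratio_gt0 n0 B0.
set y3 := \int[mu]_y (`|Y y| ^+ 3); set w3 := \int[mu]_y (`|W y| ^+ 3).
have y30 : 0 <= y3 by apply: Rintegral_ge0 => t _; rewrite exprn_ge0.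
have w30 : 0 <= w3 by apply: Rintegral_ge0 => t _; rewrite exprn_ge0.
have al0 i : 0 <= B i / wnorm B by rewrite divr_ge0 ?ltW.
have be0 : 0 <= wratio B / n%:R by rewrite divr_ge0 ?ltW.
apply: (@le_trans _ _ (\sum_(i < n) (4 * (B i / wnorm B) ^+ 3 * y3 + 4 * (wratio B / n%:R) ^+ 3 * w3))).
  by apply: ler_sum => i _; exact: lin_third.
rewrite big_split/=; apply: lerD.
- have -> : \sum_(i < n) 4 * (B i / wnorm B) ^+ 3 * y3 = 4 * y3 * \sum_(i < n) (B i / wnorm B) ^+ 3.
    by rewrite mulr_sumr; apply: eq_bigr => i _; rewrite mulrAC.
  rewrite ler_wpM2l ?mulr_ge0//.
  apply: (@le_trans _ _ (\sum_(i < n) Num.sqrt m * (B i / wnorm B) ^+ 2)).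
    apply: ler_sum => i _; rewrite exprS ler_wpM2r ?sqr_ge0//.
    rewrite -(ger0_norm (al0 i)) -sqrtr_sqr ler_sqrt//.
    by rewrite expr_div_n (wnorm_sqr n0 B0) ler_pdivrMr// sum_sqr_gt0.
  rewrite -mulr_sumr; under eq_bigr do rewrite expr_div_n.
  by rewrite -mulr_suml -(wnorm_sqr n0 B0) mulfV ?mulr1// sqrf_eq0 gt_eqF.
- have -> : \sum_(i < n) 4 * (wratio B / n%:R) ^+ 3 * w3 = 4 * w3 * (wratio B ^+ 3 / n%:R ^+ 2).
    by rewrite sumr_const card_ord -[_ *+ n]mulr_natl; field; rewrite gt_eqF.
  rewrite ler_wpM2l ?mulr_ge0//.
  set sn := Num.sqrt _; have sn0 : 0 < sn by rewrite sqrtr_gt0.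
  have sn2 : sn ^+ 2 = n%:R by rewrite sqr_sqrtr// ltW.
  have asn : wratio B <= sn.
    by rewrite -(ger0_norm (ltW an0)) -sqrtr_sqr ler_sqrt// wratio_sqr_le.
  rewrite -sn2 ler_pdivrMr ?exprn_gt0//.
  have -> : sn^-1 * sn ^+ 2 ^+ 2 = sn ^+ 3 by field; rewrite gt_eqF.
  by rewrite lerXn2r ?nnegrE// ltW.
Qed.

Theorem ratio_event_clt (B : forall n, 'I_n -> R) (rho : nat -> R) (y : \bar R) (s : R) :
  (forall n i, 0 < B n i) -> 0 < s ->
  (wratio (B n))^-1 @[n --> \oo] --> (0 : R) ->
  (\big[Num.max/0]_(i < n) B n i ^+ 2) / (\sum_(i < n) B n i ^+ 2) @[n --> \oo] --> (0 : R) ->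
  lin_variance (B n) @[n --> \oo] --> s ^+ 2 ->
  (wratio (B n) * rho n)%:E @[n --> \oo] --> y ->
  fine (pprod mu n (ratio_event a b q w (B n) (rho n))) @[n --> \oo] --> Phir (y * (s^-1)%:E)%E.
Proof.
move=> B0 s0 anoo mx vs ry.
pose m n := (\big[Num.max/0]_(i < n) B n i ^+ 2) / (\sum_(i < n) B n i ^+ 2).
(* Normalizing by [v n] rather than by its limit [s] makes the variance exactly 1, as [uniform_clt]
   requires. *)
pose v n := Num.sqrt (lin_variance (B n)).
have vs1 : v n @[n --> \oo] --> s.
  rewrite -(ger0_norm (ltW s0)) -sqrtr_sqr.
  by apply: continuous_cvg => //; exact: sqrt_continuous.
have v0 : \forall n \near \oo, 0 < v n by apply: (cvgr_gt s vs1).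
have vV : (v n)^-1 @[n --> \oo] --> s^-1 by apply: cvgV => //; rewrite gt_eqF.
(* The power -1/4 of [wratio]; [kap] will be [ig ^+ 3]. The linearization error, of order wratio
   kap^2, and the Chebyshev bound, of order (wratio kap)^-2, are then both of order [ig ^+ 2]. *)
pose ig n := Num.sqrt (Num.sqrt (wratio (B n))^-1).
have ig0 : ig n @[n --> \oo] --> (0 : R).
  by do 2 apply: cvg_sqrt0.
have ig20 : ig n ^+ 2 @[n --> \oo] --> (0 : R).
  by rewrite -[X in _ --> X](mulr0 (0 : R)); under eq_fun do rewrite expr2; apply: cvgM.
pose Va := \int[mu]_y ((a y - 1) ^+ 2); pose Vb := \int[mu]_y ((b y - 1) ^+ 2).
pose C : R := 2 * (q^-1 + w).
pose zeta n (i : 'I_n) t := (v n)^-1 * lin_summand a b q w (B n) i t.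
have mz n i : measurable_fun setT (zeta n i).
  by apply: measurable_funM => //; exact: measurable_lin_summand.
have cZ3 n i : mu.-integrable setT (EFin \o (fun t => `|lin_summand a b q w (B n) i t| ^+ 3)).
  exact: cZi.
have mcZ n i : measurable_fun setT (lin_summand a b q w (B n) i) by exact: measurable_lin_summand.
have z3 n i : mu.-integrable setT (EFin \o (fun t => `|zeta n i t| ^+ 3)).
  have := integrable_RZ (`|(v n)^-1| ^+ 3) (cZ3 n i); apply: eq_integrable => // t _ /=.
  by rewrite normrM exprMn.
have Ez n i : \int[mu]_t zeta n i t = 0.
  rewrite RintegralZl//; last exact: int1.
  by rewrite lin_summand_mean mulr0.
have V1 : \forall n \near \oo, \sum_(i < n) \int[mu]_t (zeta n i t ^+ 2) = 1.
  near=> n; have n0 : (0 < n)%N by near: n; exact: nbhs_infty_gt.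
  have vn0 : 0 < v n by near: n.
  have cv0 : 0 < lin_variance (B n) by rewrite -sqrtr_gt0.
  rewrite (eq_bigr (fun i => (v n)^-1 ^+ 2 * \int[mu]_t (lin_summand a b q w (B n) i t ^+ 2))).
    by rewrite -mulr_sumr lin_summand_var_sum// exprVn sqr_sqrtr ?ltW// mulVf ?gt_eqF.
  move=> i _; rewrite -RintegralZl//; last exact: (integrable_cube_le (isT : (2 <= 3)%N)).
  by apply: eq_Rintegral => t _; rewrite exprMn.
have T0 : \sum_(i < n) \int[mu]_t (`|zeta n i t| ^+ 3) @[n --> \oo] --> (0 : R).
  pose y3 := \int[mu]_y (`|Y y| ^+ 3); pose w3 := \int[mu]_y (`|W y| ^+ 3).
  pose bd n := (v n)^-1 ^+ 3 * (4 * y3 * Num.sqrt (m n) + 4 * w3 * (Num.sqrt n%:R)^-1).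
  apply: (@squeeze_cvgr _ _ _ _ (fun=> 0) bd); last 2 first.
  - exact: cvg_cst.
  - rewrite -[X in _ --> X](_ : s^-1 ^+ 3 * (4 * y3 * 0 + 4 * w3 * 0) = 0); last first.
      by rewrite !mulr0 addr0 mulr0.
    have e1 : (v n)^-1 ^+ 3 @[n --> \oo] --> s^-1 ^+ 3.
      by rewrite exprS expr2; under eq_fun do rewrite exprS expr2; exact: (cvgM vV (cvgM vV vV)).
    have e2 : 4 * y3 * Num.sqrt (m n) @[n --> \oo] --> 4 * y3 * 0.
      by apply: cvgMr; exact: cvg_sqrt0.
    have e3 : 4 * w3 * (Num.sqrt n%:R)^-1 @[n --> \oo] --> 4 * w3 * 0.
      by apply: cvgMr; exact: cvg_natr_sqrt_inv.
    exact: (cvgM e1 (cvgD e2 e3)).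
  near=> n; have n0 : (0 < n)%N by near: n; exact: nbhs_infty_gt.
  have vn0 : 0 < v n by near: n.
  have B20 := sum_sqr_gt0 n0 (B0 n).
  apply/andP; split.
    by apply: sumr_ge0 => i _; apply: Rintegral_ge0 => t _; rewrite exprn_ge0.
  rewrite (eq_bigr (fun i => (v n)^-1 ^+ 3 * \int[mu]_t (`|lin_summand a b q w (B n) i t| ^+ 3))); last first.
    move=> i _; rewrite -RintegralZl//; apply: eq_Rintegral => t _.
    by rewrite normrM exprMn ger0_norm// invr_ge0 ltW.
  rewrite -mulr_sumr ler_wpM2l ?exprn_ge0 ?invr_ge0 ?(ltW vn0)//.
  apply: lin_summand_third_sum => //.
    by rewrite divr_ge0 ?(ltW B20)//; apply/bigmax_geP; left.
  move=> i; rewrite /m -mulrA mulVf ?gt_eqF// mulr1.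
  exact: (@le_bigmax _ _ _ 0 (fun i => B n i ^+ 2) i).
have clt := uniform_clt mz z3 Ez V1 T0.
have anig : \forall n \near \oo, wratio (B n) * (C * (ig n ^+ 3) ^+ 2) = C * ig n ^+ 2 /\
    (Va + Vb) / (wratio (B n) * ig n ^+ 3) ^+ 2 = (Va + Vb) * ig n ^+ 2.
  near=> n; have n0 : (0 < n)%N by near: n; exact: nbhs_infty_gt.
  have an0 := wratio_gt0 n0 (B0 n).
  have ig_0 : 0 < ig n by rewrite !sqrtr_gt0 invr_gt0.
  have igE : wratio (B n) = ig n ^- 4.
    rewrite -[4%N]/(2 * 2)%N exprM sqr_sqrtr ?sqrtr_ge0// sqr_sqrtr ?invrK//.
    by rewrite invr_ge0 ltW.
  by rewrite igE; split; field; rewrite gt_eqF.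
have small c : c * (C * ig n ^+ 2) @[n --> \oo] --> (0 : R).
  rewrite -[X in _ --> X](mulr0 c); apply: cvgMr.
  by rewrite -[X in _ --> X](mulr0 C); apply: cvgMr.
(* The values [c = 1] and [c = -1] give the thresholds of [ratio_event_upper] and
   [ratio_event_lower]. As [y] may be infinite, the limit of the product requires [s^-1 != 0]. *)
have ylim c : ((wratio (B n) * rho n + c * (C * ig n ^+ 2)) / v n)%:E @[n --> \oo] --> (y * (s^-1)%:E)%E.
  under eq_fun do rewrite EFinM EFinD.
  apply: cvgeM.
  - have sV : s^-1 != 0 by rewrite gt_eqF// invr_gt0.
    by case: (y) => [r||]; rewrite /mule_def /= ?eqe ?(negbTE sV) ?andbF.
  - rewrite -[X in _ --> X]adde0; apply: cvgeD => //; first by rewrite fin_num_adde_defl.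
    by apply: cvg_EFin; [exact: nearW|exact: small].
  - by apply: cvg_EFin; [exact: nearW|exact: vV].
have bad0 : (Va + Vb) * ig n ^+ 2 @[n --> \oo] --> (0 : R).
  by rewrite -[X in _ --> X](mulr0 (Va + Vb)); apply: cvgMr.
apply/cvgrPdist_le => e e0; have e4 : 0 < e / 4 by rewrite divr_gt0.
move/cvgrPdist_le : (cvg_cdfN (ylim 1)) => /(_ _ e4) L1.
move/cvgrPdist_le : (cvg_cdfN (ylim (-1))) => /(_ _ e4) L2.
move/cvgrPdist_le : bad0 => /(_ _ e4) L3.
move/cvgrPdist_le : ig0 => /(_ 2^-1 ltac:(by rewrite invr_gt0)) L4.
have L5 := clt _ e4.
near=> n.
have n0 : (0 < n)%N by near: n; exact: nbhs_infty_gt.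
have vn0 : 0 < v n by near: n.
have an0 := wratio_gt0 n0 (B0 n).
have ign0 : 0 < ig n by rewrite !sqrtr_gt0 invr_gt0.
have kap0 : 0 < ig n ^+ 3 <= 2^-1.
  rewrite exprn_gt0//=; have : `|0 - ig n| <= 2^-1 by near: n.
  rewrite sub0r normrN gtr0_norm// => ig2.
  rewrite (le_trans _ ig2)// exprS ger_pMr// exprn_ile1 ?(ltW ign0)//.
  by rewrite (le_trans ig2)// invf_le1// ler1n.
have [anig1 anig2] : wratio (B n) * (C * (ig n ^+ 3) ^+ 2) = C * ig n ^+ 2 /\
    (Va + Vb) / (wratio (B n) * ig n ^+ 3) ^+ 2 = (Va + Vb) * ig n ^+ 2 by near: n.
have U := ratio_event_upper q0 w0 ma mb Ea Eb a3 b3 n0 (B0 n) (rho n) kap0.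
have L := ratio_event_lower q0 w0 ma mb Ea Eb a3 b3 n0 (B0 n) (rho n) kap0.
rewrite -/C -/Va -/Vb anig1 anig2 in U L.
have scale z : prob_le (pprod mu n) (fun t => \sum_(i < n) lin_summand a b q w (B n) i (tnth t i)) z =
    prob_le (pprod mu n) (fun t => \sum_(i < n) zeta n i (tnth t i)) (z / v n).
  congr (fine (pprod mu n _)); apply/seteqP; split => t /=; rewrite -mulr_sumr mulrC ler_pM2r ?invr_gt0//.
rewrite !scale in U L.
have C5 z : `|prob_le (pprod mu n) (fun t => \sum_(i < n) zeta n i (tnth t i)) z - cdfN z| <= e / 4.
  move: z; near: n; exact: L5.
have D1 : `|Phir (y * (s^-1)%:E)%E - cdfN ((wratio (B n) * rho n + 1 * (C * ig n ^+ 2)) / v n)| <= e / 4 by near: n.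
have D2 : `|Phir (y * (s^-1)%:E)%E - cdfN ((wratio (B n) * rho n + -1 * (C * ig n ^+ 2)) / v n)| <= e / 4 by near: n.
have D3 : `|0 - (Va + Vb) * ig n ^+ 2| <= e / 4 by near: n.
rewrite mul1r in D1; rewrite mulN1r in D2.
have := C5 ((wratio (B n) * rho n + C * ig n ^+ 2) / v n).
have := C5 ((wratio (B n) * rho n - C * ig n ^+ 2) / v n).
move: U L D1 D2 D3; set P1 := prob_le _ _ _; set P2 := prob_le _ _ _.
set c1 := cdfN _; set c2 := cdfN _; set ph := Phir _; set pk := fine _.
set bb := (Va + Vb) * _.
rewrite !ler_norml => U L /andP[d1 d1'] /andP[d2 d2'] /andP[d3 d3'] /andP[g1 g1'] /andP[g2 g2'].
apply/andP; split; lra.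
Unshelve. all: by end_near. Qed.

End ratio_event_clt.

(** * The limit variance *)

Section nondegeneracy.
Context {R : realType}.
Notation RT := (measurableTypeR R).
Notation leb := (@lebesgue_measure R).

(** A positive lower bound on one interval is all that the nondegeneracy arguments take from the
    law, and it holds for finite and infinite [p] alike. *)
Lemma pgauss_pdf_lb (p : \bar R) : (0 < p)%E ->
  exists2 c : R, 0 < c & forall x, 0 < x < 1 -> c <= pgauss_pdf p x.
Proof.
case: p => [r||]//; last first.
  move=> _; exists 2^-1; first by rewrite invr_gt0.
  move=> x /andP[x0 x1]; rewrite /pgauss_pdf ltxx andbF indicE mem_set ?mulr1//=.
  by rewrite in_itv/= (ltW x1) andbT; lra.
rewrite lte_fin => r0; have c0 := pgauss_cst_gt0 r0.
exists (pgauss_cst r * expR (- r^-1)); first by rewrite mulr_gt0// expR_gt0.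
move=> x /andP[x0 x1]; rewrite pgauss_pdf_EFin// ler_pM2l// ler_expR lerN2.
rewrite ler_piMl ?invr_ge0 ?(ltW r0)// gtr0_norm//.
have <- : 1 `^ r = 1 :> R by rewrite powR1.
by apply: ge0_ler_powR; rewrite ?nnegrE ?(ltW r0) ?(ltW x0) ?(ltW x1).
Qed.

(** If [g x > 0], continuity gives [g >= g x / 2] on an interval around [x] inside []0, 1[], which
    has positive mass by [pgauss_pdf_lb]. *)
Lemma pgauss_integral_eq0 (p : \bar R) (g : R -> R) : (0 < p)%E ->
  (pgauss p).-integrable setT (EFin \o (g : RT -> R)) ->
  (forall x, 0 <= g x) -> \int[pgauss p]_x g x = 0 ->
  forall x, 0 < x < 1 -> {for x, continuous g} -> g x = 0.
Proof.
move=> p0 gi g0 Ig x x01 cg; apply/eqP; rewrite eq_le g0 andbT leNgt; apply/negP => gx.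
have [c c0 cpdf] := pgauss_pdf_lb p0.
have gx2 : 0 < g x / 2 by rewrite divr_gt0.
have /cvgrPdist_lt /(_ _ gx2) /nbhs_ballP [d /= d0 dg] := cg.
have /andP[x0 x1] := x01.
pose e := Num.min d (Num.min x (1 - x)).
have e0 : 0 < e by rewrite !lt_min d0 x0 subr_gt0.
have ed : e <= d by rewrite ge_min lexx.
have ex : e <= x by rewrite !ge_min lexx orbT.
have e1 : e <= 1 - x by rewrite !ge_min lexx !orbT.
pose I : set RT := `]x - e, x + e[%classic.
have mI : measurable I by exact: measurable_itv.
have gI t : I t -> g x / 2 <= g t.
  rewrite /I /= in_itv/= => /andP[t1 t2].
  have : ball x d t by rewrite /ball /= ltr_distlC; apply/andP; split; lra.
  by move/dg; rewrite ltr_distlC => /andP[h1 h2]; lra.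
have PI : ((c * (2 * e))%:E <= pgauss p I)%E.
  rewrite /pgauss.
  apply: (@le_trans _ _ (\int[leb]_(t in I) c%:E)%E).
    rewrite integral_cst//= /I lebesgue_measure_itv/= lte_fin.
    rewrite ltrD2l gtrN// -EFinB -EFinM lee_fin.
    by rewrite le_eqVlt; apply/orP; left; apply/eqP; ring.
  apply: ge0_le_integral => //.
  - by move=> t _; rewrite lee_fin ltW.
  - by apply/measurable_EFinP; apply: measurable_funTS; exact: measurable_pgauss_pdf.
  move=> t; rewrite /I /= in_itv/= => /andP[t1 t2]; rewrite lee_fin; apply: cpdf.
  by apply/andP; split; lra.
have mg := integrable_measurable gi.
have : (\int[pgauss p]_t ((g x / 2)%:E * (\1_I t)%:E) <= \int[pgauss p]_t (g t)%:E)%E.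
  apply: ge0_le_integral => //.
  - by move=> t _; rewrite mule_ge0// lee_fin// ltW.
  - by apply: emeasurable_funM => //; apply/measurable_EFinP; exact: measurable_indic.
  - exact/measurable_EFinP.
  - move=> t _; rewrite -EFinM lee_fin indicE; have [|_] := boolP (t \in I).
      by rewrite inE mulr1; exact: gI.
    by rewrite mulr0.
have -> : (\int[pgauss p]_t (g t)%:E = 0)%E by rewrite ge0_Rintegral// Ig.
rewrite ge0_integralZl//; last 2 first.
- by apply/measurable_EFinP; exact: measurable_indic.
- by rewrite lee_fin ltW.
rewrite integral_indic// setIT; apply/negP; rewrite -ltNge.
apply: (@lt_le_trans _ _ ((g x / 2)%:E * (c * (2 * e))%:E)%E).
  by rewrite -EFinM lte_fin !mulr_gt0.
by apply: lee_wpmul2l => //; rewrite lee_fin ltW.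
Qed.

End nondegeneracy.

Section pgauss_variables.
Context {R : realType}.
Notation RT := (measurableTypeR R).
Variables (p : \bar R) (q : R).
Hypotheses (p0 : (0 < p)%E) (q0 : 0 < q).
Notation P := (pgauss p).
Notation M := (pgauss_moment p q).

(* The infinite case gives [pden = 1] and [pinv = 0], so that the normalization by the
   p-norm disappears and the cube needs no separate treatment. *)
Definition pden (x : RT) : R := if p is r%:E then `|x| `^ r else 1.
Definition pnum (x : RT) : R := `|x| `^ q / M.
Definition pinv : R := fine p^-1%E.

Lemma continuous_abs_powR (a x : R) : 0 < x -> {for x, continuous (fun y : R => `|y| `^ a)}.
Proof.
move=> x0; apply: (@continuous_comp _ _ _ (fun y : R => `|y|) (fun y => y `^ a)).
  exact: norm_continuous.
by rewrite gtr0_norm//; exact: continuous_powR_gt0.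
Qed.

Lemma pinv_ge0 : 0 <= pinv.
Proof.
rewrite /pinv; case: p p0 => [r||]//; rewrite lte_fin => r0.
by rewrite fine_inve ?gt_eqF// invr_ge0 ltW.
Qed.

Lemma half_01 : 0 < (2^-1 : R) < 1.
Proof. by rewrite invr_gt0 ltr0n invf_lt1// ltr1n. Qed.

Lemma pgauss_moment_gt0 : 0 < M.
Proof.
rewrite pgauss_momentE lt_neqAle Rintegral_ge0 ?andbT; last by move=> x _; exact: powR_ge0.
apply/negP => /eqP /esym Ig.
have gi := @integrable_pgauss_abs_powR R p q (ltW q0).
have := pgauss_integral_eq0 p0 gi (fun x => powR_ge0 _ _) Ig half_01.
have /andP[h0 h1] := half_01.
move=> /(_ (continuous_abs_powR h0)) /eqP; rewrite powR_eq0 normr_eq0 => /andP[/eqP].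
by lra.
Qed.

Let M0 := pgauss_moment_gt0.

Lemma measurable_pnum : measurable_fun setT pnum.
Proof. by apply: measurable_funM => //; exact: measurable_abs_powR. Qed.

Lemma measurable_pden : measurable_fun setT pden.
Proof.
by rewrite /pden; case: p => [r||]//; exact: measurable_abs_powR.
Qed.

Let int_shift (f : RT -> R) : measurable_fun setT f -> (forall x, 0 <= f x) ->
  P.-integrable setT (EFin \o (fun x => f x ^+ 3)) ->
  P.-integrable setT (EFin \o (fun x => `|f x - 1| ^+ 3)).
Proof.
move=> mf f0 f3; apply: (integrable_Rle _ (integrable_RD (integrable_Rcst _ 1) f3)).
  by apply: measurable_funX; apply: measurableT_comp => //; exact: measurable_funB.
move=> x; rewrite normrX normr_id; have [f1|f1] := leP 1 (f x).
  rewrite ger0_norm ?subr_ge0// (@le_trans _ _ (f x ^+ 3)) ?lerDr//.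
  by rewrite lerXn2r ?nnegrE ?subr_ge0// lerBlDr lerDl.
rewrite ltr0_norm ?subr_lt0// opprB (@le_trans _ _ 1) ?lerDl ?exprn_ge0//.
by rewrite exprn_ile1 ?subr_ge0 ?(ltW f1)// lerBlDr lerDl.
Qed.

Let powR_cube (x a : R) : 0 <= x -> (x `^ a) ^+ 3 = x `^ (a * 3).
Proof. by move=> x0; rewrite -powR_mulrn ?powR_ge0// -powRrM. Qed.

Lemma integrable_pnum_cube : P.-integrable setT (EFin \o (fun x => `|pnum x - 1| ^+ 3)).
Proof.
apply: int_shift; first exact: measurable_pnum.
  by move=> x; rewrite divr_ge0 ?powR_ge0 ?ltW.
have q3 : 0 <= q * 3 by rewrite mulr_ge0// ltW.
have := integrable_RZ (M ^- 3) (@integrable_pgauss_abs_powR R p _ q3).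
apply: eq_integrable => // x _ /=.
by rewrite /pnum expr_div_n powR_cube// mulrC.
Qed.

Lemma integrable_pden_cube : P.-integrable setT (EFin \o (fun x => `|pden x - 1| ^+ 3)).
Proof.
apply: int_shift; first exact: measurable_pden.
  by move=> x; rewrite /pden; case: (p) => [r||]//; exact: powR_ge0.
rewrite /pden; case: (p) p0 => [r||]//; last first.
  by move=> _; under eq_fun do rewrite expr1n; exact: integrable_Rcst.
rewrite lte_fin => r0; have r3 : 0 <= r * 3 by rewrite mulr_ge0// ltW.
have := @integrable_pgauss_abs_powR R r%:E _ r3.
by apply: eq_integrable => // x _ /=; rewrite powR_cube.
Qed.

Lemma Rintegral_pden : \int[P]_x pden x = 1.
Proof.
rewrite /pden; case: (p) p0 => [r||]//; first by rewrite lte_fin; exact: pgauss_moment_p.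
by move=> _; exact: Rintegral_cst1.
Qed.

Lemma integrable_pden : P.-integrable setT (EFin \o pden).
Proof.
rewrite /pden; case: (p) p0 => [r||]//; last by move=> _; exact: integrable_Rcst.
by rewrite lte_fin => /ltW r0; exact: integrable_pgauss_abs_powR.
Qed.

Lemma Rintegral_pden_sub1 : \int[P]_x (pden x - 1) = 0.
Proof.
rewrite RintegralB//; [|exact: integrable_pden|exact: integrable_Rcst].
by rewrite Rintegral_pden Rintegral_cst1 subrr.
Qed.

Lemma Rintegral_pnum_sub1 : \int[P]_x (pnum x - 1) = 0.
Proof.
have i := @integrable_pgauss_abs_powR R p _ (ltW q0).
have ia : P.-integrable setT (EFin \o pnum).
  by have := integrable_RZ M^-1 i; apply: eq_integrable => // x _ /=; rewrite /pnum mulrC.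
rewrite RintegralB//; last exact: integrable_Rcst.
under eq_Rintegral do rewrite /pnum mulrC.
by rewrite RintegralZl// -pgauss_momentE mulVf ?gt_eqF// Rintegral_cst1 subrr.
Qed.

Let Y := numer_dev pnum q.
Let W := denom_dev pden pinv.

Lemma Rintegral_numer_sqr : \int[P]_x (Y x ^+ 2) = pgauss_var p q / (q ^+ 2 * M ^+ 2).
Proof.
have -> : pgauss_var p q = \int[P]_x ((`|x| `^ q - M) ^+ 2).
  rewrite /pgauss_var /variance unlock /= unlock /Rintegral; congr fine.
  apply: eq_integral => x _; congr EFin; rewrite expr2 !fctE /=.
  by rewrite /pgauss_moment unlock.
have i2 : P.-integrable setT (EFin \o (fun x : RT => (`|x| `^ q - M) ^+ 2)).
  have := integrable_RZ (M ^+ 2) (integrable_cube_le (isT : (2 <= 3)%N)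
    (measurable_funB measurable_pnum (@measurable_cst _ _ RT _ setT (1 : R))) integrable_pnum_cube).
  apply: eq_integrable => // x _ /=; congr EFin.
  by rewrite -exprMn /pnum mulrBr mulr1 mulrCA mulfV ?gt_eqF// mulr1.
rewrite mulrC -RintegralZl//; apply: eq_Rintegral => x _.
by rewrite /Y /numer_dev /pnum; field; rewrite !gt_eqF.
Qed.

Let iY3 : P.-integrable setT (EFin \o (fun x => `|Y x| ^+ 3)).
Proof.
have := integrable_RZ (q^-1 ^+ 3) integrable_pnum_cube; apply: eq_integrable => // x _ /=.
have qV : 0 < q^-1 by rewrite invr_gt0.
by rewrite /Y /numer_dev normrM exprMn mulrC (gtr0_norm qV).
Qed.

Let iW3 : P.-integrable setT (EFin \o (fun x => `|W x| ^+ 3)).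
Proof.
have := integrable_RZ (pinv ^+ 3) integrable_pden_cube; apply: eq_integrable => // x _ /=.
by rewrite /W /denom_dev normrM exprMn (ger0_norm pinv_ge0).
Qed.

Let mY : measurable_fun setT Y.
Proof. by apply: measurable_funM => //; apply: measurable_funB => //; exact: measurable_pnum. Qed.
Let mW : measurable_fun setT W.
Proof. by apply: measurable_funM => //; apply: measurable_funB => //; exact: measurable_pden. Qed.

Lemma integrable_numer_sqr : P.-integrable setT (EFin \o (fun x => Y x ^+ 2)).
Proof. exact: (integrable_cube_le (isT : (2 <= 3)%N)). Qed.

Lemma integrable_denom_sqr : P.-integrable setT (EFin \o (fun x => W x ^+ 2)).
Proof. exact: (integrable_cube_le (isT : (2 <= 3)%N)). Qed.

Lemma integrable_numer_denom : P.-integrable setT (EFin \o (fun x => Y x * W x)).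
Proof.
apply: (integrable_Rle _ (integrable_RD integrable_numer_sqr integrable_denom_sqr)).
  exact: measurable_funM.
move=> y; rewrite normrM -(real_normK (num_real (Y y))) -(real_normK (num_real (W y))).
have := sqr_ge0 (`|Y y| - `|W y|); have := normr_ge0 (Y y); have := normr_ge0 (W y).
by nra.
Qed.

Lemma integrable_dev_sub_sqr : P.-integrable setT (EFin \o (fun x => (Y x - W x) ^+ 2)).
Proof.
have := integrable_RD integrable_numer_sqr
  (integrable_RD (integrable_RZ (- 2) integrable_numer_denom) integrable_denom_sqr).
by apply: eq_integrable => // x _ /=; congr EFin; ring.
Qed.

Lemma Rintegral_dev_sub_sqr : \int[P]_x ((Y x - W x) ^+ 2) =
  \int[P]_x (Y x ^+ 2) - 2 * \int[P]_x (Y x * W x) + \int[P]_x (W x ^+ 2).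
Proof.
rewrite (@eq_Rintegral _ _ _ _ _ (fun x => Y x ^+ 2 + (- 2 * (Y x * W x) + W x ^+ 2))); last first.
  by move=> x _; ring.
have i1 := integrable_numer_sqr; have i2 := integrable_denom_sqr; have i3 := integrable_numer_denom.
have i4 := integrable_RZ (- 2) i3.
rewrite RintegralD//; last exact: integrable_RD.
by rewrite RintegralD// RintegralZl// mulNr addrA.
Qed.

(** Otherwise |x|^q would be constant on []0, 1[], against its values at 1/2 and 1/4. *)
Lemma Rintegral_numer_sqr_gt0 : 0 < \int[P]_x (Y x ^+ 2).
Proof.
rewrite lt_neqAle Rintegral_ge0 ?andbT; last by move=> x _; exact: sqr_ge0.
apply/negP => /eqP /esym Ig.
have Y0 (x : R) : 0 < x < 1 -> `|x| `^ q = M.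
  move=> x01; have /andP[x0 x1] := x01.
  have c0 : `|y| `^ q @[y --> x] --> `|x| `^ q := continuous_abs_powR (a:=q) x0.
  have c1 : (`|y| `^ q / M - 1) / q @[y --> x] --> (`|x| `^ q / M - 1) / q.
    by apply: cvgMl; apply: cvgB; [exact: cvgMl|exact: cvg_cst].
  have cY2 : {for x, continuous (fun y : R => Y y ^+ 2)} by exact: (cvgM c1 c1).
  have /eqP := pgauss_integral_eq0 p0 integrable_numer_sqr (fun y => sqr_ge0 _) Ig x01 cY2.
  rewrite sqrf_eq0 /Y /numer_dev /pnum mulf_eq0 invr_eq0 (gt_eqF q0) orbF subr_eq0 => /eqP h.
  by rewrite -[RHS]mul1r -h mulfVK ?gt_eqF.
have /andP[h0 h1] := half_01.
have h4 : 0 < (2^-1 * 2^-1 : R) < 1 by rewrite mulr_gt0//= mulr_ilt1 ?ltW.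
have := Y0 _ h4; rewrite -(Y0 _ half_01) normrM powRM// -[RHS]mulr1 => /mulfI.
rewrite gt_eqF ?powR_gt0 ?normr_gt0 ?gt_eqF// => /(_ isT).
move=> /eqP; rewrite powR_eq1 gtr0_norm// => /or3P[/eqP|h|]; [by lra|by lra|].
by rewrite gt_eqF.
Qed.

End pgauss_variables.

Section s2_positive.
Context {R : realType}.
Notation RT := (measurableTypeR R).
Implicit Types (p : \bar R) (q G : R).

Lemma Rintegral_numer_denom p q : (0 < p)%E -> 0 < q ->
  \int[pgauss p]_x (numer_dev (pnum p q) q x * denom_dev (pden p) (pinv p) x) =
  pgauss_cov p p q * pinv p / (q * pgauss_moment p q).
Proof.
move=> p0 q0; have M0 := pgauss_moment_gt0 p0 q0.
have iYW := integrable_numer_denom p0 q0.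
case: p => [r||]// in p0 M0 iYW *; last first.
  rewrite /denom_dev /pinv /=; under eq_Rintegral do rewrite mul0r mulr0.
  by rewrite Rintegral_cst1 !mul0r.
have r0 : 0 < r by rewrite -lte_fin.
have wE : pinv r%:E = r^-1 by rewrite /pinv fine_inve// gt_eqF.
set M := pgauss_moment _ _ in M0 *.
have -> : pgauss_cov r%:E r%:E q = \int[pgauss r%:E]_x ((`|x| `^ r - 1) * (`|x| `^ q - M)).
  rewrite /pgauss_cov unlock /= unlock /Rintegral; congr fine.
  apply: eq_integral => x _; congr EFin; rewrite !fctE /=.
  have e1 := pgauss_moment_p r0; rewrite /Rintegral in e1.
  by rewrite e1 /M /pgauss_moment unlock.
have i2 : (pgauss r%:E).-integrable setT (EFin \o (fun x : RT => (`|x| `^ r - 1) * (`|x| `^ q - M))).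
  have := integrable_RZ (q * M * r) iYW; apply: eq_integrable => // x _ /=; congr EFin.
  by rewrite /numer_dev /denom_dev /pnum /pden wE -/M; field; rewrite !gt_eqF.
rewrite wE -mulrA mulrC -RintegralZl//; apply: eq_Rintegral => x _.
by rewrite /numer_dev /denom_dev /pnum /pden -/M; field; rewrite !gt_eqF.
Qed.

(** For [p = r] finite this is the variance [r] of |X|^r divided by [r ^+ 2]; for [p = +oo] both
    sides are 0. *)
Lemma Rintegral_denom_sqr p : (0 < p)%E -> \int[pgauss p]_x (denom_dev (pden p) (pinv p) x ^+ 2) = pinv p.
Proof.
case: p => [r||]//; last first.
  move=> _; rewrite /denom_dev /pinv /=; under eq_Rintegral do rewrite mul0r expr0n/=.
  by rewrite Rintegral_cst1.
rewrite lte_fin => r0; have wE : pinv r%:E = r^-1 by rewrite /pinv fine_inve// gt_eqF.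
have i1 := @integrable_pgauss_abs_powR R r%:E _ (ltW r0).
have i2 := @integrable_pgauss_abs_powR R r%:E _ (ltW (addr_gt0 r0 r0)).
rewrite (@eq_Rintegral _ _ _ _ _ (fun x : RT => r^-1 ^+ 2 * (`|x| `^ (r + r)) +
    (- (2 * r^-1 ^+ 2) * (`|x| `^ r) + r^-1 ^+ 2))); last first.
  move=> x _; rewrite /denom_dev /pden wE powRD; last by rewrite gt_eqF ?addr_gt0.
  by set X := `|x| `^ r; ring.
have cE : (r + 1) * r^-1 ^+ 2 - 2 * r^-1 ^+ 2 + r^-1 ^+ 2 = r^-1.
  by field; rewrite gt_eqF.
rewrite wE -[RHS]cE; move: (r^-1 ^+ 2) => c.
have i3 := integrable_RZ c i2; have i4 := integrable_RZ (- (2 * c)) i1.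
have i5 := @integrable_Rcst _ _ _ (pgauss r%:E) c.
rewrite RintegralD//; last exact: integrable_RD.
rewrite RintegralD// !RintegralZl// Rintegral_cst1 pgauss_moment_p// pgauss_moment_2p//.
by ring.
Qed.

Lemma s2E p q G : (0 < p)%E -> 0 < q ->
  s2 p q G = \int[pgauss p]_x (numer_dev (pnum p q) q x ^+ 2)
    - 2 * G ^+ 2 * \int[pgauss p]_x (numer_dev (pnum p q) q x * denom_dev (pden p) (pinv p) x)
    + G ^+ 2 * \int[pgauss p]_x (denom_dev (pden p) (pinv p) x ^+ 2).
Proof.
move=> p0 q0; rewrite /s2 Rintegral_numer_sqr// Rintegral_numer_denom// Rintegral_denom_sqr// -/(pinv p).
by congr (_ - _ + _); rewrite !mulrA; congr (_ / _); ring.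
Qed.

(** If the integral vanished, x^q / (q M) - x^r / r would be constant on []0, 1[]. The points 1/2,
    1/4 and 1/16 turn the powers into u, u^2, u^4 and v, v^2, v^4, which is enough to force u = v,
    that is q = r. *)
Lemma Rintegral_dev_sub_sqr_gt0 p q : (0 < p)%E -> 0 < q -> (p < +oo)%E -> p <> q%:E ->
  0 < \int[pgauss p]_x ((numer_dev (pnum p q) q x - denom_dev (pden p) (pinv p) x) ^+ 2).
Proof.
move=> p0 q0; case: p => [r||]// in p0 *; move=> _ rq.
have r0 : 0 < r by rewrite -lte_fin.
have M0 := pgauss_moment_gt0 p0 q0; have iYB := integrable_dev_sub_sqr p0 q0.
have wE : pinv r%:E = r^-1 by rewrite /pinv fine_inve// gt_eqF.
set M := pgauss_moment _ _ in M0 *.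
rewrite lt_neqAle Rintegral_ge0 ?andbT; last by move=> x _; exact: sqr_ge0.
apply/negP => /eqP /esym Ig.
have Y0 (x : R) : 0 < x < 1 -> (q * M)^-1 * x `^ q - r^-1 * x `^ r = q^-1 - r^-1.
  move=> x01; have /andP[x0 x1] := x01.
  have c0 : `|y| `^ q @[y --> x] --> `|x| `^ q := continuous_abs_powR (a:=q) x0.
  have d0 : `|y| `^ r @[y --> x] --> `|x| `^ r := continuous_abs_powR (a:=r) x0.
  have c1 : (`|y| `^ q / M - 1) / q @[y --> x] --> (`|x| `^ q / M - 1) / q.
    by apply: cvgMl; apply: cvgB; [exact: cvgMl|exact: cvg_cst].
  have d1 : pinv r%:E * (`|y| `^ r - 1) @[y --> x] --> pinv r%:E * (`|x| `^ r - 1).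
    by apply: cvgMr; apply: cvgB => //; exact: cvg_cst.
  have cYW : {for x, continuous (fun y : R =>
      (numer_dev (pnum r%:E q) q y - denom_dev (pden r%:E) (pinv r%:E) y) ^+ 2)}.
    exact: (cvgM (cvgB c1 d1) (cvgB c1 d1)).
  have /eqP := pgauss_integral_eq0 p0 iYB (fun y => sqr_ge0 _) Ig x01 cYW.
  rewrite sqrf_eq0 /numer_dev /denom_dev /pnum /pden wE -/M gtr0_norm// => /eqP h.
  apply/eqP; rewrite -subr_eq0 -[X in _ == X]h; apply/eqP.
  by set A := x `^ q; set B := x `^ r; field; rewrite !gt_eqF.
have /andP[h0 h1] := @half_01 R.
have h4 : 0 < (2^-1 * 2^-1 : R) < 1 by rewrite mulr_gt0//= mulr_ilt1 ?ltW.
have /andP[h40 h41] := h4.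
have h16 : 0 < ((2^-1 * 2^-1) * (2^-1 * 2^-1) : R) < 1.
  by rewrite mulr_gt0//= mulr_ilt1 ?(ltW h40).
have := Y0 _ half_01; have := Y0 _ h4; have := Y0 _ h16.
rewrite !powRM ?(ltW h0) ?(ltW h40)//.
have u0 : 0 < (2^-1 : R) `^ q by rewrite powR_gt0.
have v0 : 0 < (2^-1 : R) `^ r by rewrite powR_gt0.
have lt1 (c : R) : 0 < c -> (2^-1 : R) `^ c < 1.
  move=> c0; have := @gt0_ltr_powR R c c0 2^-1 1; rewrite powR1 !nnegrE.
  by apply => //; exact: ltW.
have u1 := lt1 _ q0; have v1 := lt1 _ r0.
have uv : (2^-1 : R) `^ q <> (2^-1 : R) `^ r.
  move=> /(congr1 (@ln R)); rewrite !ln_powR => /mulIf qr; apply: rq; congr EFin; apply/esym/qr.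
  by rewrite ln_eq0 ?lt_eqF// ltW.
set u := (2^-1 : R) `^ q in u0 u1 uv *; set v := (2^-1 : R) `^ r in v0 v1 uv *.
set al := (q * M)^-1; set be := r^-1; set c := q^-1 - be.
have al0 : 0 < al by rewrite invr_gt0 mulr_gt0.
have be0 : 0 < be by rewrite invr_gt0.
move=> e4 e2 e1.
(* with u = 2^-q and v = 2^-r, eliminating the constants leaves u (1 + u) = v (1 + v) *)
have f1 : al * u * (1 - u) = be * v * (1 - v) by nra.
have f2 : (al * u * (1 - u)) * (u * (1 + u)) = (be * v * (1 - v)) * (v * (1 + v)) by nra.
have k0 : be * v * (1 - v) != 0 by rewrite gt_eqF// !mulr_gt0// subr_gt0.
rewrite f1 in f2; move/(mulfI k0) : f2 => f3.
apply: uv; have : (u - v) * (1 + u + v) = 0 by nra.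
move=> /eqP; rewrite mulf_eq0 subr_eq0 => /orP[/eqP//|]; rewrite gt_eqF//.
by rewrite !addr_gt0.
Qed.

(* [s2 = (1 - G^2) Var Y + G^2 Var (Y - W)] with [Y], [W] the deviations of numerator and
   denominator, and [Y - W] degenerates only when [p = q]. *)
Lemma s2_gt0 p q G : (0 < p)%E -> 0 < q -> ((p < +oo)%E -> 0 <= G <= 1) ->
  (p <> q%:E \/ G < 1) -> 0 < s2 p q G.
Proof.
move=> p0 q0 G01 pq; have Y2 := Rintegral_numer_sqr_gt0 p0 q0.
have [->|poo] := eqVneq p +oo%E.
  have w0 : pinv (+oo%E : \bar R) = 0 by [].
  rewrite s2E// Rintegral_numer_denom// Rintegral_denom_sqr// w0.
  by rewrite !(mulr0, mul0r) subr0 addr0; exact: Rintegral_numer_sqr_gt0.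
have plt : (p < +oo)%E by rewrite ltey.
have /andP[G0 G1] := G01 plt.
rewrite s2E//; set y := \int[_]_x _ in Y2 *; set yw := \int[_]_x _; set ww := \int[_]_x _.
have -> : y - 2 * G ^+ 2 * yw + G ^+ 2 * ww = (1 - G ^+ 2) * y + G ^+ 2 * (y - 2 * yw + ww).
  by ring.
have e := Rintegral_dev_sub_sqr p0 q0; rewrite -/y -/yw -/ww in e; rewrite -e.
have B0 : 0 <= \int[pgauss p]_x ((numer_dev (pnum p q) q x - denom_dev (pden p) (pinv p) x) ^+ 2).
  by apply: Rintegral_ge0 => x _; exact: sqr_ge0.
have [Glt|] := ltP G 1.
  rewrite ltr_wpDr ?mulr_ge0 ?sqr_ge0// mulr_gt0// subr_gt0.
  by rewrite expr_lt1.
move=> G1'; have GE : G = 1 by apply/eqP; rewrite eq_le G1.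
case: pq => [pq|]; last by rewrite GE ltxx.
by rewrite GE expr1n subrr mul0r add0r mul1r Rintegral_dev_sub_sqr_gt0.
Qed.

End s2_positive.

(** * The critical case *)

Section semi_axes.
Context {R : realType}.
Implicit Types (p : \bar R) (q : R).

Lemma powRN2 (x q : R) : x `^ (- (2 * q)) = (x `^ (- q)) ^+ 2.
Proof.
by rewrite -powR_mulrn ?powR_ge0// -powRrM; congr (_ `^ _); ring.
Qed.

(** The geometric mean of the semi-axes divided by their power mean of exponent [- q]; [F] is its
    limit. *)
Definition mean_ratio n q (sigma : 'I_n -> R) : R :=
  (\prod_(i < n) sigma i) `^ n%:R^-1 *
    (n%:R^-1 * \sum_(i < n) sigma i `^ (- q)) `^ q^-1.

Section one_dimension.
Variables (n : nat) (q : R) (sigma : 'I_n -> R).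
Hypotheses (n0 : (0 < n)%N) (q0 : 0 < q) (sigma0 : forall i, 0 < sigma i).
Let B i := sigma i `^ (- q).
Let P := \prod_(i < n) sigma i.

Let nR : 0 < n%:R :> R. Proof. by rewrite ltr0n. Qed.
Let P0 : 0 < P. Proof. exact: prodr_gt0. Qed.
Let B0 i : 0 < B i. Proof. exact: powR_gt0. Qed.
Let S0 : 0 < wsum B. Proof. exact: wsum_gt0. Qed.
Let m0 : 0 < n%:R^-1 * wsum B. Proof. by rewrite mulr_gt0 ?invr_gt0. Qed.

Lemma mean_ratioE : mean_ratio q sigma =
  expR (n%:R^-1 * ln P + q^-1 * (ln (wsum B) - ln n%:R)).
Proof.
rewrite /mean_ratio -/P -/(wsum B) !powR_expR// -expRD.
by rewrite lnM ?posrE ?invr_gt0// lnV ?posrE// [ln (wsum B) - _]addrC.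
Qed.

(** The inequality of arithmetic and geometric means for the powers [- q] of the semi-axes. In the
    limit it yields [F >= 1]. *)
Lemma mean_ratio_ge1 : 1 <= mean_ratio q sigma.
Proof.
rewrite mean_ratioE -[leLHS]expR0 ler_expR.
have := leif_AGM (A := 'I_n) (fun i _ => ltW (B0 i)).
rewrite /= card_ord => -[+ _].
have -> : \prod_(i in 'I_n) B i = P `^ (- q).
  have : \prod_(i < n) B i = P `^ (- q) /\ 0 <= P; last by case.
  rewrite /P; elim/big_rec2: _ => [|i x y _ [-> x0]]; first by rewrite powR1.
  by rewrite powRM ?mulr_ge0// ltW.
rewrite -[\sum_(i in 'I_n) B i]/(wsum B) => h.
have : ln (P `^ (- q)) <= ln ((wsum B / n%:R) ^+ n).
  by rewrite ler_ln ?posrE ?powR_gt0// exprn_gt0// divr_gt0.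
rewrite ln_powR lnXn ?divr_gt0// ln_div ?posrE// -[X in _ <= X]mulr_natl => h1.
have -> : n%:R^-1 * ln P + q^-1 * (ln (wsum B) - ln n%:R) =
  (q * n%:R)^-1 * (n%:R * (ln (wsum B) - ln n%:R) - (- q * ln P)).
  by field; rewrite !gt_eqF.
by rewrite mulr_ge0 ?invr_ge0 ?mulr_ge0 ?(ltW q0) ?subr_ge0// ltW.
Qed.

(** The right-hand side is the left-hand side times a power of [mean_ratio], which is at least 1. As
    it is the sequence assumed to vanish, [wratio] tends to infinity. *)
Lemma wratioV_sqr_le : (wratio B)^-1 ^+ 2 <=
  P `^ (2 * q / n%:R) * (n%:R ^- 2 * \sum_(i < n) sigma i `^ (- (2 * q))).
Proof.
have B2 : \sum_(i < n) sigma i `^ (- (2 * q)) = wnorm B ^+ 2.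
  by rewrite wnorm_sqr//; apply: eq_bigr => i _; exact: powRN2.
rewrite B2.
have S20 : 0 < wnorm B by exact: wnorm_gt0.
have h : 1 <= P `^ (2 * q / n%:R) * (n%:R^-1 * wsum B) ^+ 2.
  rewrite -powR_mulrn; last exact: ltW.
  rewrite !powR_expR// -expRD -[leLHS]expR0 ler_expR.
  have := mean_ratio_ge1; rewrite mean_ratioE -[leLHS]expR0 ler_expR => h.
  have -> : 2 * q / n%:R * ln P + 2%:R * ln (n%:R^-1 * wsum B) =
     2 * q * (n%:R^-1 * ln P + q^-1 * (ln (wsum B) - ln n%:R)).
    by rewrite lnM ?posrE ?invr_gt0// lnV ?posrE//; field; rewrite !gt_eqF.
  by rewrite mulr_ge0// mulr_ge0// ltW.
have -> : P `^ (2 * q / n%:R) * (n%:R ^- 2 * wnorm B ^+ 2) =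
  P `^ (2 * q / n%:R) * (n%:R^-1 * wsum B) ^+ 2 * (wratio B)^-1 ^+ 2.
  by rewrite /wratio; field; rewrite !gt_eqF.
by rewrite ler_peMl// sqr_ge0.
Qed.

End one_dimension.

End semi_axes.

Section cone_events.
Context {R : realType}.
Notation RT := (measurableTypeR R).
Variables (p : \bar R) (q : R) (n : nat) (sigma : 'I_n -> R).
Hypotheses (p0 : (0 < p)%E) (q0 : 0 < q) (n0 : (0 < n)%N).
Hypothesis sigma0 : forall i, 0 < sigma i.
Let B i := sigma i `^ (- q).
Notation M := (pgauss_moment p q).

(* Chosen so that [ell_cone p q sigma k] becomes [ratio_event] at level [cone_excess k], which is
   [ln k] minus the logarithm of the typical value of the ratio. *)
Definition cone_excess (k : R) : R :=
  ln k + pinv p * ln n%:R - q^-1 * ln (M * wsum B).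

Notation Kc rho := (ratio_event (pnum p q) (pden p) q (pinv p) B rho).

Let B0 i : 0 < B i. Proof. exact: powR_gt0. Qed.

Lemma expR_cone_excess k : 0 < k ->
  expR (q * cone_excess k) = k `^ q * n%:R `^ (q * pinv p) / (M * wsum B).
Proof.
move=> k0; have MS : 0 < M * wsum B by rewrite mulr_gt0 ?pgauss_moment_gt0 ?wsum_gt0.
rewrite !powR_expR ?ltr0n// -[in RHS](lnK MS) -expRN -!expRD; congr expR.
by rewrite /cone_excess; field; rewrite gt_eqF.
Qed.

Lemma ell_cone_ratio_event r k : p = r%:E -> 0 < k -> ell_cone r q sigma k = Kc (cone_excess k).
Proof.
move=> pr k0; have r0 : 0 < r by rewrite -lte_fin -pr.
have M0 := pgauss_moment_gt0 p0 q0; have S0 : 0 < wsum B by exact: wsum_gt0.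
have wE : pinv p = r^-1 by rewrite pr /pinv fine_inve// gt_eqF.
apply/seteqP; split => x; rewrite /ell_cone /ratio_event /= expR_cone_excess// wE.
all: have -> : \sum_(i < n) B i * pnum p q (tnth x i) = ell_sum q sigma x / M
  by rewrite /ell_sum mulr_suml; apply: eq_bigr => i _; rewrite /pnum mulrA.
all: have -> : \sum_(i < n) pden p (tnth x i) = lp_sum r x by rewrite /lp_sum pr.
all: have -> : wsum B * (k `^ q * n%:R `^ (q / r) / (M * wsum B)) *
  (n%:R^-1 * lp_sum r x) `^ (q / r) = k `^ q * lp_sum r x `^ (q / r) / M
  by rewrite powRM ?invr_ge0 ?ler0n ?lp_sum_ge0// powRV ?ler0n//; field;
     rewrite !gt_eqF// powR_gt0// ltr0n.
all: by rewrite ler_pM2r ?invr_gt0.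
Qed.

Lemma ell_le_ratio_event k : p = +oo%E -> 0 < k ->
  [set x : n.-tuple RT | ell_sum q sigma x <= k `^ q] = Kc (cone_excess k).
Proof.
move=> poo k0.
have M0 := pgauss_moment_gt0 p0 q0; have S0 : 0 < wsum B by exact: wsum_gt0.
have wE : pinv p = 0 by rewrite poo.
apply/seteqP; split => x; rewrite /ratio_event /= expR_cone_excess// wE mulr0 !powRr0 !mulr1.
all: have -> : \sum_(i < n) B i * pnum p q (tnth x i) = ell_sum q sigma x / M
  by rewrite /ell_sum mulr_suml; apply: eq_bigr => i _; rewrite /pnum mulrA.
all: have -> : wsum B * (k `^ q / (M * wsum B)) = k `^ q / M
  by field; rewrite !gt_eqF.
all: by rewrite ler_pM2r ?invr_gt0.
Qed.

Lemma ratio_event_le_vol k : 0 < k -> (pprod (pgauss p) n (Kc (cone_excess k)) <=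
  (lp_cst p n)%:E * vol n ([set x | (ell_sum q sigma x <= k `^ q)%R] `&` lp_ball n p))%E.
Proof.
move=> k0; case E : p p0 => [r||] // p0'.
  by rewrite -E -(ell_cone_ratio_event E k0) E; apply: ell_cone_lower => //; rewrite -lte_fin.
rewrite -E -(ell_le_ratio_event E k0) pprod_ball//; first exact: measurable_ell_le.
by rewrite E.
Qed.

(** For finite [p] this is [ell_cone_upper]. For [p = +oo] the event is exactly a [ratio_event] and
    monotonicity in [k] suffices; the factor [1 - e] is kept so that the final squeeze treats all
    [p] at once. *)
Lemma vol_le_ratio_event k e : 0 < k -> 0 < e < 1 ->
  ((lp_cst p n)%:E * vol n ([set x | (ell_sum q sigma x <= k `^ q)%R] `&` lp_ball n p)
  <= pprod (pgauss p) n (Kc (cone_excess (k / (1 - e)))) + ((1 - e) ^+ n)%:E)%E.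
Proof.
move=> k0 e01; have /andP[e0 e1] := e01.
have ke : 0 < k / (1 - e) by rewrite divr_gt0 ?subr_gt0.
case E : p p0 => [r||] // p0'.
  by rewrite -E -(ell_cone_ratio_event E ke) E; apply: ell_cone_upper => //; rewrite -lte_fin.
rewrite -E -(ell_le_ratio_event E ke) -pprod_ball//; last 2 first.
- exact: measurable_ell_le.
- by rewrite E.
apply: (@le_trans _ _ (pprod (pgauss p) n [set x | ell_sum q sigma x <= (k / (1 - e)) `^ q])).
  apply: le_measure; rewrite ?inE; [exact: measurable_ell_le|exact: measurable_ell_le|].
  move=> x /= /le_trans; apply; apply: ge0_ler_powR; rewrite ?nnegrE ?(ltW q0) ?(ltW k0) ?(ltW ke)//.
  by rewrite ler_pdivlMr ?subr_gt0// ler_piMr ?ltW// gtrBl.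
by rewrite leeDl// lee_fin exprn_ge0// subr_ge0 ltW.
Qed.

(** [M] cancels against its power in [Apq], and the powers of [n] against the normalizations in
    [lp_nradius] and [mean_ratio]. At the critical dilation no constant is left: the first bracket
    is the error on the radii, the last term is ln h_n. *)
Lemma cone_excess_critical l F : 0 < F ->
  Apq p q = M `^ (- q^-1) * expR l ->
  cone_excess (scale_kappa p q sigma ((Apq p q)^-1 * F)) =
  (ln (lp_nradius n q%:E / lp_nradius n p) - l) - ln (mean_ratio q sigma / F).
Proof.
move=> F0 AE; have q0' : (0 < q%:E)%E by rewrite lte_fin.
have M0 := pgauss_moment_gt0 p0 q0; have S0 : 0 < wsum B by exact: wsum_gt0.
have Lp := lp_radius_gt0 n0 p0; have Lq := lp_radius_gt0 n0 q0'.
have P0 : 0 < \prod_(i < n) sigma i by exact: prodr_gt0.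
have A0 : 0 < Apq p q by rewrite AE mulr_gt0 ?powR_gt0 ?expR_gt0.
have nR : 0 < n%:R :> R by rewrite ltr0n.
have lA : ln (Apq p q) = - q^-1 * ln M + l.
  by rewrite AE lnM ?posrE ?powR_gt0 ?expR_gt0// ln_powR expRK.
rewrite /cone_excess /scale_kappa /lp_nradius mean_ratioE// -/B -/(pinv p).
move: (lp_radius n p) (lp_radius n q%:E) Lp Lq => Rp Rq Lp Lq.
rewrite !ln_div ?posrE ?mulr_gt0 ?powR_gt0 ?invr_gt0 ?expR_gt0//.
rewrite expRK !lnM ?posrE ?mulr_gt0 ?powR_gt0 ?invr_gt0 ?expR_gt0//.
rewrite !ln_powR lnV ?posrE// lA fine_inve ?gt_eqF//.
by ring.
Qed.

Lemma cone_excess_div k e : 0 < k -> 0 < e < 1 ->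
  cone_excess (k / (1 - e)) = cone_excess k - ln (1 - e).
Proof.
move=> k0 /andP[e0 e1].
by rewrite /cone_excess ln_div ?posrE ?subr_gt0//; ring.
Qed.

End cone_events.

Section perturbations.
Context {R : realType}.
Implicit Types (a h : nat -> R) (z : \bar R).

Lemma cvg_EFin_fin a (l : R) : a n @[n --> \oo] --> l -> (a n)%:E @[n --> \oo] --> l%:E.
Proof. by move=> al; apply: cvg_EFin al; exact: nearW. Qed.

(** The quotient ln h / (h - 1) tends to 1. As [z] may be infinite, the two sequences are compared
    through a factor and not through their difference. *)
Lemma cvg_mul_ln a h z : h n @[n --> \oo] --> (1 : R) ->
  (a n * (h n - 1))%:E @[n --> \oo] --> z -> (a n * ln (h n))%:E @[n --> \oo] --> z.
Proof.
move=> h1 hz.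
have u0 : 2 * `|h n - 1| @[n --> \oo] --> (0 : R).
  rewrite -[X in _ --> X](mulr0 (2 : R)); apply: cvgMr.
  rewrite -[X in _ --> X](normr0 R); apply: cvg_norm.
  by rewrite -[X in _ --> X](subrr (1 : R)); apply: cvgB => //; exact: cvg_cst.
(* At [h n = 1] both sequences vanish, and the value 1 keeps [g] convergent. *)
pose g n := if h n == 1 then 1 else ln (h n) / (h n - 1).
have g1 : g n @[n --> \oo] --> (1 : R).
  apply/cvgrPdist_le => e e0; near=> n.
  have un : 2 * `|h n - 1| < Num.min e 1.
    by near: n; apply: (cvgr_lt (0 : R) u0); rewrite lt_min e0 ltr01.
  move: un; rewrite lt_min => /andP[ue u1].
  rewrite /g; case: eqVneq => [_|hn]; first by rewrite subrr normr0 ltW.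
  apply: le_trans (ltW ue); set u := h n - 1 in ue u1 *.
  have u00 : u != 0 by rewrite subr_eq0.
  have -> : h n = 1 + u by rewrite /u; ring.
  rewrite -(ler_pM2r (_ : 0 < `|u|)) ?normr_gt0//.
  rewrite -normrM mulrBl mul1r divfK// -mulrA -expr2 real_normK ?num_real//.
  have u2 : - 2^-1 <= u /\ -1 < u.
    have : - `|u| <= u by rewrite lerNnormlW.
    by move=> ?; split; lra.
  have := ln_1D_ub u2.2; have := ln_1D_lb u2.1 => *.
  by rewrite ger0_norm ?subr_ge0//; lra.
have -> : z = (z * 1%:E)%E by rewrite mule1.
have : ((a n * (h n - 1))%:E * (g n)%:E)%E @[n --> \oo] --> (z * 1%:E)%E.
  apply: cvgeM => //; first by case: (z) => [r||]; rewrite /mule_def ?eqe ?oner_eq0 ?andbF ?orbF.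
  exact: cvg_EFin_fin.
apply: cvg_trans; apply: near_eq_cvg; near=> n; rewrite -EFinM /g /=; congr EFin.
case: eqVneq => [->|hn]; first by rewrite subrr ln1 !mulr0 mul0r.
by field; rewrite subr_eq0.
Unshelve. all: by end_near. Qed.

(** Two opposite demands: the ball of radius [1 - e] must have vanishing relative volume, while
    dividing the level by [1 - e] must not move the threshold even after multiplication by a
    sequence as large as n^(1/2). *)
Lemma vanishing_shrinkage : exists e : nat -> R,
  [/\ \forall n \near \oo, 0 < e n < 1,
      (1 - e n) ^+ n @[n --> \oo] --> (0 : R) &
      forall a, (forall n, 0 <= a n) -> (forall n, a n ^+ 2 <= n%:R) ->
        a n * ln (1 - e n) @[n --> \oo] --> (0 : R)].
Proof.
(* [e = t^3 = n^(-3/4)]; any order strictly between [1/n] and [n^(-1/2)] would do. *)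
pose t n : R := Num.sqrt (Num.sqrt n%:R)^-1.
have t0 : t n @[n --> \oo] --> (0 : R) by apply: cvg_sqrt0; exact: cvg_natr_sqrt_inv.
have tlt : \forall n \near \oo, t n < 2^-1 by apply: (cvgr_lt (0 : R) t0).
have tgt : \forall n \near \oo, 0 < t n.
  near=> n; have n0 : (0 < n)%N by near: n; exact: nbhs_infty_gt.
  by rewrite sqrtr_gt0 invr_gt0 sqrtr_gt0 ltr0n.
have t2 n : t n ^+ 2 = (Num.sqrt n%:R)^-1 by rewrite sqr_sqrtr// invr_ge0 sqrtr_ge0.
have t4 n : t n ^+ 2 ^+ 2 = n%:R^-1 by rewrite t2 exprVn sqr_sqrtr.
have et n : 0 < t n -> t n < 2^-1 -> 0 < t n ^+ 3 < 2^-1.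
  move=> h1 h2; rewrite exprn_gt0//=; apply: le_lt_trans (h2).
  rewrite exprSr ler_piMl ?(ltW h1)//.
  by rewrite expr2 mulr_ile1 ?(ltW h1)//; lra.
have t20 : 2 * t n @[n --> \oo] --> (0 : R).
  by rewrite -[X in _ --> X](mulr0 (2 : R)); exact: cvgMr.
exists (fun n => t n ^+ 3); split.
- near=> n; have /andP[] : 0 < t n ^+ 3 < 2^-1 by apply: et; near: n.
  by move=> -> /=; lra.
- apply: (squeeze_cvgr _ (cvg_cst (0 : R)) t0); near=> n.
  have tn0 : 0 < t n by near: n.
  have /andP[e0 e1] : 0 < t n ^+ 3 < 2^-1 by apply: et; near: n.
  rewrite exprn_ge0 ?subr_ge0//=; last by lra.
  have nE : n%:R = t n ^- 4 by rewrite -[LHS]invrK -t4 -exprM.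
  (* Since n = t^-4, (1 - t^3)^n <= exp(- n t^3) = exp(- 1/t) <= t. *)
  apply: (@le_trans _ _ (expR (- t n ^+ 3) ^+ n)).
    by rewrite lerXn2r ?nnegrE ?expR_ge0 ?expR_ge1Dx//; lra.
  rewrite -expRM_natr nE.
  have -> : - t n ^+ 3 * t n ^- 4 = - (t n)^-1 by field; rewrite gt_eqF.
  rewrite expRN invf_ple ?posrE ?expR_gt0//.
  by apply: le_trans (expR_ge1Dx _); rewrite lerDr.
- move=> a a0 a_le; apply/cvgrPdist_le => d d0; near=> n.
  have tn0 : 0 < t n by near: n.
  have /andP[e0 e1] : 0 < t n ^+ 3 < 2^-1 by apply: et; near: n.
  have td : 2 * t n <= d by apply: ltW; near: n; exact: (cvgr_lt (0 : R) t20).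
  rewrite sub0r normrN normrM (ger0_norm (a0 n)); apply: le_trans td.
  have ale : a n <= t n ^- 2.
    rewrite -(ler_pXn2r (_ : (0 < 2)%N)) ?nnegrE ?invr_ge0 ?exprn_ge0 ?(ltW tn0)//.
    by rewrite exprVn t4 invrK.
  have l0 : ln (1 - t n ^+ 3) <= 0 by apply: ln_le0; lra.
  have lle : `|ln (1 - t n ^+ 3)| <= 2 * t n ^+ 3.
    have h : - 2^-1 <= - t n ^+ 3 by lra.
    have := ln_1D_lb h; rewrite ler0_norm// sqrrN => h1.
    have : (t n ^+ 3) ^+ 2 <= t n ^+ 3 * 2^-1 by rewrite expr2 ler_wpM2l// ltW.
    by lra.
  apply: (@le_trans _ _ (t n ^- 2 * (2 * t n ^+ 3))); first exact: ler_pM.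
  by rewrite le_eqVlt; apply/orP; left; apply/eqP; field; rewrite gt_eqF.
Unshelve. all: by end_near. Qed.

End perturbations.

Theorem corollary1p3 (R : realType) (p : \bar R) (q : R)
    (sigma : forall n : nat, 'I_n -> R) (F G : R) (z : \bar R) :
  (0 < p)%E -> 0 < q ->
  (forall n (i : 'I_n), 0 < sigma n i) ->
  (\prod_(i < n) sigma n i) `^ n%:R^-1 *
    (n%:R^-1 * \sum_(i < n) sigma n i `^ (- q)) `^ q^-1 @[n --> \oo] --> F ->
  (\prod_(i < n) sigma n i) `^ (2 * q / n%:R) *
    (n%:R ^- 2 * \sum_(i < n) sigma n i `^ (- (2 * q))) @[n --> \oo]
      --> (0 : R) ->
  (\big[Num.max/0]_(i < n) sigma n i `^ (- (2 * q))) /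
    (\sum_(i < n) sigma n i `^ (- (2 * q))) @[n --> \oo] --> (0 : R) ->
  ((p < +oo)%E ->
    (\sum_(i < n) sigma n i `^ (- q)) /
      (Num.sqrt n%:R * Num.sqrt (\sum_(i < n) sigma n i `^ (- (2 * q))))
      @[n --> \oo] --> G) ->
  (p <> q%:E \/ G < 1) ->
  let s := Num.sqrt (s2 p q G) in
  let h n := (\prod_(i < n) sigma n i) `^ n%:R^-1 *
    (n%:R^-1 * \sum_(i < n) sigma n i `^ (- q)) `^ q^-1 / F in
  let tcrit := (Apq p q)^-1 * F in
  ((\sum_(i < n) sigma n i `^ (- q)) /
    Num.sqrt (\sum_(i < n) sigma n i `^ (- (2 * q))) * (h n - 1))%:E
      @[n --> \oo] --> z ->
  vol n (unit_dilation (lp_ball n p) `&`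
         dilate tcrit (unit_dilation (ellipsoid q (sigma n)))) @[n --> \oo]
    --> Phi (- (z / s%:E)).
Proof.
move=> p0 q0 sigma0 hF hH hmax hG pq s h tcrit hz.
pose B n (i : 'I_n) := sigma n i `^ (- q).
have B0 n (i : 'I_n) : 0 < B n i by exact: powR_gt0.
have B2E n : \sum_(i < n) sigma n i `^ (- (2 * q)) = \sum_(i < n) B n i ^+ 2.
  by apply: eq_bigr => i _; exact: powRN2.
have S2E n : Num.sqrt (\sum_(i < n) sigma n i `^ (- (2 * q))) = wnorm (B n).
  by rewrite /wnorm B2E.
have F1 : 1 <= F.
  apply: (cvgr_to_ge hF); near=> n; apply: mean_ratio_ge1 => //.
  by near: n; exact: nbhs_infty_gt.
have F0 : 0 < F := lt_le_trans ltr01 F1.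
have h1 : h n @[n --> \oo] --> (1 : R).
  by rewrite -[X in _ --> X](@mulfV _ F) ?gt_eqF//; exact: cvgMl.
have an0 n : 0 <= wratio (B n).
  by rewrite divr_ge0 ?sqrtr_ge0// sumr_ge0// => i _; exact: ltW.
have an_le n : wratio (B n) ^+ 2 <= n%:R.
  have [n0|n0] := posnP n; last exact: wratio_sqr_le.
  rewrite (_ : wratio _ = 0) ?expr0n//; rewrite /wratio /wsum big1 ?mul0r// => i _.
  by have := ltn_ord i; rewrite {2}n0.
have anV : (wratio (B n))^-1 @[n --> \oo] --> (0 : R).
  have : (wratio (B n))^-1 ^+ 2 @[n --> \oo] --> (0 : R).
    apply: (squeeze_cvgr _ (cvg_cst (0 : R)) hH); near=> n.
    rewrite sqr_ge0/=; apply: wratioV_sqr_le => //.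
    by near: n; exact: nbhs_infty_gt.
  move/cvg_sqrt0; apply: cvg_trans; apply: near_eq_cvg; near=> n.
  by rewrite /= sqrtr_sqr ger0_norm// invr_ge0.
have anG : (p < +oo)%E -> wratio (B n) / Num.sqrt n%:R @[n --> \oo] --> G.
  move=> /hG; apply: cvg_trans; apply: near_eq_cvg; near=> n.
  by rewrite /= S2E invfM mulrA mulrAC.
(* [G] is the limit of wratio / n^(1/2), which Cauchy-Schwarz keeps in [0, 1]. *)
have G01 : (p < +oo)%E -> 0 <= G <= 1.
  move=> /anG aG; apply/andP; split.
    by apply: (cvgr_to_ge aG); near=> n; rewrite divr_ge0 ?sqrtr_ge0.
  apply: (cvgr_to_le aG); near=> n.
  have n0 : (0 < n)%N by near: n; exact: nbhs_infty_gt.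
  rewrite ler_pdivrMr ?sqrtr_gt0 ?ltr0n// mul1r.
  by rewrite -[leLHS]ger0_norm// -sqrtr_sqr ler_wsqrtr.
have s20 : 0 < s2 p q G by exact: s2_gt0.
have s0 : 0 < s by rewrite sqrtr_gt0.
have sE : s ^+ 2 = s2 p q G by rewrite sqr_sqrtr// ltW.
have cV : lin_variance (pgauss p) (pnum p q) (pden p) q (pinv p) (B n) @[n --> \oo] --> s ^+ 2.
  rewrite sE s2E// /lin_variance.
  (* For [p = +oo] no convergence to [G] is available, and both terms that carry it vanish because
     [pinv p = 0]. *)
  have [poo|poo] := eqVneq p +oo%E.
    have w0 : pinv p = 0 by rewrite poo.
    rewrite Rintegral_numer_denom// Rintegral_denom_sqr// w0 !(mulr0, mul0r) subr0 addr0.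
    by under eq_fun do rewrite !mulr0 subr0 addr0; exact: cvg_cst.
  have aG : wratio (B n) ^+ 2 / n%:R @[n --> \oo] --> G ^+ 2.
    have plt : (p < +oo)%E by rewrite ltey.
    rewrite [G ^+ 2]expr2; apply: cvg_trans (cvgM (anG plt) (anG plt)).
    by apply: near_eq_cvg; near=> n; rewrite /= mulrACA -invfM -!expr2 sqr_sqrtr.
  apply: cvgD; last exact: cvgMl.
  by apply: cvgB; [exact: cvg_cst|apply: cvgMl; exact: cvgMr].
have [l [AE hl]] := ApqE p0 q0.
have A0 : 0 < Apq p q by rewrite AE mulr_gt0 ?powR_gt0 ?expR_gt0 ?pgauss_moment_gt0.
have t0 : 0 < tcrit by rewrite mulr_gt0 ?invr_gt0.
pose k n := scale_kappa p q (sigma n) tcrit.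
pose d n := ln (lp_nradius n q%:E / lp_nradius n p : R) - l.
have hd : Num.sqrt n%:R * d n @[n --> \oo] --> (0 : R) by exact: hl.
(* The radii are known up to o(n^(-1/2)), and [wratio] is at most n^(1/2). *)
have ad0 : wratio (B n) * d n @[n --> \oo] --> (0 : R).
  apply/cvgr0Pnorm_le => eps eps0; near=> n.
  have : `|Num.sqrt n%:R * d n| <= eps.
    by near: n; move: eps eps0; exact/cvgr0Pnorm_le.
  apply: le_trans; rewrite (normrM (wratio _)) (normrM (Num.sqrt _)); apply: ler_wpM2r => //.
  rewrite (ger0_norm (an0 n)) ger0_norm ?sqrtr_ge0//.
  by rewrite -[leLHS]ger0_norm// -sqrtr_sqr ler_wsqrtr.
have ahz : (wratio (B n) * ln (h n))%:E @[n --> \oo] --> z.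
  apply: cvg_mul_ln => //; move: hz; apply: cvg_trans.
  by apply: near_eq_cvg; near=> n; rewrite /= S2E.
(* [u] is the correction due to the shrinkage: 0 for the lower bound,
   [- (wratio (B n) * ln (1 - e n))] for the upper one. As [z] may be infinite, the vanishing terms
   are added to it in the extended reals. *)
have excess (u : nat -> R) : u n @[n --> \oo] --> (0 : R) ->
    (wratio (B n) * (d n - ln (h n)) + u n)%:E @[n --> \oo] --> (- z)%E.
  move=> u0; have -> : (- z = - z + 0%:E)%E by rewrite adde0.
  have : (- (wratio (B n) * ln (h n))%:E + (wratio (B n) * d n + u n)%:E)%E @[n --> \oo]
      --> (- z + 0%:E)%E.
    apply: cvgeD; first by rewrite fin_num_adde_defl.
      exact: cvgeN.
    by apply: cvg_EFin_fin; rewrite -[X in _ --> X](addr0 (0 : R)); exact: cvgD.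
  apply: cvg_trans; apply: near_eq_cvg; near=> n.
  by rewrite /=; congr EFin; ring.
have limit (rho : nat -> R) : (wratio (B n) * rho n)%:E @[n --> \oo] --> (- z)%E ->
    pprod (pgauss p) n (ratio_event (pnum p q) (pden p) q (pinv p) (B n) (rho n)) @[n --> \oo] -->
    Phi (- (z / s%:E))%E.
  move=> hrho.
  have -> : (- (z / s%:E) = - z * (s^-1)%:E)%E by rewrite inver gt_eqF// mulNe.
  rewrite -PhirE; apply: cvg_EFin.
    apply: nearW => n; apply: fin_num_measure; apply: measurable_ratio_event.
      exact: measurable_pnum.
    exact: measurable_pden.
  apply: (ratio_event_clt q0 (pinv_ge0 p0)) => //.
  - exact: measurable_pnum.
  - exact: measurable_pden.
  - exact: Rintegral_pnum_sub1.
  - exact: Rintegral_pden_sub1.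
  - exact: integrable_pnum_cube.
  - exact: integrable_pden_cube.
  - move: hmax; apply: cvg_trans; apply: near_eq_cvg; near=> n.
    by rewrite /= B2E; congr (_ / _); apply: eq_bigr => i _; rewrite powRN2.
have [e [e01 e0 ae]] := @vanishing_shrinkage R.
have excessE n : (0 < n)%N -> cone_excess p q (sigma n) (k n) = d n - ln (h n).
  by move=> n0; rewrite (cone_excess_critical p0 q0 n0 _ F0 AE).
have kgt n : (0 < n)%N -> 0 < k n by move=> n0; exact: scale_kappa_gt0.
have lo : pprod (pgauss p) n (ratio_event (pnum p q) (pden p) q (pinv p) (B n)
    (cone_excess p q (sigma n) (k n))) @[n --> \oo] --> Phi (- (z / s%:E))%E.
  apply: limit; apply: cvg_trans (excess (fun=> 0) (cvg_cst (0 : R))).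
  apply: near_eq_cvg; near=> n; rewrite /= addr0 excessE//.
  by near: n; exact: nbhs_infty_gt.
have up : (pprod (pgauss p) n (ratio_event (pnum p q) (pden p) q (pinv p) (B n)
    (cone_excess p q (sigma n) (k n / (1 - e n)))) + ((1 - e n) ^+ n)%:E)%E
    @[n --> \oo] --> Phi (- (z / s%:E))%E.
  rewrite -[X in _ --> X]adde0; apply: cvgeD; first by rewrite fin_num_adde_defl.
    apply: limit.
    have u0 : - (wratio (B n) * ln (1 - e n)) @[n --> \oo] --> (0 : R).
      by rewrite -[X in _ --> X]oppr0; apply: cvgN; exact: ae.
    apply: cvg_trans (excess _ u0); apply: near_eq_cvg; near=> n.
    have n0 : (0 < n)%N by near: n; exact: nbhs_infty_gt.
    have en : 0 < e n < 1 by near: n.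
    by rewrite /= cone_excess_div ?kgt// excessE// -mulrBr.
  exact: cvg_EFin_fin.
apply: (squeeze_cvge _ lo up); near=> n.
have n0 : (0 < n)%N by near: n; exact: nbhs_infty_gt.
have en : 0 < e n < 1 by near: n.
by rewrite vol_intersection// ratio_event_le_vol ?kgt//= vol_le_ratio_event ?kgt.
Unshelve. all: by end_near. Qed.
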